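(* Let $d=3$, $\beta>0$, $\rho=\rho_{\mathrm c}=(4\pi\beta)^{-3/2}\zeta(3/2)$, and suppose $a_1=0$, i.e. $\Lambda=\mathbb T^3$. Then: (1) There exists $C>0$ such that for all $L\ge1$ $$C^{-1}L^{-3}\le \mathbb P_{L,\beta,\rho_{\mathrm c}L^3}\big(\mathcal N_L=\rho_{\mathrm c}L^3\big)\le CL^{-3}.$$ (2) If there exists $\varepsilon>0$ such that $\mathrm{dist}(x,y)>\varepsilon L$ (and the distance of both points to the boundary, if there is one, is at least $\varepsilon L$), then there exists $C>0$ such that for all $L\ge1$ $$C^{-1}L^{-1}\le\gamma_{L,\beta,\rho_{\mathrm c}}(x,y)\le CL^{-1}.$$
   Context: Setting. $\Lambda=\mathbb T^3$ is the three-dimensional torus of unit volume, $\Delta$ its Laplacian; $-\Delta$ has eigenvalues $0=\lambda_1<\lambda_2\le\lambda_3\le\dots$ with $L^2$-normalized eigenfunctions $\phi^{(k)}$. Put $\Lambda_L=L\Lambda$, with heat kernel (generator $\Delta$) $$p^{(L)}_t(x,y)=L^{-3}\sum_{k\ge1}e^{-\lambda_k tL^{-2}}\phi^{(k)}(x/L)\phi^{(k)}(y/L).$$ Let $Z(t)=\sum_{k\ge 1}e^{-\lambda_kt}$ and $t_j=\int_{\Lambda_L}p^{(L)}_{\beta j}(x,x)\,dx=Z(\beta jL^{-2})$. The first boundary heat coefficient $a_1$ is the coefficient of $t^{-1}$ in the expansion $Z(t)=a_0t^{-3/2}+a_1t^{-1}+a_2t^{-1/2}+O(1)$ as $t\to0$;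 it is $0$ for $\mathbb T^3$ (and $\mp|\partial\Lambda|/(16\pi)$ for a region with Dirichlet, respectively Neumann/Robin, boundary conditions). Loop soup. For $N\in\mathbb N$, $\mathbb P_{L,\beta,N}$ is the Poisson point process of loops with intensity measure $\sum_{j=1}^{N}\frac1j\int_{\Lambda_L}dx\,\mathbb P^{(L)}_{x,x,\beta j}$, where $\mathbb P^{(L)}_{x,y,t}$ is the unnormalized Brownian bridge measure from $x$ to $y$ in time $t$ on $\Lambda_L$, of total mass $p_t^{(L)}(x,y)$. A loop $\omega$ coming from the $j$-th term has length $\ell(\omega)=j$. Thus the numbers of loops of length $j$, $1\le j\le N$, are independent Poisson variables with means $t_j/j$. The total particle number is $\mathcal N_L=\sum_i\ell(\omega_i)$. For $\rho>0$ with $\rho L^3\in\mathbb N$ (only such $L$ are considered), the one-particle reduced density matrix is $$\gamma_{L,\beta,\rho}(x,y)=\sum_{r=1}^{\rho L^3}\frac{p^{(L)}_{\beta r}(x,y)\,\mathbb P_{L,\beta,\rho L^3}(\mathcal N_L=\rho L^3-r)}{\mathbb P_{L,\beta,\rho L^3}(\mathcal N_L=\rho L^3)} .$$ *)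

(* Defs.v *)
From HB Require Import structures.
From mathcomp Require Import all_boot all_order all_algebra.
From mathcomp Require Import all_classical all_reals all_analysis.
Set Implicit Arguments.
Unset Strict Implicit.
Unset Printing Implicit Defensive.
Import Order.TTheory GRing.Theory Num.Theory.
Import numFieldNormedType.Exports.
Local Open Scope classical_set_scope.
Local Open Scope ring_scope.

Section torus.
Variable R : realType.
Implicit Types (x y : R * R * R) (l : R) (f g : R * R * R -> R).

Definition lebesgue3 := (lebesgue_measure \x lebesgue_measure \x
  (@lebesgue_measure R : {measure set (measurableTypeR R) -> \bar R}))%E.

(* A fundamental domain of [R^3 / l Z^3], representing the torus of side [l].
   Functions on the unit torus are Z^3-periodic functions on [R^3]. *)
Definition cell l : set (R * R * R) := `[0, l[ `*` `[0, l[ `*` `[0, l[.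

Definition lattice (k : int * int * int) : R * R * R :=
  (k.1.1%:~R, k.1.2%:~R, k.2%:~R).

(* The library's norm on a product is the sup norm. *)
Definition euclidean_norm x : R :=
  Num.sqrt (x.1.1 ^+ 2 + x.1.2 ^+ 2 + x.2 ^+ 2).

Definition torus_dist l x y : R :=
  inf [set euclidean_norm (x - y + l *: lattice k) | k in [set: int * int * int]].

Definition periodic f := forall k x, f (x + lattice k) = f x.

Definition unit_vec (i : 'I_3) : R * R * R :=
  (((i : nat) == 0)%N%:R, ((i : nat) == 1)%N%:R, ((i : nat) == 2)%N%:R).

Definition partial (i : 'I_3) f : R * R * R -> R := fun x => 'D_(unit_vec i) f x.

Definition C1 f := continuous f /\ forall i,
  (forall x, derivable f x (unit_vec i)) /\ continuous (partial i f).

Definition C2 f := C1 f /\ forall i, C1 (partial i f).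

Definition laplacian f x : R := \sum_(i < 3) partial i (partial i f) x.

Definition in_eigenspace (mu : R) f :=
  [/\ periodic f, C2 f & forall x, - laplacian f x = mu * f x].

Definition L2_inner f g : R := \int[lebesgue3]_(x in cell 1) (f x * g x).

(* [lam] lists the eigenvalues of minus the Laplacian on the unit torus in
   nondecreasing order, repeated according to multiplicity, and [phi] lists real
   orthonormal eigenfunctions; the sequences start at index [0], not [1].  The
   last field says that no eigenfunction is missing. *)
Record laplace_eigenbasis (lam : nat -> R) (phi : nat -> R * R * R -> R) : Prop := {
  eigenvalue_first : lam 0 = 0 ;
  eigenvalue_gap : 0 < lam 1 ;
  eigenvalue_nondecreasing : {homo lam : i j / (i <= j)%N >-> i <= j} ;
  eigenfunction : forall k, in_eigenspace (lam k) (phi k) ;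
  eigenfunction_orthonormal :
    forall i j, L2_inner (phi i) (phi j) = (i == j)%:R ;
  eigenfunction_exhaustive : forall mu f, in_eigenspace mu f ->
    (forall k, L2_inner f (phi k) = 0) -> forall x, f x = 0 }.

Definition heat_kernel lam (phi : nat -> R * R * R -> R) l (t : R) x y : R :=
  l ^- 3 * limn (series (fun k =>
    expR (- lam k * t * l ^- 2) * phi k (l^-1 *: x) * phi k (l^-1 *: y))).

End torus.

Section paths.
Variable R : realType.

(* Continuous paths indexed by the whole line; the bridges below stand still
   outside their time interval. *)
Record torus_path (L : {posnum R}) := TorusPath {
  path_fun : R -> R * R * R ;
  path_cell : forall s, cell L%:num (path_fun s) ;
  path_continuous : forall s e, 0 < e ->
    \forall u \near s, torus_dist L%:num (path_fun s) (path_fun u) < e }.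

Lemma torus_distxx (l : R) x : torus_dist l x x = 0.
Proof.
have h0 : euclidean_norm (x - x + l *: lattice R (0, 0, 0)) = 0.
  rewrite subrr add0r /euclidean_norm /lattice /= !scaler0.
  by rewrite !expr0n /= !addr0 sqrtr0.
apply/eqP; rewrite eq_le; apply/andP; split.
  apply: ge_inf; last by exists (0, 0, 0).
  by exists 0 => _ [k _ <-]; exact: sqrtr_ge0.
apply: lb_le_inf; first by exists 0; exists (0, 0, 0).
by move=> _ [k _ <-]; exact: sqrtr_ge0.
Qed.

Lemma cell0 (L : {posnum R}) : cell L%:num (0, 0, 0).
Proof. by rewrite /cell/=; split=> //; [split|]; rewrite in_itv /= lexx /=. Qed.

Lemma cst_path_continuous (L : {posnum R}) (s e : R) : 0 < e ->
  \forall u \near s, torus_dist L%:num ((0, 0, 0) : R * R * R) (0, 0, 0) < e.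
Proof. by move=> e0; exists 1 => //= u _; rewrite torus_distxx. Qed.

Definition cst_path (L : {posnum R}) : torus_path L :=
  @TorusPath L (fun=> (0, 0, 0)) (fun=> cell0 L) (@cst_path_continuous L).

HB.instance Definition _ L := gen_eqMixin (torus_path L).
HB.instance Definition _ L := gen_choiceMixin (torus_path L).
HB.instance Definition _ L := isPointed.Build (torus_path L) (cst_path L).

Definition evaluation_events (L : {posnum R}) : set (set (torus_path L)) :=
  [set E | exists s (A : set (R * R * R)),
    measurable A /\ E = [set w | A (path_fun w s)]].

Definition path_space (L : {posnum R}) :=
  g_sigma_algebraType (@evaluation_events L).

(* For [sA = [:: (s_1, A_1); ...; (s_m, A_m)]], the iterated integral over
   [z_i] in [A_i] of
   [p (s_1 - u) x z_1 * p (s_2 - s_1) z_1 z_2 * ... * p (t - s_m) z_m y]. *)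
Fixpoint bridge_marginal (p : R -> R * R * R -> R * R * R -> R) (l t : R)
    (y : R * R * R) (u : R) (x : R * R * R) (sA : seq (R * set (R * R * R)))
    {struct sA} : \bar R :=
  if sA is (s, A) :: sA' then
    (\int[@lebesgue3 R]_(z in cell l `&` A)
      ((p (s - u) x z)%:E * bridge_marginal p l t y s z sA'))%E
  else (p (t - u) x y)%:E.

Fixpoint cylinder (L : {posnum R}) (sA : seq (R * set (R * R * R)))
    {struct sA} : set (path_space L) :=
  if sA is (s, A) :: sA' then [set w | A (path_fun w s)] `&` cylinder sA'
  else setT.

(* The empty list of times gives total mass [p t x y]. *)
Definition is_brownian_bridge p (L : {posnum R}) x y (t : R)
    (B : {measure set (path_space L) -> \bar R}) : Prop :=
  [/\ forall s, s <= 0 -> B [set w | path_fun w s <> x] = 0%E,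
      forall s, t <= s -> B [set w | path_fun w s <> y] = 0%E &
      forall sA : seq (R * set (R * R * R)),
        path <%R 0 (rcons (unzip1 sA) t) ->
        (forall i, (i < size sA)%N -> measurable (nth setT (unzip2 sA) i)) ->
        B (cylinder sA) = bridge_marginal p L%:num t y 0 x sA].

(* The first component is the length of the loop. *)
Definition loop (L : {posnum R}) : Type := (nat * path_space L)%type.

Definition loop_intensity (L : {posnum R})
    (bridge : R * R * R -> R * R * R -> R -> {measure set (path_space L) -> \bar R})
    (beta : R) (N : nat) (A : set (loop L)) : \bar R :=
  (\sum_(1 <= j < N.+1) (j%:R^-1)%:E *
    \int[@lebesgue3 R]_(x in cell L%:num)
      bridge x x (beta * j%:R)%R (xsection A j))%E.

Definition particle_number (L : {posnum R}) (s : seq (loop L)) : nat :=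
  (\sum_(w <- s) w.1)%N.

End paths.

Section poisson.
Variable R : realType.

(* Not the library's [poisson_pmf], whose value at rate [0] is constantly [1]. *)
Definition poisson_weight (r : R) (k : nat) : R := expR (- r) * r ^+ k / k`!%:R.

(* The intensity [mu] is understood to be finite, so that the process is
   realized as a random finite list of points, whose order is irrelevant. *)
Definition is_poisson_process (d d' : measure_display) (T : measurableType d)
    (E : measurableType d') (P : probability T R) (mu : set E -> \bar R)
    (xi : T -> seq E) : Prop :=
  let hits A om := count (fun w => w \in A) (xi om) in
  (forall A k, measurable A -> measurable [set om | hits A om = k]) /\
  forall m (A : 'I_m -> set E) (k : 'I_m -> nat),
    (forall i, measurable (A i)) -> trivIset setT A ->
    P [set om | forall i, hits (A i) om = k i] =
    (\prod_(i < m) poisson_weight (fine (mu (A i))) (k i))%:E.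

Definition is_loop_soup (lam : nat -> R) (phi : nat -> R * R * R -> R) (beta : R)
    (L : {posnum R}) (N : nat) (d : measure_display) (T : measurableType d)
    (P : probability T R) (xi : T -> seq (loop L)) : Prop :=
  exists bridge : R * R * R -> R * R * R -> R ->
      {measure set (path_space L) -> \bar R},
    (forall x y t, cell L%:num x -> cell L%:num y -> 0 < t ->
      is_brownian_bridge (heat_kernel lam phi L%:num) x y t (bridge x y t)) /\
    is_poisson_process P (loop_intensity bridge beta N) xi.

Definition particle_prob (L : {posnum R}) (d : measure_display)
    (T : measurableType d) (P : probability T R) (xi : T -> seq (loop L))
    (m : nat) : R :=
  fine (P [set om | particle_number (xi om) = m]).

Definition reduced_density_matrix (lam : nat -> R) (phi : nat -> R * R * R -> R)
    (beta : R) (L : {posnum R}) (N : nat) (d : measure_display)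
    (T : measurableType d) (P : probability T R) (xi : T -> seq (loop L))
    (x y : R * R * R) : R :=
  \sum_(1 <= r < N.+1)
    heat_kernel lam phi L%:num (beta * r%:R) x y * particle_prob P xi (N - r)
    / particle_prob P xi N.

Definition zeta (s : R) : R := limn (series (fun k => k.+1%:R `^ (- s))).

Definition critical_density (beta : R) : R :=
  (4 * pi * beta) `^ (- (3 / 2)) * zeta (3 / 2).

End poisson.

(* Main.v *)
(** Fourier analysis identifies the eigenspaces of the Laplacian, so that the heat kernel is
    a product of three theta functions.  Write t_j = 1 + a_j with a_j >= 0.  The loop counts
    being independent Poisson variables, P(N_L = n) exp(sum_j t_j / j) is the n-th coefficient
    of exp(sum_j t_j z^j / j), hence equals W_n = m_0 + ... + m_n, where the m_i are the
    coefficients of exp(sum_j a_j z^j / j): the constant parts of the t_j contribute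
    sum_j z^j / j, the logarithm of 1 / (1 - z).  Up to the factor exp A, A = sum_j a_j / j,
    the m_i are a compound Poisson law of mean sum_j a_j and variance sum_j j a_j.  As the
    boundary coefficient a_1 vanishes, at the critical density the mean is N + O(L^2) and the
    variance O(L^4).  Trivially W_N <= exp A; conversely, tilting the law by exp(- s i) with s
    of order L^-2 lowers its mean by a large multiple of L^2, and Chebyshev's inequality gives
    W_n >= c exp A for all n >= N - kappa L^2.  Since sum_{j <= N} 1 / j is log N + O(1), this
    proves (1).

    In (2) the quotients of probabilities are W_{N-r} / W_N <= 1, and their sum over r is
    O(L^2) by the second moment bound.  For distant points the kernel is at most
    C L^-3 (1 + decay(r / L^2)), where decay(r / L^2) sums to O(L^2) as well; this is the upper
    bound.  For the lower bound it suffices to keep the terms with r of order L^2, where the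
    kernel is at least L^-3 / 2, and, for bounded L, the term r = N. *)

From HB Require Import structures.
Require Import Defs.
From mathcomp Require Import all_boot all_order all_algebra.
From mathcomp Require Import all_classical all_reals all_analysis.
From mathcomp Require Import measurable_realfun zify ring lra.
Set Implicit Arguments.
Unset Strict Implicit.
Unset Printing Implicit Defensive.
Import Order.TTheory GRing.Theory Num.Theory.
Import numFieldNormedType.Exports.
Local Open Scope classical_set_scope.
Local Open Scope ring_scope.

(** * Spectral decomposition of the torus Laplacian *)

(** The crux is the size of the error in the heat trace. As the time step is of order L^-2, an error
    of order 1/t sums over j <= N to L^2 log L and would spoil the O(L^2) estimate of the mean. A
    nonzero a_1 produces just such an error, and so does comparing theta series with the Gauss
    integral by monotonicity, which leaves O(1) in each factor. The error O(t^(-1/2)) is reached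
    without Poisson summation: summation by parts bounds theta at pi, a duplication formula relates
    the parameters a and 4 a, and telescoping along a / 4^k leaves only the limit to the monotone
    comparison. The offset of the mean from N and the standard deviation are bounded by multiples of
    the same L^2, with constants that are not small, so Chebyshev's inequality alone says nothing
    about W_N. Tilting with s = sg / L^2 helps because the singularity t^(-3/2) of the heat trace
    makes the drop of the mean of order sqrt(sg) L^2, unbounded in sg, at a cost independent of L.
    The eigenbasis is arbitrary, and its completeness is given only within eigenspaces; each
    eigenspace is therefore handled through its reproducing kernel. *)

Section unit_cell_integral.
Variable R : realType.
Notation MR := (measurableTypeR R).
Notation mu := (@lebesgue_measure R).
Implicit Types f g h : R * R * R -> R.

Definition lebesgue2 : set (MR * MR) -> \bar R := (mu \x mu)%E.

HB.instance Definition _ := Measure.on lebesgue2.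

(** [lebesgue3] associates to the left, so Fubini against its last coordinate needs the product of
    the first two measures to be sigma-finite. *)
Lemma lebesgue2_sigma_finite : sigma_finite setT lebesgue2.
Proof.
have /sigma_finiteP[F [TF ndF Foo]] := sigma_finiteT mu.
exists (fun n => F n `*` F n).
  rewrite -setXTT TF predeqE => -[x y]; split.
    move=> [/= [n _ Fnx] [k _ Gky]]; exists (maxn n k) => //; split.
    - by move: x Fnx; exact/subsetPset/ndF/leq_maxl.
    - by move: y Gky; exact/subsetPset/ndF/leq_maxr.
  by move=> [n _ []/= ? ?]; split; exists n.
move=> k; have [? ?] := Foo k.
split; first exact: measurableX.
by rewrite /lebesgue2 product_measure1E// lte_mul_pinfty// ge0_fin_numE.
Qed.

HB.instance Definition _ :=
  Measure_isSigmaFinite.Build _ _ _ lebesgue2 lebesgue2_sigma_finite.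

Lemma floor_approx_cvg (x : R) :
  ((Num.floor (x * n.+1%:R))%:~R / n.+1%:R : R) @[n --> \oo] --> x.
Proof.
apply/cvgrPdist_le => e e0.
have : (n.+1%:R^-1 : R) @[n --> \oo] --> 0 by exact: cvg_harmonic.
move/cvgrPdist_le => /(_ _ e0); apply: filterS => n.
rewrite sub0r normrN ger0_norm// => ne; apply: le_trans ne.
have n0 : 0 < n.+1%:R :> R by [].
have /andP[h1 h2] := floor_itv (x * n.+1%:R).
have e1 : (Num.floor (x * n.+1%:R))%:~R / n.+1%:R <= x by rewrite ler_pdivrMr.
have e2 : x <= ((Num.floor (x * n.+1%:R))%:~R + 1) / n.+1%:R.
  by rewrite ler_pdivlMr// ltW// -intrD1.
by rewrite ger0_norm ?subr_ge0// lerBlDl (le_trans e2)// mulrDl mul1r.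
Qed.

(** The measurable sets are those of the product sigma-algebra. Rounding each coordinate down to a
    grid of mesh 1/(n+1) turns [f] into a function constant on countably many half-open boxes, and
    these functions converge to [f] pointwise by continuity. *)
Lemma measurable_continuous3 f : continuous f ->
  measurable_fun (setT : set (MR * MR * MR)) (f : MR * MR * MR -> MR).
Proof.
move=> cf.
pose q n (r : R) : R := (Num.floor (r * n.+1%:R))%:~R / n.+1%:R.
pose fn n (x : MR * MR * MR) := f (q n x.1.1, q n x.1.2, q n x.2).
apply: (@measurable_realfun.measurable_fun_cvg _ _ R setT fn f); last first.
  move=> [[x y] z] _; rewrite /fn /=.
  have H : ((q n x, q n y, q n z) : R * R * R) @[n --> \oo] --> ((x, y), z).
    exact: cvg_pair (cvg_pair (@floor_approx_cvg x) (@floor_approx_cvg y))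
      (@floor_approx_cvg z).
  exact: (cvg_comp _ _ H (cf _)).
move=> n _ Y mY; rewrite setTI.
pose c (i : int) : set MR := [set` `[i%:~R / n.+1%:R, (i + 1)%:~R / n.+1%:R[].
have mc i : measurable (c i) by exact: measurable_itv.
have cE (r : R) i : c i r -> Num.floor (r * n.+1%:R) = i.
  rewrite /c/= in_itv/= ler_pdivrMr// ltr_pdivlMr// => /andP[h1 h2].
  by apply: floor_def; rewrite h1 h2.
have cq (r : R) : c (Num.floor (r * n.+1%:R)) r.
  by rewrite /c/= in_itv/= ler_pdivrMr// ltr_pdivlMr// floor_itv.
pose p (i : int) : R := i%:~R / n.+1%:R.
rewrite (_ : fn n @^-1` Y = \bigcup_(k : int * int * int)
   (if f (p k.1.1, p k.1.2, p k.2) \in Y then c k.1.1 `*` c k.1.2 `*` c k.2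
    else set0)).
  apply: countable_bigcupT_measurable => // -[[i j] k] /=.
  by case: ifP => // _; apply: measurableX => //; apply: measurableX.
apply/seteqP; split => [[[x y] z]|[[x y] z] [[[i j] k] _]] /=.
  move=> Yx; exists (Num.floor (x * n.+1%:R), Num.floor (y * n.+1%:R),
    Num.floor (z * n.+1%:R)) => //=.
  by rewrite mem_set.
case: ifPn => // /set_mem Yp [[/= /cE cx /cE cy] /cE cz].
by rewrite /fn /q /= cx cy cz.
Qed.

Lemma measurable_cell (l : R) : measurable (cell l : set (MR * MR * MR)).
Proof. by apply: measurableX => //; exact: measurableX. Qed.

Lemma lebesgue3_cell (l : R) : 0 <= l -> lebesgue3 (cell l) = (l ^+ 3)%:E.
Proof.
move=> l0.
rewrite /lebesgue3 /cell product_measure1E//; last exact: measurableX.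
rewrite /= product_measure1E//=.
rewrite lebesgue_measure_itv/= lte_fin; case: ltP => l0'.
  by rewrite -!EFinD -!EFinM !subr0 !exprS expr0 mulr1 mulrA.
by rewrite !mule0 (_ : l = 0) ?expr0n//; apply/eqP; rewrite eq_le l0'.
Qed.

Lemma continuous3_bounded f (l : R) : continuous f ->
  exists M : R, forall x, cell l x -> `|f x| <= M.
Proof.
move=> cf.
have cc : compact (`[0, l]%classic `*` `[0, l]%classic `*` `[0, l]%classic : set (R * R * R)).
  by apply: compact_setX; [apply: compact_setX|]; exact: segment_compact.
have /compact_bounded := continuous_compact (continuous_subspaceT cf) cc.
move=> [M [_ /(_ (M + 1))]]; rewrite ltrDl ltr01 => /(_ isT) H.
exists (M + 1) => -[[x y] z] [[/= cx cy] cz].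
apply: H; exists ((x, y), z) => //=.
by split; [split|] => /=; exact: subset_itv_co_cc.
Qed.

Lemma integrable_cell f (l : R) : 0 <= l -> continuous f ->
  (@lebesgue3 R).-integrable (cell l) (EFin \o f).
Proof.
move=> l0 cf; apply: measurable_bounded_integrable.
- exact: measurable_cell.
- by rewrite -[X in (X < _)%E]/(lebesgue3 (cell l)) lebesgue3_cell// ltry.
- by apply: measurable_funTS; exact: measurable_continuous3.
- have [M fM] := @continuous3_bounded _ l cf.
  exists M; split; first exact: num_real.
  by move=> r Mr x cx; exact: le_trans (fM _ cx) (ltW Mr).
Qed.
End unit_cell_integral.

Section fubini_cell.
Variable R : realType.
Notation MR := (measurableTypeR R).
Notation mu := (@lebesgue_measure R).
Implicit Types f g h : R * R * R -> R.

Let co : set MR := [set` `[0 : R, 1[].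

Let mco : measurable co. Proof. exact: measurable_itv. Qed.

Let cellE x y z :
  ((x, y, z) \in @cell R 1) = (x \in co) && (y \in co) && (z \in co).
Proof. by rewrite /cell !in_setX. Qed.

Lemma integrable_slice g z : continuous g ->
  (mu \x mu)%E.-integrable setT
    (fun w : MR * MR => (((EFin \o g) \_ (cell 1)) (w, z)) : \bar R).
Proof.
move=> cg; have [M gM] := @continuous3_bounded R g 1 cg.
have mg := @measurable_continuous3 R g cg.
have [zco|zco] := boolP (z \in co); last first.
  rewrite (_ : (fun w => _) = cst 0%E); first exact: integrable0.
  by apply/funext => -[x y]; rewrite patchE cellE (negbTE zco) andbF.
rewrite (_ : (fun w => _) = (EFin \o (fun w => g (w, z))) \_ (co `*` co)); last first.
  by apply/funext => -[x y]; rewrite !patchE cellE zco andbT in_setX.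
apply/(integrable_mkcond _ (measurableX mco mco)).
apply: measurable_bounded_integrable; first exact: measurableX.
- have muco : mu co = 1%:E.
    by rewrite /co lebesgue_measure_itv/= lte_fin ltr01 oppr0 adde0.
  have e : ((mu \x mu)%E (co `*` co) < +oo)%E.
    rewrite product_measure1E//.
    by rewrite (_ : (_ * _)%E = (mu co * mu co)%E)// muco mule1 ltry.
  exact: e.
- apply: measurable_funTS.
  have mz : measurable_fun setT (fun w : MR * MR => (w, z) : MR * MR * MR).
    by apply: measurable_fun_pair => //; exact: measurable_cst.
  exact: (measurableT_comp mg mz).
- exists M; split; first exact: num_real.
  move=> r Mr -[x y] cxy; apply: le_trans (ltW Mr).
  by apply: gM; rewrite /cell; split => //; exact: set_mem.
Qed.

(** Fubini, in whichever order puts the direction with vanishing line integrals innermost;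
    [integrable_slice] serves the two orders that separate the first two coordinates. *)
Lemma integral_cell_eq0 g : continuous g ->
  [\/ forall x y, (\int[mu]_(s in co) (g (x, y, s))%:E = 0)%E,
      forall y z, (\int[mu]_(s in co) (g (s, y, z))%:E = 0)%E |
      forall x z, (\int[mu]_(s in co) (g (x, s, z))%:E = 0)%E] ->
  \int[@lebesgue3 R]_(x in cell 1) g x = 0.
Proof.
move=> cg H.
have ig := @integrable_cell R g 1 ler01 cg.
rewrite /Rintegral (_ : (\int[_]_(_ in _) _)%E = 0%E)//.
rewrite integral_mkcond.
pose F : MR * MR * MR -> \bar R := ((EFin \o g) \_ (cell 1)).
have FE x y z : F (x, y, z) =
    if (x \in co) && (y \in co) && (z \in co) then (g (x, y, z))%:E else 0%E.
  by rewrite /F patchE cellE.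
have iF3 : (@lebesgue3 R).-integrable setT F.
  by apply/(integrable_mkcond _ (@measurable_cell R 1)).
have iF : (@lebesgue2 R \x mu)%E.-integrable setT F := iF3.
case: H => H.
- rewrite -[LHS](integral12_prod_meas1 iF) /fubini_F /=.
  apply: integral0_eq => -[x y] _.
  under eq_integral do rewrite FE.
  case: (boolP ((x \in co) && (y \in co))) => /= _; last first.
    by apply: integral0_eq.
  rewrite -[RHS](H x y) [RHS]integral_mkcond.
  by apply: eq_integral => z _; rewrite patchE.
- rewrite -[LHS](integral21_prod_meas1 iF) /fubini_G /=.
  apply: integral0_eq => z _.
  rewrite -[LHS](integral21_prod_meas1 (@integrable_slice g z cg)) /fubini_G /=.
  apply: integral0_eq => y _.
  under eq_integral do rewrite -/F FE -andbA.
  case: (boolP ((y \in co) && (z \in co))) => /= _; last first.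
    by apply: integral0_eq => x _; rewrite andbF.
  rewrite -[RHS](H y z) [RHS]integral_mkcond.
  by apply: eq_integral => x _; rewrite patchE andbT.
- rewrite -[LHS](integral21_prod_meas1 iF) /fubini_G /=.
  apply: integral0_eq => z _.
  rewrite -[LHS](integral12_prod_meas1 (@integrable_slice g z cg)) /fubini_F /=.
  apply: integral0_eq => x _.
  under eq_integral do rewrite -/F FE andbAC.
  case: (boolP ((x \in co) && (z \in co))) => /= _; last first.
    by apply: integral0_eq.
  rewrite -[RHS](H x z) [RHS]integral_mkcond.
  by apply: eq_integral => y _; rewrite patchE.
Qed.
End fubini_cell.

(** * Integration over a period cell and derivatives along lines *)

Section green.
Variable R : realType.
Notation mu := (@lebesgue_measure R).
Implicit Types f g h : R * R * R -> R.

Definition cell_integral f : R := \int[@lebesgue3 R]_(x in cell 1) f x.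

Lemma cell_integralD f g : continuous f -> continuous g ->
  cell_integral (fun x => f x + g x) = cell_integral f + cell_integral g.
Proof.
move=> cf cg; apply: RintegralD; first exact: measurable_cell.
- exact: integrable_cell.
- exact: integrable_cell.
Qed.

Lemma cell_integralZ (c : R) f : continuous f ->
  cell_integral (fun x => c * f x) = c * cell_integral f.
Proof.
move=> cf; apply: RintegralZl; first exact: measurable_cell.
exact: integrable_cell.
Qed.

Lemma cell_integral_cst (c : R) : cell_integral (fun=> c) = c.
Proof.
rewrite /cell_integral Rintegral_cst; last exact: measurable_cell.
rewrite (_ : fine _ = 1) ?mulr1//.
have e : lebesgue3 (@cell R 1) = 1%:E by rewrite lebesgue3_cell// expr1n.
by rewrite -[RHS]/(fine 1%:E) -e.
Qed.

Lemma cell_integral_sum (T : Type) (s : seq T) (P : pred T) (F : T -> R * R * R -> R) :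
  (forall i, P i -> continuous (F i)) ->
  cell_integral (fun x => \sum_(i <- s | P i) F i x) =
  \sum_(i <- s | P i) cell_integral (F i).
Proof.
move=> cF; elim: s => [|a s IH].
  rewrite big_nil -[RHS](cell_integral_cst 0).
  by congr cell_integral; apply/funext => x; rewrite big_nil.
rewrite big_cons; case: ifPn => [Pa|/negbTE Pa].
  rewrite -IH -cell_integralD//; last 2 first.
  - exact: cF.
  - by apply: continuous_big => //; exact: add_continuous.
  by congr cell_integral; apply/funext => x; rewrite big_cons Pa.
by rewrite -IH; congr cell_integral; apply/funext => x; rewrite big_cons Pa.
Qed.

Lemma cell_integral_le f g : continuous f -> continuous g ->
  (forall x, f x <= g x) -> cell_integral f <= cell_integral g.
Proof.
move=> cf cg fg; apply: le_Rintegral => //; first exact: measurable_cell.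
- exact: integrable_cell.
- exact: integrable_cell.
Qed.

Lemma cell_integral_norm f : continuous f ->
  `|cell_integral f| <= cell_integral (fun x => `|f x|).
Proof.
move=> cf; apply: le_normr_Rintegral; first exact: measurable_cell.
exact: integrable_cell.
Qed.

Lemma is_derive_line f (x v : R * R * R) (s : R) : derivable f (x + s *: v) v ->
  is_derive s 1 (fun r : R => f (x + r *: v)) ('D_v f (x + s *: v)).
Proof.
move=> df.
have E : (fun h : R => h^-1 *: (((fun r : R => f (x + r *: v)) \o shift s) (h *: (1 : R)) - f (x + s *: v)))
   = (fun h : R => h^-1 *: ((f \o shift (x + s *: v)) (h *: v) - f (x + s *: v))).
  apply/funext => h /=; congr (_ *: (f _ - _)).
  by rewrite [h *: 1]mulr1 scalerDl addrCA.
split.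
  by rewrite /derivable E.
by rewrite /derive E.
Qed.

Lemma integral_line_derive f (x v : R * R * R) :
  (forall y, derivable f y v) -> continuous (fun y => 'D_v f y) ->
  (\int[mu]_(s in [set` `[0%R : R, 1%R[]) ('D_v f (x + s *: v))%:E =
   (f (x + v) - f x)%:E)%E.
Proof.
move=> df cf.
pose G (r : R) : R := f (x + r *: v).
have cl : continuous (fun r : R => x + r *: v).
  move=> r; apply: cvgD; first exact: cvg_cst.
  by apply: cvgZl.
have cG' : continuous (fun r : R => 'D_v f (x + r *: v)).
  by move=> r; apply: (cvg_comp _ _ (cl r) (cf _)).
have dG (r : R) := is_derive_line (df (x + r *: v)).
have cG : continuous G.
  move=> r; apply: differentiable_continuous; apply/derivable1_diffP.
  by have [] := dG r.
have : (\int[mu]_(s in `[0%R, 1%R]) ('D_v f (x + s *: v))%:E = (G 1)%:E - (G 0)%:E)%E.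
  apply: continuous_FTC2 => //.
  - exact: continuous_subspaceT.
  - split.
    + by move=> r _; have [] := dG r.
    + exact/cvg_at_right_filter/cG.
    + exact/cvg_at_left_filter/cG.
  - by move=> r _; rewrite derive1E; apply: (@derive_val _ _ _ _ _ _ _ (dG r)).
rewrite /G scale1r scale0r addr0 -EFinB => <-.
rewrite integral_itv_bndo_bndc//.
apply/measurable_EFinP/measurable_funTS; exact: continuous_measurable_fun.
Qed.
End green.

Section eigenfunctions.
Variable R : realType.
Implicit Types f g h : R * R * R -> R.

(** By the fundamental theorem of calculus the integral along a unit segment is a difference of
    values one period apart. *)
Lemma cell_integral_partial i f : Defs.periodic f ->
  (forall x, derivable f x (unit_vec R i)) -> continuous (partial i f) ->
  cell_integral (partial i f) = 0.
Proof.
move=> pf df cf; apply: integral_cell_eq0 => //.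
have pv x : f (x + unit_vec R i) = f x.
  have := pf (((i : nat) == 0)%N%:R, ((i : nat) == 1)%N%:R, ((i : nat) == 2)%N%:R) x.
  by rewrite /lattice /unit_vec /= !natz -!pmulrn.
have L x := integral_line_derive x df cf.
have {}L x : (\int[@lebesgue_measure R]_(s in [set` `[0%R : R, 1%R[])
    (partial i f (x + s *: unit_vec R i))%:E = 0)%E.
  by rewrite L pv subrr.
case: i df cf pv L => -[|[|[|//]]] i3 df cf pv L.
- apply: Or32 => y z; rewrite -[RHS](L (0, y, z)).
  apply: eq_integral => s _; congr ((partial _ f _)%:E).
  rewrite [(0, y, z) + _](_ : _ = ((0 + s * 1, y + s * 0), z + s * 0))//.
  by rewrite mulr1 !mulr0 add0r !addr0.
- apply: Or33 => x z; rewrite -[RHS](L (x, 0, z)).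
  apply: eq_integral => s _; congr ((partial _ f _)%:E).
  rewrite [(x, 0, z) + _](_ : _ = ((x + s * 0, 0 + s * 1), z + s * 0))//.
  by rewrite mulr1 !mulr0 add0r !addr0.
- apply: Or31 => x y; rewrite -[RHS](L (x, y, 0)).
  apply: eq_integral => s _; congr ((partial _ f _)%:E).
  rewrite [(x, y, 0) + _](_ : _ = ((x + s * 0, y + s * 0), 0 + s * 1))//.
  by rewrite mulr1 !mulr0 add0r !addr0.
Qed.

Lemma continuousM_fun f g : continuous f -> continuous g ->
  continuous (fun x => f x * g x).
Proof. by move=> cf cg x; apply: cvgM; [exact: cf|exact: cg]. Qed.

Lemma continuousB_fun f g : continuous f -> continuous g ->
  continuous (fun x => f x - g x).
Proof. by move=> cf cg x; apply: cvgB; [exact: cf|exact: cg]. Qed.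

Lemma L2_innerC f g : L2_inner f g = L2_inner g f.
Proof. by apply: eq_Rintegral => x _; rewrite mulrC. Qed.

(** Green's identity: [f] times the Laplacian of [g], minus the same with the roles exchanged, is
    the divergence of the field [F], whose integral over a period cell vanishes. *)
Lemma eigenspace_orthogonal (mu nu : R) f g :
  in_eigenspace mu f -> in_eigenspace nu g -> mu != nu -> L2_inner f g = 0.
Proof.
move=> [pf [[cf df] d2f] ef] [pg [[cg dg] d2g] eg] mn.
have cfg : continuous (fun x => f x * g x) by exact: continuousM_fun.
pose F i := (f * partial i g - g * partial i f : R * R * R -> R).
have dF i x : is_derive x (unit_vec R i) (F i)
    (f x * partial i (partial i g) x - g x * partial i (partial i f) x).
  have [df1 _] := df i; have [dg1 _] := dg i.
  have [_ /(_ i)[df2 _]] := d2f i; have [_ /(_ i)[dg2 _]] := d2g i.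
  have M1 := derivableM (df1 x) (dg2 x).
  have M2 := derivableM (dg1 x) (df2 x).
  split; first exact: (derivableB M1 M2).
  rewrite (deriveB M1 M2) (deriveM (df1 x) (dg2 x)) (deriveM (dg1 x) (df2 x)).
  rewrite -/(partial i f x) -/(partial i g x).
  rewrite -/(partial i (partial i f) x) -/(partial i (partial i g) x).
  move: (f x) (g x) (partial i f x) (partial i g x)
    (partial i (partial i f) x) (partial i (partial i g) x) => a b c e p q.
  by rewrite /GRing.scale /=; ring.
have pF i : partial i (F i) =
    (fun x => f x * partial i (partial i g) x - g x * partial i (partial i f) x).
  by apply/funext => x; rewrite /partial (@derive_val _ _ _ _ _ _ _ (dF i x)).
have cF i : continuous (partial i (F i)).
  have [_ /(_ i)[_ cf2]] := d2f i; have [_ /(_ i)[_ cg2]] := d2g i.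
  by rewrite pF; apply: continuousB_fun; exact: continuousM_fun.
have perp h i : Defs.periodic h -> Defs.periodic (partial i h).
  move=> ph k x; rewrite /partial /derive.
  suff -> : (fun s : R => s^-1 *: ((h \o shift (x + lattice R k)) (s *: unit_vec R i)
      - h (x + lattice R k))) =
    (fun s : R => s^-1 *: ((h \o shift x) (s *: unit_vec R i) - h x)) by [].
  by apply/funext => s /=; rewrite addrA !ph.
have I0 i : cell_integral (partial i (F i)) = 0.
  apply: cell_integral_partial => //.
  move=> k x; rewrite /F /=.
  rewrite -[LHS]/(f (x + lattice R k) * partial i g (x + lattice R k) -
     g (x + lattice R k) * partial i f (x + lattice R k)).
  by rewrite pf pg !perp.
have : cell_integral (fun x => \sum_(i < 3) partial i (F i) x) = 0.
  by rewrite cell_integral_sum// big1.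
have -> : (fun x => \sum_(i < 3) partial i (F i) x) =
    (fun x => (mu - nu) * (f x * g x)).
  apply/funext => x; under eq_bigr do rewrite pF.
  transitivity (f x * laplacian g x - g x * laplacian f x).
    by rewrite /laplacian !mulr_sumr -sumrB.
  have lf : laplacian f x = - (mu * f x) by rewrite -ef opprK.
  have lg : laplacian g x = - (nu * g x) by rewrite -eg opprK.
  rewrite {}lf {}lg; move: (f x) (g x) => a b.
  by ring.
rewrite cell_integralZ// => /eqP; rewrite mulf_eq0 subr_eq0 (negbTE mn) => I.
exact/eqP.
Qed.
End eigenfunctions.

(** * Products of cosine waves as eigenfunctions *)

Section product_eigenfunctions.
Variable R : realType.
Implicit Types G : 'I_3 -> R -> R.

Definition prod3 G (x : R * R * R) : R :=
  G (@Ordinal 3 0 isT) x.1.1 * G (@Ordinal 3 1 isT) x.1.2 * G (@Ordinal 3 2 isT) x.2.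

Definition derive_at G (i : 'I_3) : 'I_3 -> R -> R :=
  fun j => if j == i then (derive1 (G j)) else G j.

Lemma is_derive_prod3 G (i : 'I_3) (x : R * R * R) :
  (forall s, derivable (G i) s 1) ->
  is_derive x (unit_vec R i) (prod3 G) (prod3 (derive_at G i) x).
Proof.
move=> dG.
have key (g : R -> R) (c s : R) (q : R -> R) :
  derivable g s 1 -> q = (fun h => h^-1 *: ((g \o shift s) (h *: 1) - g s) * c) ->
  q h @[h --> 0^'] --> derive1 g s * c.
  by move=> dg ->; apply: cvgMl; rewrite derive1E; exact: dg.
have H : (h^-1 *: ((prod3 G \o shift x) (h *: unit_vec R i) - prod3 G x)) @[h --> 0^']
    --> prod3 (derive_at G i) x.
  case: i dG x => -[|[|[|//]]] i3 dG [[x y] z].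
  - have e : Ordinal i3 = @Ordinal 3 0 isT by exact: val_inj.
    rewrite {}e in dG *.
    rewrite [X in _ --> X](_ : _ = derive1 (G (@Ordinal 3 0 isT)) x *
        (G (@Ordinal 3 1 isT) y * G (@Ordinal 3 2 isT) z)); last first.
      by rewrite /prod3 /derive_at /=; ring.
    apply: key => //; apply/funext => h /=.
    rewrite [h *: unit_vec _ _ + _](_ : _ =
      ((h * 1 + x, h * 0 + y), h * 0 + z))// [h%:A]mulr1.
    by rewrite /prod3 /= mulr1 !mulr0 !add0r /GRing.scale /=; ring.
  - have e : Ordinal i3 = @Ordinal 3 1 isT by exact: val_inj.
    rewrite {}e in dG *.
    rewrite [X in _ --> X](_ : _ = derive1 (G (@Ordinal 3 1 isT)) y *
        (G (@Ordinal 3 0 isT) x * G (@Ordinal 3 2 isT) z)); last first.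
      by rewrite /prod3 /derive_at /=; ring.
    apply: key => //; apply/funext => h /=.
    rewrite [h *: unit_vec _ _ + _](_ : _ =
      ((h * 0 + x, h * 1 + y), h * 0 + z))// [h%:A]mulr1.
    by rewrite /prod3 /= mulr1 !mulr0 !add0r /GRing.scale /=; ring.
  - have e : Ordinal i3 = @Ordinal 3 2 isT by exact: val_inj.
    rewrite {}e in dG *.
    rewrite [X in _ --> X](_ : _ = derive1 (G (@Ordinal 3 2 isT)) z *
        (G (@Ordinal 3 0 isT) x * G (@Ordinal 3 1 isT) y)); last first.
      by rewrite /prod3 /derive_at /=; ring.
    apply: key => //; apply/funext => h /=.
    rewrite [h *: unit_vec _ _ + _](_ : _ =
      ((h * 0 + x, h * 0 + y), h * 1 + z))// [h%:A]mulr1.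
    by rewrite /prod3 /= mulr1 !mulr0 !add0r /GRing.scale /=; ring.
split; first by apply/cvg_ex; exists (prod3 (derive_at G i) x).
exact: cvg_lim.
Qed.

Lemma continuous_prod3 G : (forall i, continuous (G i)) -> continuous (prod3 G).
Proof.
move=> cG x.
have c1 : continuous (fun x : R * R * R => x.1.1).
  by move=> u; exact: (cvg_comp _ _ (@cvg_fst _ _ _ _ _) (@cvg_fst _ _ _ _ _)).
have c2 : continuous (fun x : R * R * R => x.1.2).
  by move=> u; exact: (cvg_comp _ _ (@cvg_fst _ _ _ _ _) (@cvg_snd _ _ _ _ _)).
have c3 : continuous (fun x : R * R * R => x.2) by move=> u; exact: cvg_snd.
by apply: cvgM; [apply: cvgM|];
  [exact: (cvg_comp _ _ (c1 x) (cG _ _))|exact: (cvg_comp _ _ (c2 x) (cG _ _))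
  |exact: (cvg_comp _ _ (c3 x) (cG _ _))].
Qed.

Lemma partial_prod3 G i : (forall s, derivable (G i) s 1) ->
  partial i (prod3 G) = prod3 (derive_at G i).
Proof.
move=> dG; apply/funext => x; rewrite /partial.
exact: (@derive_val _ _ _ _ _ _ _ (is_derive_prod3 x dG)).
Qed.

Lemma C1_prod3 G : (forall i s, derivable (G i) s 1) ->
  (forall i, continuous (derive1 (G i))) -> C1 (prod3 G).
Proof.
move=> dG cG.
have cG0 i : continuous (G i).
  by move=> s; apply: differentiable_continuous; apply/derivable1_diffP.
split; first exact: continuous_prod3.
move=> i; split; first by move=> x; have [] := is_derive_prod3 x (dG i).
rewrite partial_prod3//; apply: continuous_prod3 => j.
by rewrite /derive_at; case: ifP.
Qed.

Lemma C2_prod3 G : (forall i s, derivable (G i) s 1) ->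
  (forall i s, derivable (derive1 (G i)) s 1) ->
  (forall i, continuous (derive1 (derive1 (G i)))) -> C2 (prod3 G).
Proof.
move=> dG ddG cG.
have cG1 i : continuous (derive1 (G i)).
  by move=> s; apply: differentiable_continuous; apply/derivable1_diffP.
split; first exact: C1_prod3.
move=> i; rewrite partial_prod3//; apply: C1_prod3.
  by move=> j s; rewrite /derive_at; case: ifP.
by move=> j; rewrite /derive_at; case: ifP.
Qed.

Lemma laplacian_prod3 G (k : 'I_3 -> R) : (forall i s, derivable (G i) s 1) ->
  (forall i s, derivable (derive1 (G i)) s 1) ->
  (forall i s, (derive1 (derive1 (G i))) s = - k i * G i s) ->
  forall x, laplacian (prod3 G) x = - (\sum_i k i) * prod3 G x.
Proof.
move=> dG ddG kG x; rewrite /laplacian mulNr mulr_suml -sumrN.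
apply: eq_bigr => i _; rewrite partial_prod3//.
rewrite partial_prod3; last by move=> s; rewrite /derive_at eqxx.
case: i => -[|[|[|//]]] i3.
- have -> : Ordinal i3 = @Ordinal 3 0 isT by exact: val_inj.
  by rewrite /prod3 /derive_at /= kG; ring.
- have -> : Ordinal i3 = @Ordinal 3 1 isT by exact: val_inj.
  by rewrite /prod3 /derive_at /= kG; ring.
- have -> : Ordinal i3 = @Ordinal 3 2 isT by exact: val_inj.
  by rewrite /prod3 /derive_at /= kG; ring.
Qed.

(** Waves centred at an arbitrary point [a] carry both phases, so that cosines alone span every
    eigenspace. *)
Definition coswave (m : nat) (a s : R) : R := cos (2 * pi * m%:R * (a - s)).

Lemma cosDint (x : R) (k : int) : cos (x + 2 * pi * k%:~R) = cos x.
Proof.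
have H n (y : R) : cos (y + 2 * pi * n%:R) = cos y.
  rewrite -(periodicn (@cosD2pi R) n y); congr cos.
  by rewrite -mulrnA -[pi *+ _]mulr_natr natrM; ring.
case: k => n; first exact: H.
rewrite -[LHS](H n.+1); congr cos; rewrite NegzE rmorphN /= -pmulrn.
by ring.
Qed.

Lemma coswaveD (m : nat) (a s : R) (k : int) : coswave m a (s + k%:~R) = coswave m a s.
Proof.
rewrite /coswave -[RHS](cosDint _ (- (m%:Z * k))); congr cos.
by rewrite rmorphN rmorphM /= -pmulrn; ring.
Qed.

Lemma is_derive_coswave m a (s : R) : is_derive s 1 (coswave m a)
  (2 * pi * m%:R * sin (2 * pi * m%:R * (a - s))).
Proof.
rewrite /coswave; apply: is_derive_eq.
by rewrite /GRing.scale /=; ring.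
Qed.

Lemma is_derive_sinwave m a (s : R) : is_derive s 1
  (fun s => 2 * pi * m%:R * sin (2 * pi * m%:R * (a - s)))
  (- (4 * pi ^+ 2 * m%:R ^+ 2) * coswave m a s).
Proof.
rewrite /coswave; apply: is_derive_eq.
by rewrite /GRing.scale /=; ring.
Qed.

Lemma coswave_derive1 m a : (derive1 (coswave m a)) =
  (fun s => 2 * pi * m%:R * sin (2 * pi * m%:R * (a - s))).
Proof.
apply/funext => s; rewrite derive1E.
exact: (@derive_val _ _ _ _ _ _ _ (is_derive_coswave m a s)).
Qed.

Lemma coswave_derive2 m a :
  (derive1 (derive1 (coswave m a))) = (fun s => - (4 * pi ^+ 2 * m%:R ^+ 2) * coswave m a s).
Proof.
rewrite coswave_derive1; apply/funext => s; rewrite derive1E.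
exact: (@derive_val _ _ _ _ _ _ _ (is_derive_sinwave m a s)).
Qed.

Definition coord (x : R * R * R) (i : 'I_3) : R :=
  if i == 0 :> nat then x.1.1 else if i == 1 :> nat then x.1.2 else x.2.

Definition plane_wave (m : 'I_3 -> nat) (x y : R * R * R) : R :=
  prod3 (fun i => coswave (m i) (coord x i)) y.

Definition sqnorm (m : 'I_3 -> nat) : nat := (\sum_i m i ^ 2)%N.

Lemma continuous_coswave m a : continuous (coswave m a).
Proof.
move=> s; apply: differentiable_continuous; apply/derivable1_diffP.
by have [] := is_derive_coswave m a s.
Qed.

Lemma plane_wave_eigen (m : 'I_3 -> nat) (x : R * R * R) :
  in_eigenspace (4 * pi ^+ 2 * (sqnorm m)%:R) (plane_wave m x).
Proof.
have d1 i (s : R) : derivable (coswave (m i) (coord x i)) s 1.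
  by have [] := is_derive_coswave (m i) (coord x i) s.
have d2 i (s : R) : derivable (derive1 (coswave (m i) (coord x i))) s 1.
  by rewrite coswave_derive1; have [] := is_derive_sinwave (m i) (coord x i) s.
split.
- by move=> [[k1 k2] k3] [[y1 y2] y3]; rewrite /plane_wave /prod3 /= !coswaveD.
- apply: (C2_prod3 d1 d2) => i; rewrite coswave_derive2 => s.
  by apply: cvgM; [exact: cvg_cst|exact: continuous_coswave].
- move=> y; have kE i (s : R) : derive1 (derive1 (coswave (m i) (coord x i))) s =
      - (4 * pi ^+ 2 * (m i)%:R ^+ 2) * coswave (m i) (coord x i) s.
    by rewrite coswave_derive2.
  rewrite /plane_wave (laplacian_prod3 d1 d2 kE) mulNr opprK; congr (_ * _).
  by rewrite -mulr_sumr /sqnorm natr_sum; under [in RHS]eq_bigr do rewrite natrX.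
Qed.
End product_eigenfunctions.

(** * Fejer kernels *)

Section fejer.
Variable R : realType.
Implicit Types v : R.

(** The number of integers of absolute value [m]: with it, a cosine series over the natural numbers
    stands for a Fourier series over the integers. *)
Definition fourier_weight (m : nat) : R := if m == 0%N then 1 else 2.

Lemma fourier_weight_gt0 m : 0 < fourier_weight m.
Proof. by rewrite /fourier_weight; case: ifP. Qed.

Definition fejer_coef (n m : nat) : R :=
  fourier_weight m * ((n.+1)%:R - m%:R) / n.+1%:R.

Lemma cos_second_difference (m : nat) v :
  2 * cos v * cos (m.+1%:R * v) = cos (m.+2%:R * v) + cos (m%:R * v).
Proof.
have -> : m.+2%:R * v = m.+1%:R * v + v by rewrite -[in LHS]natr1; ring.
have -> : m%:R * v = m.+1%:R * v - v by rewrite -[in RHS]natr1; ring.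
by rewrite cosB cosD; ring.
Qed.

Lemma dirichlet_closed n v :
  (2 - 2 * cos v) * (\sum_(m < n.+1) fourier_weight m * cos (m%:R * v)) =
  2 * cos (n%:R * v) - 2 * cos (n.+1%:R * v).
Proof.
elim: n => [|n IH].
  rewrite big_ord_recl big_ord0 /fourier_weight /=.
  by rewrite mul0r !mul1r cos0; ring.
rewrite big_ord_recr mulrDr IH /fourier_weight /=.
have := cos_second_difference n v => H.
transitivity (2 * cos (n%:R * v) + 2 * cos (n.+1%:R * v) -
  2 * (2 * cos v * cos (n.+1%:R * v))); first by ring.
by rewrite H; ring.
Qed.

Definition fejer_kernel (n : nat) v : R :=
  \sum_(m < n.+1) fejer_coef n m * cos (m%:R * v).

(** The Fejer kernel is the mean of the Dirichlet kernels of orders 0 to [n], whose closed forms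
    telescope. Keeping the factor [2 - 2 * cos v] on the left covers the points where it
    vanishes. *)
Lemma fejer_kernel_closed n v :
  (2 - 2 * cos v) * fejer_kernel n v = (2 - 2 * cos (n.+1%:R * v)) / n.+1%:R.
Proof.
pose G n := \sum_(m < n.+1) fourier_weight m * ((n.+1)%:R - m%:R) * cos (m%:R * v).
have -> : fejer_kernel n v = G n / n.+1%:R.
  by rewrite /fejer_kernel /G mulr_suml; apply: eq_bigr => m _; rewrite /fejer_coef; ring.
rewrite mulrA; congr (_ / _).
elim: n => [|n IH].
  rewrite /G big_ord_recl big_ord0 /fourier_weight /=.
  by rewrite mul0r !mul1r cos0; ring.
have -> : G n.+1 = G n + \sum_(m < n.+2) fourier_weight m * cos (m%:R * v).
  rewrite /G [LHS]big_ord_recr /= [X in _ = _ + X]big_ord_recr /= addrA -big_split /=.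
  congr (_ + _).
    by apply: eq_bigr => m _; rewrite -[n.+2%:R]natr1; ring.
  by rewrite -[n.+2%:R]natr1; ring.
by rewrite mulrDr IH dirichlet_closed; ring.
Qed.

Lemma fejer_kernel_ge0 n v : 0 <= fejer_kernel n v.
Proof.
have [c1|c1] := eqVneq (cos v) 1.
  have s0 : sin v = 0.
    by apply/eqP; rewrite -sqrf_eq0 sin2cos2 c1 expr1n subrr.
  apply: sumr_ge0 => m _.
  have -> : cos (m%:R * v) = 1.
    elim: (m : nat) => [|k IH]; first by rewrite mul0r cos0.
    by rewrite -natr1 mulrDl mul1r cosD s0 c1 IH mulr0 subr0 mulr1.
  rewrite mulr1 /fejer_coef divr_ge0// mulr_ge0 ?(ltW (fourier_weight_gt0 _))//.
  by rewrite subr_ge0 ler_nat ltnW.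
have p : 0 < 2 - 2 * cos v.
  by have := cos_le1 v; rewrite le_eqVlt (negbTE c1) /= => h; lra.
by rewrite -(pmulr_rge0 _ p) fejer_kernel_closed divr_ge0//.
Qed.

Lemma fejer_kernel_le n v : (2 - 2 * cos v) * fejer_kernel n v <= 4 / n.+1%:R.
Proof.
rewrite fejer_kernel_closed ler_pM2r ?invr_gt0//.
by have := cos_geN1 (n.+1%:R * v); lra.
Qed.

Lemma fejer_coef0 n : fejer_coef n 0 = 1.
Proof. by rewrite /fejer_coef /fourier_weight /= mul1r subr0 divff. Qed.

Lemma fejer_coef_cvg m : fejer_coef n m @[n --> \oo] --> fourier_weight m.
Proof.
rewrite -[X in _ --> X]mulr1 -[X in _ * X](subr0 1).
rewrite (_ : (fun n => _) = (fun n => fourier_weight m * (1 - m%:R * n.+1%:R^-1))); last first.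
  apply/funext => n; rewrite /fejer_coef -mulrA; congr (_ * _).
  by rewrite mulrBl divff.
apply: cvgMr; apply: cvgB; first exact: cvg_cst.
by rewrite -(mulr0 m%:R); apply: cvgMr; exact: cvg_harmonic.
Qed.

Lemma nearest_int v : exists k : int, `|v - k%:~R| <= 2^-1.
Proof.
exists (Num.floor (v + 2^-1)); have /andP[] := floor_itv (v + 2^-1).
rewrite intrD => h1 h2; rewrite ler_norml; apply/andP; split; lra.
Qed.

Lemma cos_far (d v : R) (k : int) : 0 <= d -> `|v - k%:~R| <= 2^-1 ->
  d <= `|v - k%:~R| -> cos (2 * pi * v) <= cos (2 * pi * d).
Proof.
move=> d0 vk dv.
have -> : 2 * pi * v = 2 * pi * (v - k%:~R) + 2 * pi * k%:~R by ring.
rewrite cosDint.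
have -> : cos (2 * pi * (v - k%:~R)) = cos (2 * pi * `|v - k%:~R|).
  by case: (ger0P (v - k%:~R)) => // _; rewrite mulrN cosN.
have p0 := pi_gt0 R.
move: vk dv; set w := `|v - k%:~R| => vk dv.
have [->//|dw] := eqVneq d w.
have {dw}dv : d < w by rewrite lt_neqAle dw.
rewrite ltW// ltr_cos ?in_itv /=; first by rewrite ltr_pM2l// mulr_gt0.
- by apply/andP; split; nra.
- by apply/andP; split; nra.
Qed.

Lemma cos2pi_lt1 (d : R) : 0 < d -> d <= 2^-1 -> cos (2 * pi * d) < 1.
Proof.
move=> d0 d1; have p0 := pi_gt0 R.
rewrite -[X in _ < X]cos0 ltr_cos; first by nra.
- by rewrite in_itv /=; apply/andP; split; nra.
- by rewrite in_itv; apply/andP; split => /=; nra.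
Qed.
End fejer.

(** * Pointwise approximation by Fejer means *)

Section reproducing.
Variable R : realType.
Implicit Types (f g h : R * R * R -> R) (x y : R * R * R).

Definition wave3 (a b c : nat) x y : R :=
  coswave a x.1.1 y.1.1 * coswave b x.1.2 y.1.2 * coswave c x.2 y.2.

Definition sumsq (a b c : nat) : nat := (a ^ 2 + b ^ 2 + c ^ 2)%N.

Lemma wave3_eigen a b c x :
  in_eigenspace (4 * pi ^+ 2 * (sumsq a b c)%:R) (wave3 a b c x).
Proof.
have := plane_wave_eigen (fun i : 'I_3 => nth 0%N [:: a; b; c] i) x.
by rewrite /sqnorm !big_ord_recl big_ord0 /= addn0 addnA.
Qed.

Lemma continuous_wave3 a b c x : continuous (wave3 a b c x).
Proof. by have [_ [[]]] := wave3_eigen a b c x. Qed.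

Lemma coswave0 (s u : R) : coswave 0 s u = 1.
Proof. by rewrite /coswave mulr0 mul0r cos0. Qed.

Lemma wave3_000 x y : wave3 0 0 0 x y = 1.
Proof. by rewrite /wave3 !coswave0 !mulr1. Qed.

Lemma integral_wave3 a b c x : cell_integral (wave3 a b c x) =
  ((a == 0) && (b == 0) && (c == 0))%N%:R.
Proof.
have [/andP[/andP[/eqP-> /eqP->] /eqP->]|/negP n0] := boolP (_ && _).
  rewrite -(cell_integral_cst 1); congr cell_integral.
  by apply/funext => y; rewrite wave3_000.
have ne : 4 * pi ^+ 2 * (sumsq a b c)%:R != 4 * pi ^+ 2 * (sumsq 0 0 0)%:R :> R.
  have s0 : (0 < sumsq a b c)%N.
    by rewrite lt0n /sumsq !addn_eq0 !expn_eq0 /= !andbT; exact/negP.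
  by rewrite mulr0 gt_eqF// !mulr_gt0// ?exprn_gt0 ?pi_gt0 ?ltr0n.
have I0 := eigenspace_orthogonal (wave3_eigen a b c x) (wave3_eigen 0 0 0 x) ne.
transitivity (L2_inner (wave3 a b c x) (wave3 0 0 0 x)) => //.
by apply: eq_Rintegral => y _; rewrite wave3_000 mulr1.
Qed.

(* [fejer_kernel 0] is the constant [1], so exponents [0] drop coordinates. *)
Definition fejer3 (n1 n2 n3 : nat) x y : R :=
  fejer_kernel n1 (2 * pi * (x.1.1 - y.1.1)) *
  fejer_kernel n2 (2 * pi * (x.1.2 - y.1.2)) *
  fejer_kernel n3 (2 * pi * (x.2 - y.2)).

Lemma fejer_kernelE n (s u : R) : fejer_kernel n (2 * pi * (s - u)) =
  \sum_(m < n.+1) fejer_coef R n m * coswave m s u.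
Proof. by apply: eq_bigr => m _; rewrite /coswave; congr (_ * cos _); ring. Qed.

Lemma fejer3E n1 n2 n3 x y : fejer3 n1 n2 n3 x y =
  \sum_(a < n1.+1) \sum_(b < n2.+1) \sum_(c < n3.+1)
    fejer_coef R n1 a * fejer_coef R n2 b * fejer_coef R n3 c * wave3 a b c x y.
Proof.
rewrite /fejer3 !fejer_kernelE -mulrA mulr_suml; apply: eq_bigr => a _.
rewrite mulr_suml mulr_sumr; apply: eq_bigr => b _.
rewrite !mulr_sumr; apply: eq_bigr => c _.
by rewrite /wave3; ring.
Qed.

Lemma fejer_kernel0 v : @fejer_kernel R 0 v = 1.
Proof. by rewrite /fejer_kernel big_ord1 fejer_coef0 mul1r mul0r cos0. Qed.

Lemma continuous_fejer3 n1 n2 n3 x : continuous (fejer3 n1 n2 n3 x).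
Proof.
have -> : fejer3 n1 n2 n3 x = fun y => \sum_(a < n1.+1) \sum_(b < n2.+1) \sum_(c < n3.+1)
    fejer_coef R n1 a * fejer_coef R n2 b * fejer_coef R n3 c * wave3 a b c x y.
  by apply/funext => y; exact: fejer3E.
apply: continuous_big => [|a _]; first exact: add_continuous.
apply: continuous_big => [|b _]; first exact: add_continuous.
apply: continuous_big => [|c _]; first exact: add_continuous.
by apply: continuousM_fun; [move=> z; exact: cvg_cst|exact: continuous_wave3].
Qed.

Lemma integral_mul_fejer3 g n1 n2 n3 x : continuous g ->
  cell_integral (fun y => g y * fejer3 n1 n2 n3 x y) =
  \sum_(a < n1.+1) \sum_(b < n2.+1) \sum_(c < n3.+1)
    fejer_coef R n1 a * fejer_coef R n2 b * fejer_coef R n3 c *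
    L2_inner g (wave3 a b c x).
Proof.
move=> cg.
have cw a b c : continuous (fun y => g y * wave3 a b c x y).
  by apply: continuousM_fun => //; exact: continuous_wave3.
have ck a b c : continuous (fun y =>
    fejer_coef R n1 a * fejer_coef R n2 b * fejer_coef R n3 c * (g y * wave3 a b c x y)).
  by apply: continuousM_fun => //; move=> z; exact: cvg_cst.
have -> : (fun y => g y * fejer3 n1 n2 n3 x y) =
  (fun y => \sum_(a < n1.+1) \sum_(b < n2.+1) \sum_(c < n3.+1)
    fejer_coef R n1 a * fejer_coef R n2 b * fejer_coef R n3 c * (g y * wave3 a b c x y)).
  apply/funext => y; rewrite fejer3E.
  rewrite mulr_sumr; apply: eq_bigr => a _.
  rewrite mulr_sumr; apply: eq_bigr => b _.
  rewrite mulr_sumr; apply: eq_bigr => c _; ring.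
rewrite cell_integral_sum; last first.
  move=> a _; apply: continuous_big => [|b _]; first exact: add_continuous.
  by apply: continuous_big => [|c _]; first exact: add_continuous.
apply: eq_bigr => a _; rewrite cell_integral_sum; last first.
  by move=> b _; apply: continuous_big => [|c _]; first exact: add_continuous.
apply: eq_bigr => b _; rewrite cell_integral_sum//.
by apply: eq_bigr => c _; rewrite cell_integralZ.
Qed.

Lemma integral_fejer3 n1 n2 n3 x : cell_integral (fejer3 n1 n2 n3 x) = 1.
Proof.
have -> : fejer3 n1 n2 n3 x = (fun y => (cst 1 : R * R * R -> R) y * fejer3 n1 n2 n3 x y).
  by apply/funext => y; rewrite mul1r.
rewrite integral_mul_fejer3; last by move=> z; exact: cvg_cst.
have E a b c : L2_inner (cst 1) (wave3 a b c x) = ((a == 0) && (b == 0) && (c == 0))%N%:R.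
  by rewrite -(integral_wave3 a b c x); apply: eq_Rintegral => y _; rewrite mul1r.
rewrite big_ord_recl [X in _ + X]big1 ?addr0; last first.
  move=> a _; rewrite big1// => b _; rewrite big1// => c _.
  by rewrite E mulr0.
rewrite big_ord_recl [X in _ + X]big1 ?addr0; last first.
  by move=> b _; rewrite big1// => c _; rewrite E mulr0.
rewrite big_ord_recl [X in _ + X]big1 ?addr0; last by move=> c _; rewrite E mulr0.
by rewrite E !fejer_coef0 !mulr1.
Qed.

Lemma fejer3_ge0 n1 n2 n3 x y : 0 <= fejer3 n1 n2 n3 x y.
Proof. by rewrite !mulr_ge0// fejer_kernel_ge0. Qed.

(** A periodic substitute for the squared distance: each summand is the factor that cancels the peak
    of a Fejer kernel in [fejer_kernel_le]. *)
Definition torus_gap x y : R := (2 - 2 * cos (2 * pi * (x.1.1 - y.1.1))) +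
  (2 - 2 * cos (2 * pi * (x.1.2 - y.1.2))) + (2 - 2 * cos (2 * pi * (x.2 - y.2))).

(** Each summand of the gap meets the Fejer kernel of its own coordinate, and [fejer_kernel_le]
    trades both for 4 / (n+1); the exponent 0 marks the coordinate so lost. *)
Lemma torus_gap_fejer3 n x y : torus_gap x y * fejer3 n n n x y <=
  4 / n.+1%:R * (fejer3 0 n n x y + fejer3 n 0 n x y + fejer3 n n 0 x y).
Proof.
rewrite /torus_gap /fejer3 !fejer_kernel0 !mul1r !mulr1.
set u1 := 2 * pi * (x.1.1 - y.1.1); set u2 := 2 * pi * (x.1.2 - y.1.2).
set u3 := 2 * pi * (x.2 - y.2).
have H1 := fejer_kernel_le n u1; have H2 := fejer_kernel_le n u2.
have H3 := fejer_kernel_le n u3.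
have P1 := fejer_kernel_ge0 n u1; have P2 := fejer_kernel_ge0 n u2.
have P3 := fejer_kernel_ge0 n u3.
move: H1 H2 H3 P1 P2 P3; set c1 := 2 - _; set c2 := 2 - _; set c3 := 2 - _.
move: (fejer_kernel n u1) (fejer_kernel n u2) (fejer_kernel n u3) (4 / _) => f1 f2 f3 q.
move=> H1 H2 H3 P1 P2 P3.
have := ler_wpM2r (mulr_ge0 P2 P3) H1.
have := ler_wpM2r (mulr_ge0 P1 P3) H2.
have := ler_wpM2r (mulr_ge0 P1 P2) H3.
by move=> *; lra.
Qed.

Lemma one_sub_cos_ge0 (v : R) : 0 <= 2 - 2 * cos v.
Proof. by have := cos_le1 v; lra. Qed.

Lemma torus_gap_ge0 x y : 0 <= torus_gap x y.
Proof. by apply: addr_ge0; [apply: addr_ge0|]; exact: one_sub_cos_ge0. Qed.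

Lemma periodic_bounded g : Defs.periodic g -> continuous g ->
  exists M, forall x, `|g x| <= M.
Proof.
move=> pg cg; have [M gM] := @continuous3_bounded R g 1 cg.
exists M => -[[x1 x2] x3].
rewrite -(pg (- Num.floor x1, - Num.floor x2, - Num.floor x3)).
have H (r : R) : (`[0, 1[ : set R)%classic (r + (- Num.floor r)%:~R).
  have /andP[] := floor_itv r; rewrite /= in_itv /= rmorphN /= intrD => h1 h2.
  by apply/andP; split; lra.
by apply: gM; split; [split|]; exact: H.
Qed.

(** Continuity at [x] serves near the lattice translates of [x]; elsewhere the gap is bounded below
    and absorbs twice the supremum of [g]. A bound linear in the gap can be integrated against the
    kernel as it stands. *)
Lemma periodic_modulus g x (e : R) : Defs.periodic g -> continuous g -> 0 < e ->
  exists2 K, 0 <= K & forall y, `|g y - g x| <= e + K * torus_gap x y.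
Proof.
move=> pg cg e0; have [M gM] := periodic_bounded pg cg.
have M0 : 0 <= M by exact: le_trans (gM x).
have /cvgrPdist_lt/(_ _ e0)/nbhs_ballP[d0 /= d00 dg] := cg x.
pose d := Num.min d0 (2^-1) / 2.
have d_gt0 : 0 < d by rewrite divr_gt0// lt_min d00/=.
have dd0 : d < d0.
  have : Num.min d0 2^-1 <= d0 by rewrite ge_min lexx.
  by rewrite /d; move: d_gt0; rewrite /d; lra.
have d2 : d <= 2^-1.
  have : Num.min d0 2^-1 <= 2^-1 by rewrite ge_min lexx orbT.
  by rewrite /d; move: d_gt0; rewrite /d; lra.
have q0 : 0 < 2 - 2 * cos (2 * pi * d) by have := cos2pi_lt1 d_gt0 d2; lra.
exists (2 * M / (2 - 2 * cos (2 * pi * d))); first by rewrite divr_ge0 ?mulr_ge0// ltW.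
move=> y.
have [k1 K1] := nearest_int (x.1.1 - y.1.1).
have [k2 K2] := nearest_int (x.1.2 - y.1.2).
have [k3 K3] := nearest_int (x.2 - y.2).
have [near|far] := boolP [&& `|x.1.1 - y.1.1 - k1%:~R| < d, `|x.1.2 - y.1.2 - k2%:~R| < d
   & `|x.2 - y.2 - k3%:~R| < d].
  have -> : g y = g (y + lattice R (k1, k2, k3)) by rewrite pg.
  have : ball x d0 (y + lattice R (k1, k2, k3)).
    move: near => /and3P[n1 n2 n3].
    split; [split|]; rewrite /ball /= /ball_ opprD addrA; apply: lt_trans dd0 => //.
  move/dg => /ltW; rewrite distrC => /le_trans; apply.
  by rewrite lerDl mulr_ge0 ?torus_gap_ge0 ?divr_ge0 ?mulr_ge0// ltW.
have far2 : 2 - 2 * cos (2 * pi * d) <= torus_gap x y.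
  have G1 := one_sub_cos_ge0 (2 * pi * (x.1.1 - y.1.1)).
  have G2 := one_sub_cos_ge0 (2 * pi * (x.1.2 - y.1.2)).
  have G3 := one_sub_cos_ge0 (2 * pi * (x.2 - y.2)).
  move: far; rewrite !negb_and -!leNgt => /or3P[] n;
    [have := cos_far (ltW d_gt0) K1 n|have := cos_far (ltW d_gt0) K2 n|
     have := cos_far (ltW d_gt0) K3 n]; rewrite /torus_gap; lra.
have : `|g y - g x| <= 2 * M.
  by rewrite (le_trans (ler_normB _ _))//; have := gM x; have := gM y; lra.
move=> /le_trans; apply; rewrite -[leLHS]add0r; apply: lerD; first exact: ltW.
by rewrite -mulrA ler_peMr ?mulr_ge0// ler_pdivlMl// mulr1.
Qed.

(** Korovkin's argument: the kernel is nonnegative with integral 1, and the integral of the gap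
    against it is O(1/n) by [torus_gap_fejer3]. *)
Lemma fejer3_approx g x : Defs.periodic g -> continuous g ->
  cell_integral (fun y => g y * fejer3 n n n x y) @[n --> \oo] --> g x.
Proof.
move=> pg cg; apply/cvgrPdist_le => e e0.
have [K K0 gK] := periodic_modulus x pg cg (divr_gt0 e0 (ltr0Sn _ 1)).
have cF n : continuous (fejer3 n n n x) by exact: continuous_fejer3.
(* 12 is three times the 4 of [torus_gap_fejer3], as each of the three reduced kernels has integral
   1. *)
have key n : `|g x - cell_integral (fun y => g y * fejer3 n n n x y)| <=
    e / 2 + K * (12 * n.+1%:R^-1).
  have -> : g x = cell_integral (fun y => g x * fejer3 n n n x y).
    by rewrite cell_integralZ// integral_fejer3 mulr1.
  have c1 : continuous (fun y => g y * fejer3 n n n x y) by exact: continuousM_fun.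
  have c2 : continuous (fun y => g x * fejer3 n n n x y).
    by apply: continuousM_fun => // z; exact: cvg_cst.
  have c3 : continuous (fun y => (-1) * (g y * fejer3 n n n x y)).
    by apply: continuousM_fun => // z; exact: cvg_cst.
  rewrite -mulN1r -cell_integralZ// -cell_integralD//.
  have c4 : continuous (fun y => g x * fejer3 n n n x y + (-1) * (g y * fejer3 n n n x y)).
    by move=> z; apply: cvgD; [exact: c2|exact: c3].
  apply: (le_trans (cell_integral_norm c4)).
  have C k1 k2 k3 : continuous (fejer3 k1 k2 k3 x) by exact: continuous_fejer3.
  have cs : continuous (fun y => fejer3 0 n n x y + fejer3 n 0 n x y + fejer3 n n 0 x y).
    by move=> z; apply: cvgD; [apply: cvgD|]; exact: C.
  have cs2 : continuous (fun y => (K * (4 / n.+1%:R)) *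
      (fejer3 0 n n x y + fejer3 n 0 n x y + fejer3 n n 0 x y)).
    by apply: continuousM_fun => // z; exact: cvg_cst.
  have cs1 : continuous (fun y => e / 2 * fejer3 n n n x y).
    by apply: continuousM_fun => // z; exact: cvg_cst.
  rewrite (_ : e / 2 + _ = cell_integral (fun y => e / 2 * fejer3 n n n x y +
      (K * (4 / n.+1%:R)) * (fejer3 0 n n x y + fejer3 n 0 n x y + fejer3 n n 0 x y))); last first.
    rewrite cell_integralD// !cell_integralZ// !cell_integralD//; last first.
      by move=> z; apply: cvgD; exact: C.
    by rewrite !integral_fejer3; field.
  apply: cell_integral_le.
  - by move=> z; apply: cvg_norm; exact: c4.
  - by move=> z; apply: cvgD; [exact: cs1|exact: cs2].
  move=> y; rewrite mulN1r -mulrBl normrM (ger0_norm (fejer3_ge0 _ _ _ _ _)) distrC.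
  have := ler_wpM2r (fejer3_ge0 n n n x y) (gK y).
  have := ler_wpM2l K0 (torus_gap_fejer3 n x y).
  move=> h1 h2; apply: (le_trans h2).
  by rewrite mulrDl lerD2l -[K * torus_gap x y * _]mulrA -[K * (4 / _) * _]mulrA.
have : (e / 2 + K * (12 * n.+1%:R^-1)) @[n --> \oo] --> e / 2 + K * (12 * 0).
  apply: cvgD; first exact: cvg_cst.
  by apply: cvgMr; apply: cvgMr; exact: cvg_harmonic.
rewrite !mulr0 addr0 => /cvgrPdist_lt/(_ _ (divr_gt0 e0 (ltr0Sn _ 1))).
apply: filterS => n; rewrite opprD addrA subrr sub0r normrN => H.
rewrite (le_trans (key n))//.
by rewrite [leRHS]splitr lerD2l (le_trans (ler_norm _))// ltW.
Qed.
End reproducing.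

(** * Eigenspaces as levels of integer points *)

Section eigenspace_levels.
Variable R : realType.
Implicit Types (f g h : R * R * R -> R) (x y : R * R * R).
Notation fw := (fourier_weight R).

Lemma C1_lin (c : R) f g : C1 f -> C1 g -> C1 (fun x => c * f x + g x) /\
  forall i, partial i (fun x => c * f x + g x) = fun x => c * partial i f x + partial i g x.
Proof.
move=> [cf df] [cg dg].
have D i x : is_derive x (unit_vec R i) (fun x => c * f x + g x)
    (c * partial i f x + partial i g x).
  have /derivableP H1 := (df i).1 x; have /derivableP H2 := (dg i).1 x.
  exact: (is_deriveD (is_deriveZ c H1) H2).
have E i : partial i (fun x => c * f x + g x) = fun x => c * partial i f x + partial i g x.
  by apply/funext => x; rewrite /partial (@derive_val _ _ _ _ _ _ _ (D i x)).
have cl (f' g' : R * R * R -> R) : continuous f' -> continuous g' ->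
    continuous (fun x => c * f' x + g' x).
  by move=> c1 c2 x; apply: cvgD; [apply: cvgMr; exact: c1|exact: c2].
split=> //; split; first exact: cl.
move=> i; split; first by move=> x; have [] := D i x.
by rewrite E; apply: cl; [have [_] := df i|have [_] := dg i].
Qed.

Lemma eigenspace_lin (mu c : R) f g : in_eigenspace mu f -> in_eigenspace mu g ->
  in_eigenspace mu (fun x => c * f x + g x).
Proof.
move=> [pf [c1f c2f] ef] [pg [c1g c2g] eg].
have [C1fg E] := C1_lin c c1f c1g.
split.
- by move=> k x; rewrite pf pg.
- split; first exact: C1fg.
  by move=> i; rewrite E; exact: (C1_lin c (c2f i) (c2g i)).1.
- move=> x.
  have -> : laplacian (fun x => c * f x + g x) x = c * laplacian f x + laplacian g x.
    rewrite /laplacian.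
    rewrite mulr_sumr -big_split /=; apply: eq_bigr => i _; rewrite E.
    exact: (congr1 (fun h => h x) ((C1_lin c (c2f i) (c2g i)).2 i)).
  move: (ef x) (eg x).
  move: (laplacian f x) (laplacian g x) (f x) (g x) => lf lg a b h1 h2.
  by rewrite opprD -mulrN h1 h2; ring.
Qed.

Lemma eigenspace0 (mu : R) : in_eigenspace mu (fun=> 0).
Proof.
have E i : partial i (fun=> 0) = (fun=> 0) :> (R * R * R -> R).
  by apply/funext => x; rewrite /partial derive_cst.
have C : C1 (fun=> 0 : R).
  split; first by move=> x; exact: cvg_cst.
  by move=> i; split; [move=> x; exact: derivable_cst|rewrite E => x; exact: cvg_cst].
split=> //; first by split=> // i; rewrite E.
by move=> x; rewrite /laplacian mulr0; under eq_bigr do rewrite !E; rewrite big1 ?oppr0.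
Qed.

Lemma eigenspace_sum (mu : R) (T : Type) (s : seq T) (P : pred T) (c : T -> R) F :
  (forall i, P i -> in_eigenspace mu (F i)) ->
  in_eigenspace mu (fun x => \sum_(i <- s | P i) c i * F i x).
Proof.
move=> eF; elim: s => [|a s IH].
  by under eq_fun do rewrite big_nil; exact: eigenspace0.
have [Pa|/negbTE Pa] := boolP (P a).
  rewrite (_ : (fun x => _) = (fun x => c a * F a x + \sum_(i <- s | P i) c i * F i x)).
    exact: eigenspace_lin (eF _ Pa) IH.
  by apply/funext => x; rewrite big_cons Pa.
rewrite (_ : (fun x => _) = (fun x => \sum_(i <- s | P i) c i * F i x))//.
by apply/funext => x; rewrite big_cons Pa.
Qed.

Lemma eigenspace_continuous mu f : in_eigenspace mu f -> continuous f.
Proof. by case=> _ [[]]. Qed.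

(** Coordinates up to [r] suffice, as a natural number is at most its square; see [sumsq_gt]. *)
Definition level_sum (V : nmodType) (r : nat) (F : nat -> nat -> nat -> V) : V :=
  \sum_(a < r.+1) \sum_(b < r.+1) \sum_(c < r.+1 | sumsq a b c == r) F a b c.

(** The reproducing kernel of the eigenspace of eigenvalue 4 pi^2 r, by [level_kernel_reproducing];
    its constant diagonal [level_mult] counts the integer points of squared length [r]. *)
Definition level_kernel (r : nat) x y : R :=
  level_sum r (fun a b c => fw a * fw b * fw c * wave3 a b c x y).

Definition level_mult (r : nat) : R := level_sum r (fun a b c => fw a * fw b * fw c).

Lemma wave3_diag a b c x : wave3 a b c x x = 1.
Proof. by rewrite /wave3 /coswave !subrr !mulr0 !cos0 !mulr1. Qed.

Lemma level_kernel_diag r x : level_kernel r x x = level_mult r.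
Proof.
by apply: eq_bigr => a _; apply: eq_bigr => b _; apply: eq_bigr => c _;
  rewrite wave3_diag mulr1.
Qed.

Lemma level_kernel_eigen r x :
  in_eigenspace (4 * pi ^+ 2 * r%:R) (level_kernel r x).
Proof.
rewrite /level_kernel /level_sum.
have H1 F : (forall i, in_eigenspace (4 * pi ^+ 2 * r%:R) (F i)) ->
    in_eigenspace (4 * pi ^+ 2 * r%:R) (fun y => \sum_(i < r.+1) F i y).
  move=> eF; have := @eigenspace_sum (4 * pi ^+ 2 * r%:R) _ (index_enum 'I_r.+1) xpredT
    (fun=> 1) F (fun i _ => eF i).
  by under eq_fun do under eq_bigr do rewrite mul1r.
apply: (H1) => a; apply: (H1) => b; apply: eigenspace_sum => c /eqP sc.
by have := wave3_eigen a b c x; rewrite sc.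
Qed.

Lemma sum_ord_trunc (F : nat -> R) r n : (r <= n)%N ->
  (forall a, (r < a)%N -> F a = 0) -> \sum_(a < n.+1) F a = \sum_(a < r.+1) F a.
Proof.
move=> rn F0; rewrite [RHS](big_ord_widen n.+1 F)// [RHS]big_mkcond /=.
by apply: eq_bigr => a _; case: ifPn => //; rewrite ltnS -ltnNge => /F0.
Qed.

Lemma sumsq_gt r a b c : ((r < a) || (r < b) || (r < c))%N -> (r < sumsq a b c)%N.
Proof.
have H m : (m <= m ^ 2)%N by case: m => // m; rewrite expnS expn1 leq_pmulr.
have := H a; have := H b; have := H c; rewrite /sumsq.
move: (a ^ 2)%N (b ^ 2)%N (c ^ 2)%N => a2 b2 c2 h1 h2 h3.
move=> /orP[/orP[]|] h.
- by rewrite -addnA (leq_trans h)// (leq_trans h3)// leq_addr.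
- by rewrite (leq_trans h)// (leq_trans h2)// -addnA addnCA leq_addr.
- by rewrite (leq_trans h)// (leq_trans h1)// leq_addl.
Qed.

Lemma four_pi2_neq (r s : nat) : r != s ->
  4 * pi ^+ 2 * r%:R != 4 * pi ^+ 2 * s%:R :> R.
Proof.
move=> rs; rewrite (inj_eq (mulfI _)) ?eqr_nat//.
by rewrite mulf_neq0// expf_neq0// gt_eqF// pi_gt0.
Qed.

(** All Fejer means of [f] vanish, because [f] is orthogonal to every wave, and they converge to
    [f]. *)
Lemma eigenspace_level0 (mu : R) f x : in_eigenspace mu f ->
  (forall r : nat, mu != 4 * pi ^+ 2 * r%:R) -> f x = 0.
Proof.
move=> ef nmu; have [pf _ _] := ef; have cf := eigenspace_continuous ef.
have := @fejer3_approx R f x pf cf.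
under eq_cvg do rewrite integral_mul_fejer3//.
have -> : (fun n => \sum_(a < n.+1) \sum_(b < n.+1) \sum_(c < n.+1)
    fejer_coef R n a * fejer_coef R n b * fejer_coef R n c * L2_inner f (wave3 a b c x))
    = (fun=> 0).
  apply/funext => n; rewrite big1// => a _; rewrite big1// => b _; rewrite big1// => c _.
  by rewrite (eigenspace_orthogonal ef (wave3_eigen a b c x) (nmu _)) mulr0.
by move=> /cvg_lim => <-//; rewrite lim_cst.
Qed.

(** Orthogonality leaves only the waves of level [r] in the Fejer means of [f]. Their number does
    not depend on the order [n] of the mean, so the limit may be taken in the coefficients. *)
Lemma level_kernel_reproducing r f x : in_eigenspace (4 * pi ^+ 2 * r%:R) f ->
  L2_inner f (level_kernel r x) = f x.
Proof.
move=> ef; have [pf _ _] := ef; have cf := eigenspace_continuous ef.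
have L0 a b c : sumsq a b c != r -> L2_inner f (wave3 a b c x) = 0.
  move=> ne; apply: (eigenspace_orthogonal ef (wave3_eigen a b c x)).
  by apply: four_pi2_neq; rewrite eq_sym.
have gt0 a b c : ((r < a) || (r < b) || (r < c))%N -> L2_inner f (wave3 a b c x) = 0.
  by move=> /sumsq_gt h; apply: L0; rewrite gtn_eqF.
pose T n (a b c : nat) := fejer_coef R n a * fejer_coef R n b * fejer_coef R n c *
  L2_inner f (wave3 a b c x).
pose S n := \sum_(a < r.+1) \sum_(b < r.+1) \sum_(c < r.+1) T n a b c.
have T0 n a b c : ((r < a) || (r < b) || (r < c))%N -> T n a b c = 0.
  by move=> h; rewrite /T gt0// mulr0.
have cS : S n @[n --> \oo] --> f x.
  apply: cvg_trans (@fejer3_approx R f x pf cf); apply: near_eq_cvg.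
  near=> n; rewrite integral_mul_fejer3//.
  have rn : (r <= n)%N by near: n; exact: nbhs_infty_ge.
  transitivity (\sum_(a < n.+1) \sum_(b < n.+1) \sum_(c < n.+1) T n a b c) => //.
  rewrite [LHS](@sum_ord_trunc (fun a => \sum_(b < n.+1) \sum_(c < n.+1) T n a b c) r n rn).
    apply: eq_bigr => a _.
    rewrite [LHS](@sum_ord_trunc (fun b => \sum_(c < n.+1) T n a b c) r n rn).
      apply: eq_bigr => b _; apply: (@sum_ord_trunc (fun c => T n a b c) r n rn).
      by move=> c rc; rewrite T0// rc !orbT.
    by move=> b rb; rewrite big1// => c _; rewrite T0// rb orbT.
  by move=> a ra; rewrite big1// => b _; rewrite big1// => c _; rewrite T0// ra.
have cS2 : S n @[n --> \oo] --> \sum_(a < r.+1) \sum_(b < r.+1) \sum_(c < r.+1)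
  fw a * fw b * fw c * L2_inner f (wave3 a b c x).
  apply: cvg_big => [|a _]; first exact: add_continuous.
  apply: cvg_big => [|b _]; first exact: add_continuous.
  apply: cvg_big => [|c _]; first exact: add_continuous.
  by apply: cvgMl; apply: cvgM; [apply: cvgM|]; exact: fejer_coef_cvg.
rewrite -(cvg_lim _ cS)// (cvg_lim _ cS2)//.
have ck a b c : continuous (fun y => fw a * fw b * fw c * (f y * wave3 a b c x y)).
  apply: continuousM_fun; first by move=> z; exact: cvg_cst.
  by apply: continuousM_fun => //; exact: continuous_wave3.
transitivity (cell_integral (fun y => \sum_(a < r.+1) \sum_(b < r.+1)
    \sum_(c < r.+1 | sumsq a b c == r) fw a * fw b * fw c * (f y * wave3 a b c x y))).
  apply: eq_Rintegral => y _; rewrite /level_kernel /level_sum.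
  rewrite mulr_sumr; apply: eq_bigr => a _.
  rewrite mulr_sumr; apply: eq_bigr => b _.
  by rewrite mulr_sumr; apply: eq_bigr => c _; ring.
rewrite cell_integral_sum; last first.
  move=> a _; apply: continuous_big => [|b _]; first exact: add_continuous.
  by apply: continuous_big => [|c _]; first exact: add_continuous.
apply: eq_bigr => a _; rewrite cell_integral_sum; last first.
  by move=> b _; apply: continuous_big => [|c _]; first exact: add_continuous.
apply: eq_bigr => b _; rewrite cell_integral_sum// big_mkcond /=.
apply: eq_bigr => c _; case: ifPn => [_|/L0->]; last by rewrite mulr0.
rewrite cell_integralZ//; apply: continuousM_fun => //; exact: continuous_wave3.
Unshelve. all: by end_near.
Qed.
End eigenspace_levels.

(** * Identification of an arbitrary eigenbasis *)

Section spectral.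
Variables (R : realType) (lam : nat -> R) (phi : nat -> R * R * R -> R).
Hypothesis B : laplace_eigenbasis lam phi.

(** At any other value an eigenfunction vanishes identically, against the normalization of
    [phi k]. *)
Lemma eigenvalue_level : exists r : nat -> nat, forall k, lam k = 4 * pi ^+ 2 * (r k)%:R.
Proof.
suff /choice[r rE] : forall k, exists r : nat, lam k = 4 * pi ^+ 2 * r%:R by exists r.
move=> k; apply: contrapT => /forallNP H.
have /eqP := eigenfunction_orthonormal B k k.
rewrite eqxx /L2_inner (_ : \int[_]_(_ in _) _ = cell_integral (fun=> 0)); last first.
  apply: eq_Rintegral => x _.
  rewrite (eigenspace_level0 x (eigenfunction B k)) ?mulr0// => r.
  exact/eqP.
by rewrite cell_integral_cst eq_sym oner_eq0.
Qed.

Variable r : nat -> nat.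
Hypothesis rE : forall k, lam k = 4 * pi ^+ 2 * (r k)%:R.

Let cphi k : continuous (phi k).
Proof. exact: eigenspace_continuous (eigenfunction B k). Qed.

Let ephi k : in_eigenspace (4 * pi ^+ 2 * (r k)%:R) (phi k).
Proof. by rewrite -rE; exact: eigenfunction. Qed.

(** Bessel's inequality for the kernel [D] centred at [x]: by reproduction its coefficients are the
    values [phi k x] and its squared norm is [D x]. *)
Lemma level_bessel (s : seq nat) (m : nat) x : uniq s -> all (fun k => r k == m) s ->
  \sum_(k <- s) phi k x ^+ 2 <= level_mult R m.
Proof.
move=> us /allP rs.
pose D := level_kernel m x; have eD := level_kernel_eigen m x.
have cD : continuous D := eigenspace_continuous eD.
have kr k : k \in s -> L2_inner D (phi k) = phi k x.
  move=> ks; have /eqP rk := rs _ ks.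
  by have := @level_kernel_reproducing R (r k) (phi k) x (ephi k); rewrite rk L2_innerC.
pose S y := \sum_(k <- s) phi k x * phi k y.
have cS : continuous S.
  apply: continuous_big => [|k _]; first exact: add_continuous.
  by apply: continuousM_fun => //; move=> z; exact: cvg_cst.
have DD : L2_inner D D = level_mult R m.
  by rewrite /D (@level_kernel_reproducing R m _ x eD) level_kernel_diag.
have H g : continuous g -> L2_inner g S = \sum_(k <- s) phi k x * L2_inner g (phi k).
  move=> cg; transitivity (cell_integral (fun y => \sum_(k <- s) phi k x * (g y * phi k y))).
    by apply: eq_Rintegral => y _; rewrite mulr_sumr; apply: eq_bigr => k _; ring.
  rewrite cell_integral_sum; last first.
    move=> k _; apply: continuousM_fun; first by move=> z; exact: cvg_cst.
    exact: continuousM_fun.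
  by apply: eq_bigr => k _; rewrite cell_integralZ//; exact: continuousM_fun.
have DS : L2_inner D S = \sum_(k <- s) phi k x ^+ 2.
  by rewrite H// !big_seq; apply: eq_bigr => k ks; rewrite kr.
have SS : L2_inner S S = \sum_(k <- s) phi k x ^+ 2.
  rewrite H// !big_seq; apply: eq_bigr => k ks.
  rewrite L2_innerC H// (bigD1_seq k)//= (eigenfunction_orthonormal B) eqxx mulr1.
  rewrite big1 ?addr0// => j /negbTE jk.
  by rewrite (eigenfunction_orthonormal B) eq_sym jk mulr0.
have : 0 <= cell_integral (fun y => (D y - S y) ^+ 2).
  by apply: Rintegral_ge0 => y _; exact: sqr_ge0.
have -> : cell_integral (fun y => (D y - S y) ^+ 2) =
    L2_inner D D + (-2 * L2_inner D S + L2_inner S S).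
  have c1 := continuousM_fun cD cD; have c2 := continuousM_fun cD cS.
  have c3 := continuousM_fun cS cS.
  have c4 : continuous (fun y => -2 * (D y * S y)).
    by apply: continuousM_fun => // z; exact: cvg_cst.
  have c5 : continuous (fun y => -2 * (D y * S y) + S y * S y).
    by move=> z; apply: cvgD; [exact: c4|exact: c3].
  rewrite /L2_inner -!/(cell_integral _) -cell_integralZ// -!cell_integralD//.
  by apply: eq_Rintegral => y _; ring.
by rewrite DD DS SS; lra.
Qed.

(** Integration of [level_bessel] over the cell. Only finitely many indices can thus share a
    level. *)
Lemma level_size (s : seq nat) (m : nat) : uniq s -> all (fun k => r k == m) s ->
  (size s)%:R <= level_mult R m.
Proof.
move=> us rs.
have -> : (size s)%:R = cell_integral (fun x => \sum_(k <- s) phi k x ^+ 2).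
  rewrite cell_integral_sum; last first.
    by move=> k _; under eq_fun do rewrite expr2; exact: continuousM_fun.
  rewrite (eq_bigr (fun=> 1)); last first.
    move=> k _; transitivity (L2_inner (phi k) (phi k)); last first.
      by rewrite (eigenfunction_orthonormal B) eqxx.
    by apply: eq_Rintegral => y _; rewrite expr2.
  by rewrite big_const_seq count_predT iter_addr_0.
rewrite -[leRHS]cell_integral_cst; apply: cell_integral_le.
- apply: continuous_big => [|k _]; first exact: add_continuous.
  by under eq_fun do rewrite expr2; exact: continuousM_fun.
- by move=> z; exact: cvg_cst.
- by move=> x; exact: level_bessel.
Qed.

Lemma level_nondecreasing : {homo r : i j / (i <= j)%N}.
Proof.
move=> i j /(eigenvalue_nondecreasing B); rewrite !rE.
by rewrite ler_pM2l ?ler_nat// mulr_gt0// exprn_gt0// pi_gt0.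
Qed.

Lemma level_unbounded (m : nat) : exists n : nat, forall k, (n <= k)%N -> (m < r k)%N.
Proof.
(* [n] exceeds the total number of indices that the levels up to [m] can hold. *)
pose n := (Num.truncn (\sum_(i < m.+1) level_mult R i)).+1.
exists n.-1 => k nk; rewrite ltnNge; apply/negP => rk.
have rle j : (j < n)%N -> (r j < m.+1)%N.
  by move=> jn; rewrite ltnS (leq_trans _ rk)//; apply: level_nondecreasing; exact: leq_trans nk.
have : n%:R <= \sum_(i < m.+1) level_mult R i.
  have -> : n%:R = \sum_(i < m.+1) (size [seq j <- iota 0 n | r j == i])%:R :> R.
    rewrite -natr_sum; congr _%:R.
    under eq_bigr do rewrite size_filter -sum1_count.
    rewrite (exchange_big_dep xpredT)//= -[LHS](size_iota 0) -sum1_size big_seq [RHS]big_seq.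
    apply: eq_bigr => j; rewrite mem_iota add0n => /andP[_ /rle jn].
    by rewrite (big_pred1 (Ordinal jn))// => i /=; rewrite -val_eqE eq_sym.
  apply: ler_sum => i _; apply: level_size; first by rewrite filter_uniq// iota_uniq.
  by apply/allP => j; rewrite mem_filter => /andP[].
rewrite leNgt /n truncnS_gt//.
Qed.

(** Completeness enters here: the difference of the two sides is an eigenfunction orthogonal to
    every [phi j], by reproduction if [j] has level [m] and by distinct eigenvalues otherwise. *)
Lemma level_kernelE (m n : nat) x y : (forall k, (n <= k)%N -> (m < r k)%N) ->
  level_kernel m x y = \sum_(k < n | r k == m) phi k x * phi k y.
Proof.
move=> hn; apply/eqP; rewrite -subr_eq0; apply/eqP.
have eD := level_kernel_eigen m x.
have eS : in_eigenspace (4 * pi ^+ 2 * m%:R)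
    (fun y => \sum_(k < n | r k == m) phi k x * phi k y).
  by apply: eigenspace_sum => k /eqP <-; exact: ephi.
have ef := eigenspace_lin (-1) eS eD.
have -> : level_kernel m x y - \sum_(k < n | r k == m) phi k x * phi k y =
  -1 * (\sum_(k < n | r k == m) phi k x * phi k y) + level_kernel m x y by ring.
apply: (eigenfunction_exhaustive B ef) => j.
have [rj|rj] := eqVneq (r j) m; last first.
  by apply: (eigenspace_orthogonal ef (ephi j)); apply: four_pi2_neq; rewrite eq_sym.
have jn : (j < n)%N by rewrite ltnNge; apply/negP => /hn; rewrite rj ltnn.
have cD := eigenspace_continuous eD.
have cS := eigenspace_continuous eS.
transitivity (cell_integral (fun z => -1 * (\sum_(k < n | r k == m) phi k x * (phi k z * phi j z))
   + level_kernel m x z * phi j z)).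
  apply: eq_Rintegral => z _; rewrite mulrDl -mulrA mulr_suml.
  by congr (_ * _ + _); apply: eq_bigr => k _; rewrite mulrA.
have ck k : continuous (fun z => phi k x * (phi k z * phi j z)).
  by apply: continuousM_fun; [move=> z; exact: cvg_cst|exact: continuousM_fun].
have cs : continuous (fun z => \sum_(k < n | r k == m) phi k x * (phi k z * phi j z)).
  by apply: continuous_big => [|k _]; first exact: add_continuous.
rewrite cell_integralD; last 2 first.
- by apply: continuousM_fun => // z; exact: cvg_cst.
- exact: continuousM_fun.
rewrite cell_integralZ// cell_integral_sum//.
have -> : cell_integral (fun z => level_kernel m x z * phi j z) = phi j x.
  have := @level_kernel_reproducing R (r j) (phi j) x (ephi j).
  by rewrite rj L2_innerC.
rewrite (bigD1 (Ordinal jn)) /=; last by rewrite rj.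
rewrite cell_integralZ; last exact: continuousM_fun.
have := eigenfunction_orthonormal B j j; rewrite eqxx /L2_inner -/(cell_integral _) => ->.
rewrite big1 ?addr0 ?mulr1; first by ring.
move=> k /andP[_ kj]; rewrite cell_integralZ; last exact: continuousM_fun.
have := eigenfunction_orthonormal B k j; rewrite /L2_inner -/(cell_integral _) => ->.
by rewrite -val_eqE /= in kj; rewrite (negbTE kj) mulr0.
Qed.
End spectral.

(** * Theta functions and the heat kernel *)

Section series_facts.
Variable R : realType.
Implicit Types u : R ^nat.

Lemma bounded_series_cvg u (M : R) :
  (forall n, \sum_(k < n) `|u k| <= M) -> cvgn (series u).
Proof.
move=> uM; apply: normed_cvg; apply: nondecreasing_is_cvgn.
  by apply: nondecreasing_series => k _ _; exact: normr_ge0.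
exists M => _ [n _ <-]; have := uM n.
by rewrite -(big_mkord xpredT (fun k => `|u k|)).
Qed.

Lemma series_lim_norm_le u (M : R) : cvgn (series u) ->
  (\forall n \near \oo, `|\sum_(k < n) u k| <= M) -> `|limn (series u)| <= M.
Proof.
move=> cu H; rewrite ler_norml; apply/andP; split.
  apply: limr_ge => //; apply: filterS H => n.
  by rewrite seriesEord /= ler_norml => /andP[].
apply: limr_le => //; apply: filterS H => n.
by rewrite seriesEord /= ler_norml => /andP[].
Qed.

Lemma geometric_sum_le (q : R) n : 0 <= q -> q < 1 -> \sum_(m < n) q ^+ m <= (1 - q)^-1.
Proof.
move=> q0 q1; have p : 0 < 1 - q by rewrite subr_gt0.
rewrite -[leRHS]mulr1 ler_pdivlMl//.
have -> : (1 - q) * \sum_(m < n) q ^+ m = 1 - q ^+ n.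
  elim: n => [|n IH]; first by rewrite big_ord0 mulr0 expr0 subrr.
  by rewrite big_ord_recr mulrDr IH /= exprS; ring.
by rewrite gerBl exprn_ge0.
Qed.

(** With s^2 = b, the square of s m - 1/2 being nonnegative gives exp(- b m^2) <= exp(1/4) exp(- s
    m), and a geometric series remains. *)
Lemma gauss_sum_le (b : R) n : 0 < b ->
  \sum_(m < n) expR (- (b * m%:R ^+ 2)) <= 2 * (1 + (Num.sqrt b)^-1).
Proof.
move=> b0; set s := Num.sqrt b; have s0 : 0 < s by rewrite sqrtr_gt0.
have sb : s ^+ 2 = b by rewrite sqr_sqrtr// ltW.
have e14 : expR (1/4) <= 2 :> R.
  have := @expR_ge1Dx R (- (1/4)); rewrite expRN => h.
  by rewrite -[leLHS]invrK -[leRHS]invrK lef_pV2 ?posrE ?invr_gt0 ?expR_gt0//; lra.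
have q1 : expR (- s) < 1 by rewrite expR_lt1; lra.
apply: (@le_trans _ _ (\sum_(m < n) 2 * expR (- s) ^+ m)).
  apply: ler_sum => m _; rewrite -expRM_natl.
  apply: (@le_trans _ _ (expR (1/4) * expR (m%:R * - s))).
    rewrite -expRD ler_expR -sb.
    by have := sqr_ge0 (s * m%:R - 1/2); nra.
  by rewrite ler_pM2r ?expR_gt0.
rewrite -mulr_sumr ler_pM2l//; apply: le_trans (geometric_sum_le n (expR_ge0 _) q1) _.
rewrite expRN; have := expR_ge1Dx s; set E := expR s => h.
have E0 : 0 < E by exact: expR_gt0.
have -> : (1 - E^-1)^-1 = 1 + (E - 1)^-1.
  by field; rewrite ?gt_eqF//; lra.
by rewrite lerD2l lef_pV2 ?posrE//; lra.
Qed.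
End series_facts.

(** * The theta series and its size away from the peak *)

Section theta.
Variable R : realType.
Implicit Types a u v : R.
Notation fw := (fourier_weight R).

Definition theta_term a v (m : nat) : R :=
  fw m * expR (- (a * m%:R ^+ 2)) * cos (m%:R * v).

(** Jacobi's theta function: the sum over all integers k of exp(- a k^2) cos(k v). *)
Definition theta a v : R := limn (series (theta_term a v)).

Lemma fourier_weight_le2 m : fw m <= 2.
Proof. by rewrite /fourier_weight; case: ifP => _; lra. Qed.

Lemma theta_term_norm a v m : `|theta_term a v m| <= 2 * expR (- (a * m%:R ^+ 2)).
Proof.
rewrite /theta_term !normrM (ger0_norm (expR_ge0 _)) -mulrA.
rewrite (ger0_norm (ltW (fourier_weight_gt0 R m))).
apply: ler_pM; rewrite ?mulr_ge0 ?expR_ge0 ?(ltW (fourier_weight_gt0 _ _))//.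
  exact: fourier_weight_le2.
by rewrite ler_piMr ?expR_ge0// cos_max.
Qed.

Lemma theta_term0 a m : theta_term a 0 m = fw m * expR (- (a * m%:R ^+ 2)).
Proof. by rewrite /theta_term mulr0 cos0 mulr1. Qed.

Lemma theta_term0_ge0 a m : 0 <= theta_term a 0 m.
Proof. by rewrite theta_term0 mulr_ge0 ?expR_ge0// ltW// fourier_weight_gt0. Qed.

Lemma theta_term_le0 a v m : `|theta_term a v m| <= theta_term a 0 m.
Proof.
rewrite theta_term0 /theta_term normrM.
rewrite (ger0_norm (mulr_ge0 (ltW (fourier_weight_gt0 R m)) (expR_ge0 _))).
by rewrite ler_piMr ?cos_max// mulr_ge0 ?expR_ge0// ltW// fourier_weight_gt0.
Qed.

Lemma theta_cvg a v : 0 < a -> cvgn (series (theta_term a v)).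
Proof.
move=> a0; apply: (@bounded_series_cvg _ _ (2 * (2 * (1 + (Num.sqrt a)^-1)))) => n.
apply: (@le_trans _ _ (\sum_(m < n) 2 * expR (- (a * m%:R ^+ 2)))).
  by apply: ler_sum => m _; exact: theta_term_norm.
by rewrite -mulr_sumr ler_pM2l// gauss_sum_le.
Qed.

Lemma theta_psum_le a n : 0 < a -> \sum_(m < n) theta_term a 0 m <= theta a 0.
Proof.
move=> a0; have nd : nondecreasing_seq (series (theta_term a 0)).
  by apply: nondecreasing_series => k _ _; exact: theta_term0_ge0.
have := nondecreasing_cvgn_le nd (@theta_cvg a 0 a0) n.
by rewrite {1}seriesEord.
Qed.

Lemma theta_norm_le a v : 0 < a -> `|theta a v| <= theta a 0.
Proof.
move=> a0; apply: series_lim_norm_le; first exact: theta_cvg.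
apply: nearW => n; apply: le_trans (theta_psum_le n a0).
apply: (le_trans (ler_norm_sum _ _ _)); apply: ler_sum => m _; exact: theta_term_le0.
Qed.

Lemma theta0_ge1 a : 0 < a -> 1 <= theta a 0.
Proof.
move=> a0; have := theta_psum_le 1 a0; rewrite big_ord1 theta_term0 /fourier_weight /=.
by rewrite expr0n /= mulr0 oppr0 expR0 mulr1.
Qed.

Lemma theta0_large a : 0 < a -> theta a 0 - 1 <= 2 / (expR a - 1).
Proof.
move=> a0; rewrite lerBlDr; apply: limr_le; first exact: theta_cvg.
apply: nearW => n; rewrite seriesEord /=.
have ea : 0 < expR a - 1 by rewrite subr_gt0 expR_gt1.
case: n => [|n]; first by rewrite big_ord0 addr_ge0// divr_ge0// ltW.
rewrite big_ord_recl theta_term0 {1}/fourier_weight /= expr0n /= mulr0 oppr0 expR0 mulr1.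
rewrite addrC lerD2r.
have q1 : expR (- a) < 1 by rewrite expR_lt1; lra.
apply: (@le_trans _ _ (\sum_(m < n) (2 * expR (- a)) * expR (- a) ^+ m)).
  apply: ler_sum => m _; rewrite theta_term0 /fourier_weight /= -mulrA -exprS ler_pM2l//.
  rewrite -expRM_natl ler_expR mulrN lerN2 mulrC ler_pM2l//.
  by rewrite -natrX ler_nat /bump /= add1n expnS expn1 leq_pmulr.
rewrite -mulr_sumr.
apply: (le_trans (ler_wpM2l _ (geometric_sum_le n (expR_ge0 _) q1))).
  by rewrite mulr_ge0// expR_ge0.
rewrite expRN; set E := expR a in ea *.
have E0 : 0 < E by exact: expR_gt0.
have E1 : E - 1 != 0 by rewrite gt_eqF.
have E2 : E != 0 by rewrite gt_eqF.
by rewrite le_eqVlt; apply/orP; left; apply/eqP; field; rewrite ?E1 ?E2.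
Qed.

Lemma theta_sub1_le a v : 0 < a -> `|theta a v - 1| <= theta a 0 - 1.
Proof.
move=> a0.
have H w : theta a w - 1 = limn (fun n => series (theta_term a w) n - 1).
  by apply/esym/cvg_lim => //; apply: cvgB; [exact: theta_cvg|exact: cvg_cst].
have cH w : cvgn (fun n => series (theta_term a w) n - 1).
  by apply: is_cvgB; [exact: theta_cvg|exact: is_cvg_cst].
have key n : `|series (theta_term a v) n.+1 - 1| <= series (theta_term a 0) n.+1 - 1.
  rewrite !seriesEord /= !big_ord_recl.
  have T0 w : theta_term a w 0 = 1.
    by rewrite /theta_term /fourier_weight /= mul0r cos0 expr0n /= mulr0 oppr0 expR0 !mulr1.
  rewrite !T0 ![1 + _]addrC !addrK.
  by apply: (le_trans (ler_norm_sum _ _ _)); apply: ler_sum => m _; exact: theta_term_le0.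
rewrite ler_norml [theta a 0 - 1]H [theta a v - 1]H; apply/andP; split.
  rewrite -limN//; apply: ler_lim => //; first exact: is_cvgN.
  exists 1%N => // -[//|n] _ /=.
  by have := key n; rewrite ler_norml => /andP[].
apply: ler_lim => //; exists 1%N => // -[//|n] _ /=.
by have := key n; rewrite ler_norml => /andP[].
Qed.

Definition gauss_diff2 a (m : nat) : R :=
  expR (- (a * (m%:R + 1) ^+ 2)) + expR (- (a * (m%:R - 1) ^+ 2)) -
  2 * expR (- (a * m%:R ^+ 2)).

(** A second difference gains the factor [a]. The polynomial prefactor a m^2 is absorbed by a
    quarter of the Gaussian exponent, and the factor exp(2 a m) of the shift by half of it, through
    (m - 2)^2 >= 0; a quarter is left. *)
Lemma gauss_diff2_le a m : 0 < a ->
  `|gauss_diff2 a m| <= 16 * expR (2 * a) * a * expR (- (a / 4 * m%:R ^+ 2)).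
Proof.
move=> a0; rewrite /gauss_diff2; set M := m%:R.
have M0 : 0 <= M :> R by rewrite ler0n.
pose x := 2 * a * M; have x0 : 0 <= x by rewrite !mulr_ge0// ltW.
pose E := expR (- (a * M ^+ 2)); pose X := expR x; pose A := expR (- a).
have X0 : 0 < X by exact: expR_gt0.
have A0 : 0 < A by exact: expR_gt0.
have E0 : 0 < E by exact: expR_gt0.
have -> : expR (- (a * (M + 1) ^+ 2)) = E * A * X^-1.
  by rewrite -expRN -!expRD; congr expR; rewrite /x; ring.
have -> : expR (- (a * (M - 1) ^+ 2)) = E * A * X.
  by rewrite -!expRD; congr expR; rewrite /x; ring.
rewrite -/E.
have X1 : 1 <= X by rewrite -expR0 ler_expR.
have A1 : A <= 1 by rewrite -expR0 ler_expR; lra.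
have A2 : 1 - a <= A by exact: expR_ge1Dx.
have XX : X - 1 <= x * X.
  have := expR_ge1Dx (- x); rewrite expRN -/X => h.
  have := ler_wpM2l (ltW X0) h; rewrite mulfV ?gt_eqF//; lra.
pose W := X + X^-1 - 2.
have WE : W = (X - 1) ^+ 2 * X^-1 by rewrite /W; field; rewrite gt_eqF.
have W0 : 0 <= W by rewrite WE mulr_ge0 ?sqr_ge0// invr_ge0 ltW.
have W1 : W <= x ^+ 2 * X.
  rewrite WE ler_pdivrMr//.
  have d1 : 0 <= X - 1 by lra.
  have d2 : 0 <= x * X by rewrite mulr_ge0// ltW.
  have h : (X - 1) ^+ 2 <= (x * X) ^+ 2 by rewrite ler_sqr ?nnegrE.
  by apply: (le_trans h); rewrite exprMn [X ^+ 2]expr2 mulrA.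
have -> : E * A * X^-1 + E * A * X - 2 * E = E * (A * W - 2 * (1 - A)).
  by rewrite /W; ring.
rewrite normrM (gtr0_norm E0).
have h1 : `|A * W - 2 * (1 - A)| <= x ^+ 2 * X + 2 * a.
  have AW : A * W <= W by rewrite ler_piMl.
  have AW0 : 0 <= A * W by rewrite mulr_ge0// ltW.
  have q0 : 0 <= x ^+ 2 * X by rewrite mulr_ge0 ?sqr_ge0// ltW.
  by rewrite ler_norml; apply/andP; split; lra.
apply: (le_trans (ler_wpM2l (ltW E0) h1)).
pose y := a * M ^+ 2; have y0 : 0 <= y by rewrite mulr_ge0 ?sqr_ge0// ltW.
have h2 : x ^+ 2 * X + 2 * a <= a * (16 * expR (y / 4)) * X.
  have e4 : 1 + y / 4 <= expR (y / 4) by exact: expR_ge1Dx.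
  have -> : x ^+ 2 = a * (4 * y) by rewrite /x /y; ring.
  have : 2 * a <= 2 * a * X by rewrite ler_peMr// ?mulr_ge0// ltW.
  have : a * X * (16 * (1 + y / 4)) <= a * X * (16 * expR (y / 4)).
    by rewrite ler_pM2l ?mulr_gt0// ler_pM2l.
  have : 0 <= a * X by rewrite mulr_ge0 ?ltW.
  lra.
apply: (le_trans (ler_wpM2l (ltW E0) h2)).
rewrite (_ : E * _ = 16 * a * (E * expR (y / 4) * X)); last by ring.
rewrite (_ : 16 * expR (2 * a) * a * _ = 16 * a * (expR (2 * a) * expR (- (a / 4 * M ^+ 2)))); last by ring.
rewrite ler_pM2l ?mulr_gt0// -!expRD ler_expR /y /x.
have := mulr_ge0 (ltW a0) (sqr_ge0 (M - 2)); lra.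
Qed.

(** Two summations by parts move the factor [2 - 2 * cos v] onto the Gaussian weights. *)
Lemma theta_second_difference a v n :
  (2 - 2 * cos v) * (\sum_(m < n.+1) theta_term a v m) =
  2 * (expR (- (a * (n%:R + 1) ^+ 2)) * cos (n%:R * v)
     - expR (- (a * n%:R ^+ 2)) * cos (n.+1%:R * v)) -
  \sum_(m < n.+1) fw m * gauss_diff2 a m * cos (m%:R * v).
Proof.
elim: n => [|n IH].
  rewrite !big_ord1 /theta_term /gauss_diff2 /fourier_weight /= !mul0r cos0 !mul1r.
  rewrite add0r sub0r sqrrN !mulr1 expr0n /= mulr0 oppr0 expR0 mulr1.
  by ring.
rewrite [\sum_(m < n.+2) theta_term a v m]big_ord_recr.
rewrite [\sum_(m < n.+2) fw m * _ * _]big_ord_recr mulrDr {}IH /=.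
rewrite /theta_term /gauss_diff2 /fourier_weight /=.
have := cos_second_difference n v.
have -> : n.+1%:R - 1 = n%:R :> R by rewrite -natr1 addrK.
have -> : (n%:R + 1 : R) = n.+1%:R by rewrite natr1.
move: (cos (n.+1%:R * v)) (cos (n%:R * v)) (cos (n.+2%:R * v)) (cos v) => c1 c0 c2 c H.
move: (expR (- (a * n.+1%:R ^+ 2))) (expR (- (a * n%:R ^+ 2)))
  (expR (- (a * (n.+1%:R + 1) ^+ 2))) (\sum_(m < n.+1) _) => f1 f0 f2 S.
have -> : c2 = 2 * c * c1 - c0 by rewrite H addrK.
by ring.
Qed.

(** The boundary terms of the summation by parts tend to 0, and the second differences sum to [a]
    times a Gaussian sum. For small [a] this gives order a^(1/2) away from the multiples of 2 pi,
    against a^(-1/2) at the peak. *)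
Lemma theta_far_le a v : 0 < a ->
  (2 - 2 * cos v) * `|theta a v| <= 64 * expR (2 * a) * (a + 2 * Num.sqrt a).
Proof.
move=> a0.
have c0 : 0 <= 2 - 2 * cos v by have := cos_le1 v; lra.
rewrite -{1}(ger0_norm c0) -normrM.
pose f n := (2 - 2 * cos v) * series (theta_term a v) n.+1.
have cf : f n @[n --> \oo] --> (2 - 2 * cos v) * theta a v.
  apply: cvgMr; have := @theta_cvg a v a0.
  by rewrite -(cvg_shiftS (series (theta_term a v))).
rewrite -(cvg_lim _ cf)//.
set B := 64 * expR (2 * a) * (a + 2 * Num.sqrt a).
have gb n : `|f n| <= 4 * expR (- (a * n%:R ^+ 2)) + B.
  rewrite /f seriesEord /= theta_second_difference.
  apply: (le_trans (ler_normB _ _)); apply: lerD.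
    rewrite normrM (ger0_norm (ler0n _ 2)).
    rewrite (_ : 4 * _ = 2 * (expR (- (a * n%:R ^+ 2)) + expR (- (a * n%:R ^+ 2)))); last by ring.
    rewrite ler_pM2l//; apply: (le_trans (ler_normB _ _)); rewrite !normrM !(ger0_norm (expR_ge0 _)).
    apply: lerD.
      rewrite (@le_trans _ _ (expR (- (a * (n%:R + 1) ^+ 2))))//.
        by rewrite ler_piMr ?expR_ge0 ?cos_max.
      rewrite ler_expR lerN2 ler_pM2l//; have := ler0n R n; nra.
    by rewrite ler_piMr ?expR_ge0 ?cos_max.
  apply: (le_trans (ler_norm_sum _ _ _)).
  apply: (@le_trans _ _ (\sum_(m < n.+1) (2 * (16 * expR (2 * a) * a)) * expR (- (a / 4 * m%:R ^+ 2)))).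
    apply: ler_sum => m _; rewrite !normrM -mulrA -[leRHS]mulrA.
    rewrite (ger0_norm (ltW (fourier_weight_gt0 R m))).
    apply: ler_pM; rewrite ?mulr_ge0 ?(ltW (fourier_weight_gt0 R m))//.
      exact: fourier_weight_le2.
    apply: le_trans (gauss_diff2_le m a0).
    by rewrite ler_piMr// cos_max.
  rewrite -mulr_sumr.
  have a4 : 0 < a / 4 by rewrite divr_gt0.
  apply: (le_trans (ler_wpM2l _ (gauss_sum_le n.+1 a4))).
    by rewrite !mulr_ge0 ?expR_ge0// ltW.
  have s0 : 0 < Num.sqrt a by rewrite sqrtr_gt0.
  have -> : Num.sqrt (a / 4) = Num.sqrt a / 2.
    rewrite sqrtrM ?ltW// sqrtrV// (_ : 4 = 2 ^+ 2) ?sqrtr_sqr ?ger0_norm//.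
    by rewrite expr2; ring.
  rewrite /B le_eqVlt; apply/orP; left; apply/eqP.
  have sa : a = Num.sqrt a ^+ 2 by rewrite sqr_sqrtr// ltW.
  move: s0 sa; move: (Num.sqrt a) (expR (2 * a)) => s e s0 ->.
  by field; rewrite gt_eqF.
have cvf : cvgn f by apply/cvg_ex; eexists; exact: cf.
rewrite -lim_norm//; apply/ler_addgt0Pr => e e0.
apply: limr_le; first exact: is_cvg_norm.
have := cvg_series_cvg_0 (@theta_cvg a 0 a0).
have e4 : 0 < e / 4 by rewrite divr_gt0.
move=> /cvgrPdist_le/(_ _ e4); apply: filterS => n.
rewrite sub0r normrN ger0_norm ?theta_term0_ge0// => h.
apply: (le_trans (gb n)); rewrite addrC lerD2l.
have : expR (- (a * n%:R ^+ 2)) <= theta_term a 0 n.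
  rewrite theta_term0 ler_peMl ?expR_ge0// /fourier_weight.
  by case: ifP => _; lra.
by move=> h2; have := le_trans h2 h; rewrite ler_pdivlMr// mulrC.
Qed.
End theta.

(** * Asymptotics of theta at the peak *)

Section theta_asymptotics.
Variable R : realType.
Implicit Types a u v : R.
Notation fw := (fourier_weight R).
Import gauss_integral_proof.

Lemma integral0_gauss_increment (x s : R) : 0 <= x -> 0 <= s ->
  s * gauss_fun (x + s) <= integral0_gauss (x + s) - integral0_gauss x <= s * gauss_fun x.
Proof.
move=> x0 s0.
have ig (A B : itv_bound R) : (@lebesgue_measure R).-integrable [set` Interval A B] (EFin \o @gauss_fun R).
  exact: integrableS (integrableT_gauss).
rewrite /integral0_gauss Rintegral_itvB//; last by rewrite bnd_simp lerDl.
have ms : fine (lebesgue_measure [set` `]x, (x + s)]]) = s.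
  rewrite lebesgue_measure_itv /= lte_fin ltrDl; case: ltP => h.
    by rewrite -EFinB /= addrC addKr.
  by apply/eqP; rewrite eq_le s0.
have ic (c : R) : (@lebesgue_measure R).-integrable [set` `]x, (x + s)]] (EFin \o (fun=> c)).
  apply: measurable_bounded_integrable => //.
  - rewrite -[X in (X < _)%E]/(lebesgue_measure [set` `]x, (x + s)]]).
    by rewrite lebesgue_measure_itv /=; case: ifP => _; rewrite -?EFinB ltry.
  - by exists `|c|; split; [exact: num_real|move=> r /ltW ? y _].
apply/andP; split.
  rewrite -{1}ms mulrC -Rintegral_cst//; apply: le_Rintegral => // y.
  rewrite /= in_itv /= => /andP[y1 y2]; rewrite /gauss_fun ler_expR lerN2.
  by rewrite ler_sqr ?nnegrE//; lra.
rewrite -[X in _ <= X * _]ms mulrC -Rintegral_cst//; apply: le_Rintegral => // y.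
rewrite /= in_itv /= => /andP[y1 y2]; rewrite /gauss_fun ler_expR lerN2.
by rewrite ler_sqr ?nnegrE//; lra.
Qed.

Lemma gauss_riemann (s : R) n : 0 <= s ->
  s * (\sum_(m < n) gauss_fun (s * m.+1%:R)) <= integral0_gauss (s * n%:R) <=
  s * (\sum_(m < n) gauss_fun (s * m%:R)).
Proof.
move=> s0; elim: n => [|n IH].
  rewrite !big_ord0 !mulr0 /integral0_gauss set_itv1 Rintegral_set1.
  by rewrite lexx.
have x0 : 0 <= s * n%:R by rewrite mulr_ge0.
have /andP[h1 h2] := integral0_gauss_increment x0 s0.
have e : s * n.+1%:R = s * n%:R + s by rewrite -natr1 mulrDr mulr1.
rewrite !big_ord_recr !mulrDr /= e.
by move: IH => /andP[h3 h4]; apply/andP; split; lra.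
Qed.

(** Upper and lower Riemann sums of the Gauss integral differ by one step. The integral is known
    through the limit pi / 4 of its square, so the comparison is made between squares. *)
Lemma theta_crude a : 0 < a -> `|Num.sqrt a * theta a 0 - Num.sqrt pi| <= Num.sqrt a.
Proof.
move=> a0; set s := Num.sqrt a; have s0 : 0 < s by rewrite sqrtr_gt0.
have sa : s ^+ 2 = a by rewrite sqr_sqrtr// ltW.
have fE m : gauss_fun (s * m%:R) = expR (- (a * m%:R ^+ 2)).
  by rewrite /gauss_fun exprMn sa.
have cI : (fun n => integral0_gauss (s * n%:R) ^+ 2) @ \oo --> (pi / 4 : R).
  apply: (@cvg_comp _ _ _ (fun n => s * n%:R) (fun x => integral0_gauss x ^+ 2) _
    (+oo%R) _ _ cvg_integral0_gauss_sqr).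
  apply/cvgryPge => A; near=> n; rewrite mulrC -ler_pdivrMr//.
  near: n; exact: nbhs_infty_ger.
pose S n := series (theta_term a 0) n.+1.
have cS : S @ \oo --> theta a 0.
  have := @theta_cvg R a 0 a0.
  by rewrite -(cvg_shiftS (series (theta_term a 0))).
have SE n : S n = 1 + 2 * \sum_(m < n) gauss_fun (s * m.+1%:R).
  rewrite /S seriesEord /= big_ord_recl theta_term0 /fourier_weight /=.
  rewrite expr0n /= mulr0 oppr0 expR0 mulr1 mulr_sumr; congr (_ + _).
  by apply: eq_bigr => m _; rewrite theta_term0 /fourier_weight /= fE.
have SE2 n : S n = 2 * \sum_(m < n.+1) gauss_fun (s * m%:R) - 1.
  rewrite SE big_ord_recl mulr0 /gauss_fun expr0n /= oppr0 expR0.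
  by rewrite (eq_bigr (fun m : 'I_n => gauss_fun (s * m.+1%:R)))//; ring.
have th1 := theta0_ge1 a0.
have sq (w : R ^nat) (l : R) : w @ \oo --> l -> (fun n => w n ^+ 2) @ \oo --> l ^+ 2.
  by move=> cw; under eq_cvg do rewrite expr2; rewrite expr2; exact: cvgM.
have pi4 : pi / 4 = (Num.sqrt pi / 2) ^+ 2 :> R.
  by rewrite expr_div_n sqr_sqrtr ?pi_ge0// expr2 -natrM.
have low : s * (theta a 0 - 1) / 2 <= Num.sqrt pi / 2.
  rewrite -ler_sqr ?nnegrE; last 2 first.
  - by rewrite divr_ge0// mulr_ge0 ?subr_ge0// ltW.
  - by rewrite divr_ge0// sqrtr_ge0.
  rewrite -pi4 -(cvg_lim _ cI)//.
  have c1 : (fun n => (s * (S n - 1) / 2) ^+ 2) @ \oo --> (s * (theta a 0 - 1) / 2) ^+ 2.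
    by apply: sq; apply: cvgMl; apply: cvgMr; apply: cvgB; [exact: cS|exact: cvg_cst].
  rewrite -(cvg_lim _ c1)//; apply: ler_lim.
  - by apply/cvg_ex; eexists; exact: c1.
  - by apply/cvg_ex; eexists; exact: cI.
  apply: nearW => n; have /andP[h _] := gauss_riemann n (ltW s0).
  have e : s * (S n - 1) / 2 = s * \sum_(m < n) gauss_fun (s * m.+1%:R) by rewrite SE; field.
  have p : 0 <= s * \sum_(m < n) gauss_fun (s * m.+1%:R).
    by rewrite mulr_ge0 ?(ltW s0)// sumr_ge0// => m _; exact: gauss_fun_ge0.
  by rewrite e ler_sqr ?nnegrE// (le_trans p h).
have upp : Num.sqrt pi / 2 <= s * (theta a 0 + 1) / 2.
  rewrite -ler_sqr ?nnegrE; last 2 first.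
  - by rewrite divr_ge0// sqrtr_ge0.
  - by rewrite divr_ge0// mulr_ge0 ?(ltW s0)//; lra.
  rewrite -pi4 -(cvg_lim _ cI)//.
  have c1 : (fun n => (s * (S n + 1) / 2) ^+ 2) @ \oo --> (s * (theta a 0 + 1) / 2) ^+ 2.
    by apply: sq; apply: cvgMl; apply: cvgMr; apply: cvgD; [exact: cS|exact: cvg_cst].
  rewrite -(cvg_lim _ c1)//; apply: ler_lim.
  - by apply/cvg_ex; eexists; exact: cI.
  - by apply/cvg_ex; eexists; exact: c1.
  apply: nearW => n; have /andP[h0 h] := gauss_riemann n (ltW s0).
  have e : s * (S n + 1) / 2 = s * \sum_(m < n.+1) gauss_fun (s * m%:R) by rewrite SE2; field.
  have p : 0 <= integral0_gauss (s * n%:R) by exact: integral0_gauss_ge0.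
  have h2 : integral0_gauss (s * n%:R) <= s * \sum_(m < n.+1) gauss_fun (s * m%:R).
    apply: (le_trans h); rewrite ler_pM2l// big_ord_recr /= lerDl; exact: gauss_fun_ge0.
  by rewrite e ler_sqr ?nnegrE// (le_trans p h2).
rewrite ler_norml; apply/andP; split; lra.
Unshelve. all: by end_near.
Qed.

(** At [pi] the cosines alternate in sign: odd indices cancel, and an even index 2 m turns a into 4
    a. *)
Lemma theta_doubling a : 0 < a -> theta a 0 + theta a pi = 2 * theta (4 * a) 0.
Proof.
move=> a0; have a40 : 0 < 4 * a by rewrite mulr_gt0.
have dbl (u : R ^nat) (l : R) : u @ \oo --> l -> (fun n => u n.*2) @ \oo --> l.
  move=> cu; apply: (@cvg_comp _ _ _ double u _ \oo) => //.
  move=> A [N _ NA]; exists N => // n /= Nn; apply: NA => /=.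
  by rewrite (leq_trans Nn)// -addnn leq_addr.
have c1 := dbl _ _ (@theta_cvg R a 0 a0); have c2 := dbl _ _ (@theta_cvg R a pi a0).
have c3 : (fun n => 2 * series (theta_term (4 * a) 0) n) @ \oo --> 2 * theta (4 * a) 0.
  by apply: cvgMr; exact: theta_cvg.
have c4 : (fun n => series (theta_term a 0) n.*2 + series (theta_term a pi) n.*2) @ \oo -->
    theta a 0 + theta a pi by exact: cvgD c1 c2.
have cospi n : cos (n.*2%:R * pi) = 1 :> R.
  rewrite -[RHS](@cos0 R) -(cosDint 0 n); congr cos.
  by rewrite -muln2 natrM add0r -pmulrn; ring.
have cospi1 n : cos ((n.*2).+1%:R * pi) = -1 :> R.
  by rewrite -natr1 mulrDl mul1r cosDpi cospi.
have E n : series (theta_term a 0) n.*2 + series (theta_term a pi) n.*2 =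
    2 * series (theta_term (4 * a) 0) n.
  rewrite !seriesEord /=; elim: n => [|n IH]; first by rewrite !big_ord0 mulr0 addr0.
  rewrite doubleS !big_ord_recr /= mulrDr -IH !theta_term0 /theta_term cospi cospi1.
  have -> : fw n.*2 = fw n by rewrite /fourier_weight double_eq0.
  have -> : a * n.*2%:R ^+ 2 = 4 * a * n%:R ^+ 2 by rewrite -muln2 natrM; ring.
  by ring.
rewrite -(cvg_lim _ c3)//; apply/esym/cvg_lim => //.
by under eq_cvg do rewrite -E; exact: c4.
Qed.

(** With g(b) = sqrt(b) theta(b, 0), the duplication formula gives g(4 b) - g(b) = sqrt(b) theta(b,
    pi), which is O(b). Along a / 4^k these increments sum to O(a), and [theta_crude] identifies the
    limit sqrt(pi). *)
Lemma theta_asymptotics (A : R) : 0 < A -> exists2 C : R, 0 < C &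
  forall a, 0 < a -> a <= A -> `|Num.sqrt a * theta a 0 - Num.sqrt pi| <= C * a.
Proof.
move=> A0; pose C := 16 * expR (2 * A) * (Num.sqrt A + 2).
have C0 : 0 < C by rewrite !mulr_gt0 ?expR_gt0// ltr_pwDr// sqrtr_ge0.
exists C => // a a0 aA.
pose g (b : R) := Num.sqrt b * theta b 0.
have step (b : R) : 0 < b -> b <= A -> `|g (4 * b) - g b| <= C * b.
  move=> b0 bA; have s0 : 0 < Num.sqrt b by rewrite sqrtr_gt0.
  have -> : g (4 * b) - g b = Num.sqrt b * theta b pi.
    have -> : theta b pi = 2 * theta (4 * b) 0 - theta b 0.
      by rewrite -(theta_doubling b0); ring.
    rewrite /g sqrtrM// (_ : 4 = 2 ^+ 2) ?sqrtr_sqr ?ger0_norm//; first by ring.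
    by rewrite expr2; ring.
  have := theta_far_le pi b0; rewrite cospi => h.
  rewrite normrM (gtr0_norm s0).
  have e : expR (2 * b) <= expR (2 * A) by rewrite ler_expR ler_pM2l.
  have sb : Num.sqrt b ^+ 2 = b by rewrite sqr_sqrtr// ltW.
  have sA : Num.sqrt b <= Num.sqrt A by rewrite ler_wsqrtr.
  have h2 : `|theta b pi| <= 16 * expR (2 * b) * (b + 2 * Num.sqrt b) by lra.
  apply: (le_trans (ler_wpM2l (ltW s0) h2)); rewrite /C.
  have -> : Num.sqrt b * (16 * expR (2 * b) * (b + 2 * Num.sqrt b)) =
      16 * (expR (2 * b) * (Num.sqrt b + 2)) * b.
    by move: sb; move: (Num.sqrt b) (expR (2 * b)) => s e1 <-; ring.
  rewrite ler_wpM2r ?(ltW b0)// -mulrA ler_pM2l//.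
  by apply: ler_pM; rewrite ?expR_ge0 ?lerD2r// addr_ge0 ?sqrtr_ge0.
have iter k : `|g a - g (a / 4 ^+ k)| <= C * a * (1 - 4 ^- k).
  elim: k => [|k IH]; first by rewrite expr0 divr1 subrr normr0 invr1 subrr mulr0.
  have p0 : 0 < 4 ^+ k :> R by rewrite exprn_gt0.
  set b := a / 4 ^+ k.+1.
  have b4 : 4 * b = a / 4 ^+ k.
    by rewrite /b exprS; field; rewrite gt_eqF.
  have b0 : 0 < b by rewrite divr_gt0// exprn_gt0.
  have bA : b <= A.
    apply: le_trans aA; rewrite ler_pdivrMr ?exprn_gt0//.
    by rewrite ler_peMr ?ltW// exprn_egt1 ?ltr1n.
  rewrite -(subrKA (g (a / 4 ^+ k))); apply: (le_trans (ler_normD _ _)).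
  have h := step b b0 bA; rewrite b4 in h.
  have bE : b = a * 4 ^- k / 4 by rewrite /b exprS; field; rewrite gt_eqF.
  apply: (le_trans (lerD IH h)); rewrite exprS invfM bE !mulrA.
  have q0 : 0 <= C * a * 4 ^- k by apply: divr_ge0; [exact: ltW (mulr_gt0 C0 a0)|exact: ltW].
  by move: q0; move: (4 ^- k) (C * a) => q Ca q0; lra.
have c1 : (fun k => `|g a - g (a / 4 ^+ k)|) @ \oo --> `|g a - Num.sqrt pi|.
  apply: cvg_norm; apply: cvgB; first exact: cvg_cst.
  have c4 : (fun k => a / 4 ^+ k : R) @ \oo --> (0 : R).
    have := @cvg_geometric R a (4^-1).
    rewrite (_ : geometric a 4^-1 = (fun k => a / 4 ^+ k)); last first.
      by apply/funext => k; rewrite /geometric /= exprVn.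
    by apply; rewrite ger0_norm// invf_lt1// ltr1n.
  apply/cvgrPdist_le => e e0.
  have : (fun k => Num.sqrt (a / 4 ^+ k)) @ \oo --> Num.sqrt (0 : R).
    by apply: continuous_cvg => //; exact: sqrt_continuous.
  rewrite sqrtr0 => /cvgrPdist_le/(_ _ e0); apply: filterS => k.
  rewrite sub0r normrN ger0_norm ?sqrtr_ge0// => h; rewrite distrC.
  by apply: le_trans h; apply: theta_crude; rewrite divr_gt0// exprn_gt0.
rewrite -/(g a) -(cvg_lim _ c1)//; apply: limr_le; first by apply/cvg_ex; eexists; exact: c1.
apply: nearW => k; apply: (le_trans (iter k)).
apply: ler_piMr; first exact: ltW (mulr_gt0 C0 a0).
by rewrite gerBl invr_ge0 exprn_ge0.
Qed.
End theta_asymptotics.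

(** * Triple sums over cubes and over balls *)

Section box_sums.
Variable R : realType.
Implicit Types F : nat -> nat -> nat -> R.

Definition box_sum (n : nat) F : R := \sum_(a < n) \sum_(b < n) \sum_(c < n) F a b c.

Lemma sum_widen (f : nat -> R) m n : (m <= n)%N ->
  \sum_(a < m) f a = \sum_(a < n) (a < m)%N%:R * f a.
Proof.
move=> mn; rewrite (big_ord_widen n f mn) big_mkcond /=.
by apply: eq_bigr => a _; case: ifP; rewrite ?mul1r ?mul0r.
Qed.

Lemma box_sum_widen m n F : (m <= n)%N ->
  box_sum m F = box_sum n (fun a b c => ((a < m) && (b < m) && (c < m))%N%:R * F a b c).
Proof.
move=> mn; rewrite /box_sum (sum_widen (fun a => \sum_(b < m) \sum_(c < m) F a b c) mn).
apply: eq_bigr => a _; rewrite (sum_widen (fun b => \sum_(c < m) F a b c) mn).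
rewrite mulr_sumr; apply: eq_bigr => b _; rewrite (sum_widen (fun c => F a b c) mn).
rewrite !mulr_sumr; apply: eq_bigr => c _.
by case: (a < m)%N; case: (b < m)%N; case: (c < m)%N; rewrite /= ?mul1r ?mul0r.
Qed.

Lemma box_sum_prod n (f1 f2 f3 : nat -> R) :
  box_sum n (fun a b c => f1 a * f2 b * f3 c) =
  (\sum_(a < n) f1 a) * (\sum_(a < n) f2 a) * (\sum_(a < n) f3 a).
Proof.
rewrite -mulrA mulr_suml; apply: eq_bigr => a _.
rewrite mulr_suml mulr_sumr; apply: eq_bigr => b _.
by rewrite !mulr_sumr; apply: eq_bigr => c _; ring.
Qed.

Lemma box_sum_le n F G : (forall a b c, F a b c <= G a b c) -> box_sum n F <= box_sum n G.
Proof. by move=> FG; do 3! (apply: ler_sum => ? _). Qed.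

Lemma box_sum_norm n F : `|box_sum n F| <= box_sum n (fun a b c => `|F a b c|).
Proof. by do 3! (apply: (le_trans (ler_norm_sum _ _ _)); apply: ler_sum => ? _). Qed.

Lemma box_sumB n F G : box_sum n F - box_sum n G = box_sum n (fun a b c => F a b c - G a b c).
Proof. by rewrite /box_sum; do 3! (rewrite -sumrB; apply: eq_bigr => ? _). Qed.

Lemma level_sum_box m n F : (m < n)%N ->
  level_sum m F = box_sum n (fun a b c => (sumsq a b c == m)%:R * F a b c).
Proof.
move=> mn; have Z a b c : ((m < a) || (m < b) || (m < c))%N ->
    (sumsq a b c == m)%:R * F a b c = 0.
  by move=> /sumsq_gt h; rewrite gtn_eqF// mul0r.
case: n mn => // n; rewrite ltnS => mn; rewrite /box_sum.
rewrite (@sum_ord_trunc _ (fun a => \sum_(b < n.+1) \sum_(c < n.+1)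
  (sumsq a b c == m)%:R * F a b c) m n mn); last first.
  by move=> a ha; rewrite big1// => b _; rewrite big1// => c _; rewrite Z// ha.
apply: eq_bigr => a _.
rewrite (@sum_ord_trunc _ (fun b => \sum_(c < n.+1)
  (sumsq a b c == m)%:R * F a b c) m n mn); last first.
  by move=> b hb; rewrite big1// => c _; rewrite Z// hb orbT.
apply: eq_bigr => b _.
rewrite (@sum_ord_trunc _ (fun c => (sumsq a b c == m)%:R * F a b c) m n mn); last first.
  by move=> c hc; rewrite Z// hc !orbT.
rewrite big_mkcond /=; apply: eq_bigr => c _.
by case: ifP => _; rewrite ?mul1r ?mul0r.
Qed.

Lemma sum_level_sum n (g : nat -> R) F :
  \sum_(m < n) g m * level_sum m F =
  box_sum n (fun a b c => (sumsq a b c < n)%N%:R * (g (sumsq a b c) * F a b c)).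
Proof.
under eq_bigr do rewrite (level_sum_box _ (ltn_ord _)) mulr_sumr.
rewrite exchange_big; apply: eq_bigr => a _.
under eq_bigr do rewrite mulr_sumr.
rewrite exchange_big; apply: eq_bigr => b _.
under eq_bigr do rewrite mulr_sumr.
rewrite exchange_big; apply: eq_bigr => c _ /=.
have [h|h] := ltnP (sumsq a b c) n.
  rewrite (bigD1 (Ordinal h))//= eqxx !mul1r big1 ?addr0// => m.
  by rewrite -val_eqE /= eq_sym => /negbTE->; rewrite mul0r mulr0.
rewrite mul0r big1// => m _; rewrite gtn_eqF ?mul0r ?mulr0//.
exact: leq_trans (ltn_ord m) h.
Qed.
End box_sums.

(** * The heat kernel as a product of theta functions *)

Section heat_kernel_theta.
Variables (R : realType) (lam : nat -> R) (phi : nat -> R * R * R -> R).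
Hypothesis B : laplace_eigenbasis lam phi.
Notation fw := (fourier_weight R).
Implicit Types (x y : R * R * R).

Definition theta3 (a : R) x y : R := theta a (2 * pi * (x.1.1 - y.1.1)) *
  theta a (2 * pi * (x.1.2 - y.1.2)) * theta a (2 * pi * (x.2 - y.2)).

Variable r : nat -> nat.
Hypothesis rE : forall k, lam k = 4 * pi ^+ 2 * (r k)%:R.

Let term (a : R) x y k : R := expR (- (a * (r k)%:R)) * (phi k x * phi k y).

Let wave_term (a : R) x y (i j k : nat) : R := theta_term a (2 * pi * (x.1.1 - y.1.1)) i *
  theta_term a (2 * pi * (x.1.2 - y.1.2)) j * theta_term a (2 * pi * (x.2 - y.2)) k.

Let wave_termE a x y i j k : expR (- (a * (sumsq i j k)%:R)) *
  (fw i * fw j * fw k * wave3 i j k x y) = wave_term a x y i j k.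
Proof.
have -> : expR (- (a * (sumsq i j k)%:R)) =
    expR (- (a * i%:R ^+ 2)) * expR (- (a * j%:R ^+ 2)) * expR (- (a * k%:R ^+ 2)).
  by rewrite /sumsq !natrD !natrX !mulrDr !opprD !expRD.
rewrite /wave_term /theta_term /wave3 /coswave.
have E (m : nat) (u : R) : m%:R * (2 * pi * u) = 2 * pi * m%:R * u by ring.
by rewrite !E; ring.
Qed.

Let cube_ge0 (a : R) i j k :
  0 <= theta_term a 0 i * theta_term a 0 j * theta_term a 0 k.
Proof.
exact: mulr_ge0 (mulr_ge0 (theta_term0_ge0 a i) (theta_term0_ge0 a j)) (theta_term0_ge0 a k).
Qed.

Let wave_term_le a x y i j k : `|wave_term a x y i j k| <=
  theta_term a 0 i * theta_term a 0 j * theta_term a 0 k.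
Proof.
rewrite /wave_term normrM normrM; apply: ler_pM => //; last exact: theta_term_le0.
by apply: ler_pM => //; exact: theta_term_le0.
Qed.

Let cube_le (a : R) n : 0 < a ->
  box_sum n (fun i j k => theta_term a 0 i * theta_term a 0 j * theta_term a 0 k) <= theta a 0 ^+ 3.
Proof.
move=> a0; rewrite box_sum_prod.
have H := theta_psum_le n a0.
have H0 : 0 <= \sum_(i < n) theta_term a 0 i by apply: sumr_ge0 => i _; exact: theta_term0_ge0.
rewrite !exprS expr0 mulr1 mulrA; apply: ler_pM; rewrite ?mulr_ge0//.
exact: ler_pM.
Qed.

Let sum_by_level n N (f : nat -> R) : (forall k, (k < n)%N -> (r k < N)%N) ->
  \sum_(k < n) f k = \sum_(m < N) \sum_(k < n | r k == m) f k.
Proof.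
move=> rN; rewrite (exchange_big_dep xpredT)//=; apply: eq_bigr => k _.
by rewrite (big_pred1 (Ordinal (rN k (ltn_ord k))))// => m /=; rewrite -val_eqE eq_sym.
Qed.

(** Grouping by level lets Bessel's inequality replace the unknown squares by [level_mult], whose
    weighted sum is part of the cube of a theta series. Absolute convergence off the diagonal
    follows. *)
Let diag_le a x n : 0 < a -> \sum_(k < n) expR (- (a * (r k)%:R)) * phi k x ^+ 2 <= theta a 0 ^+ 3.
Proof.
move=> a0.
have rN k : (k < n)%N -> (r k < (r n).+1)%N.
  by move=> kn; rewrite ltnS; apply: (level_nondecreasing B rE); exact: ltnW.
rewrite (sum_by_level (fun k => expR (- (a * (r k)%:R)) * phi k x ^+ 2) rN).
apply: le_trans (cube_le (r n).+1 a0).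
apply: (@le_trans _ _ (\sum_(m < (r n).+1) expR (- (a * m%:R)) * level_mult R m)).
  apply: ler_sum => m _.
  rewrite (eq_bigr (fun k : 'I_n => expR (- (a * m%:R)) * phi k x ^+ 2)); last by move=> k /eqP->.
  rewrite -mulr_sumr ler_pM2l ?expR_gt0//.
  pose s := [seq k <- iota 0 n | r k == m].
  have -> : \sum_(k < n | r k == m) phi k x ^+ 2 = \sum_(k <- s) phi k x ^+ 2.
    rewrite big_filter -(big_mkord (fun k => r k == m) (fun k => phi k x ^+ 2)).
    by rewrite /index_iota subn0.
  apply: (level_bessel B rE); first by rewrite filter_uniq// iota_uniq.
  by apply/allP => j; rewrite mem_filter => /andP[].
rewrite /level_mult (sum_level_sum _ (fun m => expR (- (a * m%:R)))); apply: box_sum_le => i j k.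
have -> : expR (- (a * (sumsq i j k)%:R)) * (fw i * fw j * fw k) =
    theta_term a 0 i * theta_term a 0 j * theta_term a 0 k.
  by rewrite !theta_term0 /sumsq !natrD !natrX !mulrDr !opprD !expRD; ring.
by case: ltnP => _; rewrite ?mul1r ?mul0r.
Qed.

Let term_cvg a x y : 0 < a -> cvgn (series (term a x y)).
Proof.
move=> a0; apply: (@bounded_series_cvg _ _ (theta a 0 ^+ 3)) => n.
apply: (@le_trans _ _ (\sum_(k < n) (expR (- (a * (r k)%:R)) * phi k x ^+ 2 +
   expR (- (a * (r k)%:R)) * phi k y ^+ 2) / 2)).
  apply: ler_sum => k _; rewrite normrM (ger0_norm (expR_ge0 _)) -mulrDr -mulrA.
  rewrite ler_pM2l ?expR_gt0// ler_norml; apply/andP; split.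
    by have := sqr_ge0 (phi k x + phi k y); lra.
  by have := sqr_ge0 (phi k x - phi k y); lra.
rewrite -mulr_suml big_split /=.
by have := diag_le x n a0; have := diag_le y n a0; lra.
Qed.

(** Cutting the eigenbasis between levels sums the waves over a ball; cutting the product of theta
    series sums them over a cube. The waves in the ball and outside the cube are dominated by a tail
    of the positive series at 0. *)
Lemma spectral_series_theta a x y : 0 < a ->
  limn (series (fun k => expR (- (a * (r k)%:R)) * (phi k x * phi k y))) = theta3 a x y.
Proof.
move=> a0; rewrite -/(term a x y).
have ub N := level_unbounded B rE N.
have exP N : exists n, (N <= r n)%N by have [n nN] := ub N; exists n; rewrite ltnW// nN.
(* The first index of level at least [N]: the partial sum of length [nu N] consists of the full
   levels below [N]. *)
pose nu N := ex_minn (exP N).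
have nu_lt N k : (k < nu N)%N -> (r k < N)%N.
  rewrite /nu; case: ex_minnP => m _ mmin km; rewrite ltnNge; apply/negP => /mmin.
  by rewrite leqNgt km.
have nu_ge N k : (nu N <= k)%N -> (N <= r k)%N.
  rewrite /nu; case: ex_minnP => m Nm _ mk.
  by apply: leq_trans Nm _; apply: (level_nondecreasing B rE).
have SE N : series (term a x y) (nu N) =
    box_sum N (fun i j k => (sumsq i j k < N)%N%:R * wave_term a x y i j k).
  rewrite seriesEord /= (sum_by_level (term a x y) (nu_lt N)).
  transitivity (\sum_(m < N) expR (- (a * m%:R)) * level_kernel m x y).
    apply: eq_bigr => m _; rewrite (level_kernelE B rE (n := nu N)); last first.
      by move=> k /nu_ge; apply: leq_trans.
    by rewrite mulr_sumr; apply: eq_bigr => k /eqP <-.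
  rewrite /level_kernel (sum_level_sum _ (fun m => expR (- (a * m%:R)))).
  by do 3! (apply: eq_bigr => ? _); rewrite wave_termE.
(* Three squares of numbers below [M] add up to less than [rad M], so the ball contains the cube. *)
pose rad M := (3 * M ^ 2).+1.
have radM M : (M <= rad M)%N.
  by rewrite /rad; case: M => // M; rewrite expnS expn1 ltnW// ltnS; nia.
have nu_oo : nu (rad M) @[M --> \oo] --> \oo.
  move=> A [N _ NA]; exists (\max_(k < N.+1) (r k).+1)%N => // M /= hM; apply: NA => /=.
  rewrite leqNgt; apply/negP => nuN.
  have := nu_ge (rad M) N (ltnW nuN); rewrite leqNgt => /negP; apply.
  apply: leq_trans (radM M); apply: leq_trans hM.
  by rewrite (leq_bigmax (ord_max : 'I_N.+1)).
have c1 : series (term a x y) (nu (rad M)) @[M --> \oo] --> limn (series (term a x y)).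
  exact: (@cvg_comp _ _ _ (nu \o rad) (series (term a x y)) _ \oo _ nu_oo (term_cvg a0)).
pose V M := box_sum M (wave_term a x y).
pose V0 M := box_sum M (fun i j k => theta_term a 0 i * theta_term a 0 j * theta_term a 0 k).
have cth v : (\sum_(i < M) theta_term a v i) @[M --> \oo] --> theta a v.
  by under eq_cvg do rewrite -(big_mkord xpredT (theta_term a v)); exact: theta_cvg.
have cV : V M @[M --> \oo] --> theta3 a x y.
  under eq_cvg do rewrite /V box_sum_prod.
  by apply: cvgM; [apply: cvgM|]; exact: cth.
have cV0 : V0 M @[M --> \oo] --> theta a 0 ^+ 3.
  under eq_cvg do rewrite /V0 box_sum_prod.
  rewrite !exprS expr0 mulr1 mulrA.
  by apply: cvgM; [apply: cvgM|]; exact: cth.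
have dist M : `|series (term a x y) (nu (rad M)) - V M| <= theta a 0 ^+ 3 - V0 M.
  rewrite SE /V (box_sum_widen _ (radM M)) box_sumB; apply: (le_trans (box_sum_norm _ _)).
  apply: le_trans (lerB (cube_le (rad M) a0) (lexx _)).
  rewrite /V0 (box_sum_widen _ (radM M)) box_sumB; apply: box_sum_le => i j k.
  have T0 : 0 <= theta_term a 0 i * theta_term a 0 j * theta_term a 0 k.
    exact: cube_ge0.
  have [/andP[/andP[iM jM] kM]|_] := boolP (_ && _).
    rewrite (_ : (sumsq i j k < rad M)%N) ?subrr ?normr0 ?mul1r ?subrr//.
    rewrite /rad ltnS /sumsq !mulSn mul0n addn0 addnA.
    by rewrite !leq_add// leq_exp2r// ltnW.
  rewrite !mul0r !subr0; by case: ltnP => _; rewrite ?mul1r ?mul0r ?normr0.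
have c2 : `|series (term a x y) (nu (rad M)) - V M| @[M --> \oo] -->
    `|limn (series (term a x y)) - theta3 a x y|.
  by apply: cvg_norm; apply: cvgB.
have c3 : (theta a 0 ^+ 3 - V0 M) @[M --> \oo] --> 0.
  by rewrite -[X in _ --> X](subrr (theta a 0 ^+ 3)); apply: cvgB; [exact: cvg_cst|exact: cV0].
have : `|limn (series (term a x y)) - theta3 a x y| <= 0.
  rewrite -(cvg_lim _ c2)// -(cvg_lim _ c3)//; apply: ler_lim.
  - by apply/cvg_ex; eexists; exact: c2.
  - by apply/cvg_ex; eexists; exact: c3.
  - by apply: nearW => m; exact: dist.
by rewrite normr_le0 subr_eq0 => /eqP.
Qed.

Lemma heat_kernel_theta_level (l t : R) x y : 0 < l -> 0 < t ->
  heat_kernel lam phi l t x y = l ^- 3 * theta3 (4 * pi ^+ 2 * t * l ^- 2) (l^-1 *: x) (l^-1 *: y).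
Proof.
move=> l0 t0; rewrite /heat_kernel; congr (_ * _).
rewrite -spectral_series_theta; last first.
  by rewrite !mulr_gt0 ?exprn_gt0 ?pi_gt0// invr_gt0 exprn_gt0.
congr (limn (series _)); apply/funext => k; rewrite rE -mulrA; congr (expR _ * _).
by ring.
Qed.
End heat_kernel_theta.

Lemma heat_kernel_theta (R : realType) (lam : nat -> R) (phi : nat -> R * R * R -> R)
    (l t : R) (x y : R * R * R) : laplace_eigenbasis lam phi -> 0 < l -> 0 < t ->
  heat_kernel lam phi l t x y = l ^- 3 * theta3 (4 * pi ^+ 2 * t * l ^- 2) (l^-1 *: x) (l^-1 *: y).
Proof. by move=> B; have [r rE] := eigenvalue_level B; exact: heat_kernel_theta_level. Qed.

(** * The heat trace *)

Section partition_function.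
Variable R : realType.
Implicit Types t : R.

Definition theta_time t : R := theta (4 * pi ^+ 2 * t) 0.

(* The [Z t] of the paper; its leading term as [t] tends to [0] is [four_pi_sqrt t ^+ 3]. *)
Definition heat_trace t : R := theta_time t ^+ 3.

Definition four_pi_sqrt t : R := (Num.sqrt (4 * pi * t))^-1.

(** The derivative of 2 s / (1 + s) with s = sqrt t, hence of finite integral; it behaves as
    t^(-1/2) near 0 and as t^(-3/2) at infinity. *)
Definition decay t : R := (Num.sqrt t * (1 + Num.sqrt t) ^+ 2)^-1.

Lemma decay_gt0 t : 0 < t -> 0 < decay t.
Proof.
by move=> t0; rewrite invr_gt0 mulr_gt0 ?exprn_gt0 ?sqrtr_gt0// ltr_pwDl// sqrtr_ge0.
Qed.

Lemma time_gt0 t : 0 < t -> 0 < 4 * pi ^+ 2 * t.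
Proof.
move=> t0; apply: mulr_gt0 => //; apply: mulr_gt0 => //.
exact: exprn_gt0 (pi_gt0 R).
Qed.

Lemma decay_small t : 0 < t -> t <= 1 -> (Num.sqrt t)^-1 <= 4 * decay t.
Proof.
move=> t0 t1; rewrite /decay; set s := Num.sqrt t.
have s0 : 0 < s by rewrite sqrtr_gt0.
have s1 : s <= 1 by rewrite -sqrtr1 ler_wsqrtr.
have u0 : 0 < 1 + s by rewrite ltr_pwDl// ltW.
have u2 : 0 < (1 + s) ^+ 2 by exact: exprn_gt0.
rewrite invfM mulrCA ler_peMr ?invr_ge0 ?(ltW s0)// ler_pdivlMr// mul1r expr2.
by nra.
Qed.

Lemma decay_large t : 1 <= t -> (Num.sqrt t ^+ 3)^-1 <= 4 * decay t.
Proof.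
move=> t1; rewrite /decay; set s := Num.sqrt t.
have s1 : 1 <= s by rewrite -sqrtr1 ler_wsqrtr.
have s0 : 0 < s by apply: lt_le_trans s1.
have u0 : 0 < 1 + s by rewrite ltr_pwDl// ltW.
have s3 : 0 < s ^+ 3 by exact: exprn_gt0.
have u2 : 0 < s * (1 + s) ^+ 2 by apply: mulr_gt0 => //; exact: exprn_gt0.
rewrite -[leLHS]mul1r ler_pdivrMr// mulrAC ler_pdivlMr// mul1r.
rewrite (_ : 4 * s ^+ 3 = s * (4 * s ^+ 2)); last by ring.
by rewrite ler_pM2l// expr2 expr2; nra.
Qed.

Lemma sqrt_time t : 0 < t -> Num.sqrt (4 * pi ^+ 2 * t) = 2 * pi * Num.sqrt t.
Proof.
move=> t0; have p0 := pi_gt0 R.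
rewrite (_ : 4 * pi ^+ 2 = (2 * pi) ^+ 2); last by ring.
by rewrite sqrtrM ?sqr_ge0// sqrtr_sqr ger0_norm// mulr_ge0// ltW.
Qed.

Lemma theta_time_small : exists2 D : R, 0 < D & forall t, 0 < t -> t <= 1 ->
  theta_time t <= D / Num.sqrt t /\ `|theta_time t - four_pi_sqrt t| <= D * Num.sqrt t.
Proof.
have p0 := pi_gt0 R.
have A0 : 0 < 4 * pi ^+ 2 :> R by rewrite mulr_gt0// exprn_gt0.
have [C C0 HC] := theta_asymptotics A0.
pose c0 : R := (2 * Num.sqrt pi)^-1.
have sp0 : 0 < Num.sqrt pi :> R by rewrite sqrtr_gt0.
have c00 : 0 < c0 by rewrite invr_gt0 mulr_gt0.
exists (c0 + C * (2 * pi)); first by rewrite addr_gt0// !mulr_gt0.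
move=> t t0 t1; set s := Num.sqrt t; have s0 : 0 < s by rewrite sqrtr_gt0.
have s1 : s <= 1 by rewrite -sqrtr1 ler_wsqrtr.
have st : s ^+ 2 = t by rewrite sqr_sqrtr// ltW.
have yE : four_pi_sqrt t = c0 / s.
  rewrite /four_pi_sqrt -mulrA (_ : 4 = 2 ^+ 2); last by rewrite expr2; ring.
  rewrite sqrtrM ?sqr_ge0// sqrtr_sqr ger0_norm// sqrtrM ?ltW// /c0 -/s.
  by rewrite !invfM mulrA.
have H := HC _ (time_gt0 t0); rewrite (sqrt_time t0) -/s in H.
have {}H : `|2 * pi * s * theta_time t - Num.sqrt pi| <= C * (4 * pi ^+ 2 * t).
  by apply: H; rewrite ler_piMr// ltW.
have E : 2 * pi * s * theta_time t - Num.sqrt pi = 2 * pi * s * (theta_time t - four_pi_sqrt t).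
  rewrite yE /c0 mulrBr; congr (_ - _).
  have := sqr_sqrtr (ltW p0); move: sp0; move: (Num.sqrt pi) => q q0 <-; field.
  by rewrite !gt_eqF.
have ps : 0 < 2 * pi * s by rewrite !mulr_gt0.
have d : `|theta_time t - four_pi_sqrt t| <= C * (2 * pi) * s.
  rewrite E normrM (gtr0_norm ps) -ler_pdivlMl// in H.
  have scale (p q c : R) : 0 < p -> 0 < q ->
      (2 * p * q)^-1 * (c * (4 * p ^+ 2 * q ^+ 2)) = c * (2 * p) * q.
    by move=> hp hq; field; rewrite !gt_eqF.
  by apply: (le_trans H); rewrite -st scale.
split; last by apply: (le_trans d); rewrite ler_wpM2r ?(ltW s0)//; lra.
rewrite ler_pdivlMr//.
have : theta_time t <= c0 / s + C * (2 * pi) * s by move: d; rewrite ler_norml yE; lra.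
move=> /(ler_wpM2r (ltW s0)) h; apply: (le_trans h).
have K0 : 0 <= C * (2 * pi) by exact: ltW (mulr_gt0 C0 (mulr_gt0 (ltr0Sn _ _) p0)).
rewrite mulrDl divfK ?gt_eqF// lerD2l -[leLHS]mulrA.
by move: (C * (2 * pi)) K0 => K K0; nra.
Qed.

(** The exponential decay is weakened to the power t^(-5/2): multiplied by t it still leaves
    t^(-3/2), the rate of [decay]. *)
Lemma theta_time_large t : 1 <= t -> theta_time t - 1 <= 12 / Num.sqrt t ^+ 5.
Proof.
move=> t1; have t0 : 0 < t by apply: lt_le_trans t1.
apply: (le_trans (theta0_large (time_gt0 t0))).
set s := Num.sqrt t; have s0 : 0 < s by rewrite sqrtr_gt0.
have s1 : 1 <= s by rewrite -sqrtr1 ler_wsqrtr.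
have st : s ^+ 2 = t by rewrite sqr_sqrtr// ltW.
have p1 : 1 <= pi :> R by have := pi_ge2 R; lra.
have h : t <= 4 * pi ^+ 2 * t.
  by rewrite ler_peMl ?ltW//; have := exprn_ege1 2 p1; lra.
have h1 : t ^+ 3 / 6 <= expR (4 * pi ^+ 2 * t) - 1.
  have := @expR_ge1Dxn R t 2 (ltW t0); rewrite (_ : 3`!%:R = 6)// => h2.
  have : expR t <= expR (4 * pi ^+ 2 * t) by rewrite ler_expR.
  lra.
have t3 : 0 < t ^+ 3 by rewrite exprn_gt0.
have s5 : 0 < s ^+ 5 by rewrite exprn_gt0.
rewrite ler_pdivrMr; last by apply: lt_le_trans h1; rewrite divr_gt0.
rewrite mulrAC ler_pdivlMr//.
have h2 : s ^+ 5 <= t ^+ 3.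
  by rewrite -st -exprM (exprSr s 5) ler_peMr// ltW.
lra.
Qed.

Lemma theta_time_ge1 t : 0 < t -> 1 <= theta_time t.
Proof. by move=> t0; exact: theta0_ge1 (time_gt0 t0). Qed.

Lemma heat_trace_ge1 t : 0 < t -> 1 <= heat_trace t.
Proof. by move=> t0; rewrite exprn_ege1// theta_time_ge1. Qed.

Lemma heat_trace_large : exists2 M : R, 0 < M &
  forall t, 1 <= t -> heat_trace t - 1 <= M / Num.sqrt t ^+ 5.
Proof.
(* [theta_time t] is at most 13 here, and 13^2 + 13 + 1 = 183. *)
exists (12 * 183) => [|t t1]; first by rewrite mulr_gt0. have t0 : 0 < t by apply: lt_le_trans t1.
have h := theta_time_large t1; have x1 := theta_time_ge1 t0.
set s := Num.sqrt t in h *.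
have s1 : 1 <= s by rewrite -sqrtr1 ler_wsqrtr.
have s5 : 1 <= s ^+ 5 by rewrite exprn_ege1.
have i5 : (s ^+ 5)^-1 <= 1 by rewrite invf_le1// (lt_le_trans _ s5).
have i50 : 0 <= (s ^+ 5)^-1 by rewrite invr_ge0 (le_trans _ s5).
rewrite /heat_trace; set x := theta_time t in h x1 *.
have x13 : x <= 13 by lra.
have -> : x ^+ 3 - 1 = (x - 1) * (x ^+ 2 + x + 1) by ring.
have q : x ^+ 2 + x + 1 <= 183 by nra.
have q0 : 0 <= x ^+ 2 + x + 1 by nra.
have x10 : 0 <= x - 1 by lra.
by rewrite mulrAC; apply: ler_pM.
Qed.

(** The first bound will control the mean, the second the variance. For t <= 1, in x^3 - y^3 = (x -
    y) (x^2 + x y + y^2) the two factors are of orders t^(1/2) and 1 / t. *)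
Lemma heat_trace_estimate : exists2 C : R, 0 < C & forall t, 0 < t ->
  `|heat_trace t - 1 - four_pi_sqrt t ^+ 3| <= C * decay t /\
  t * (heat_trace t - 1) <= C * decay t.
Proof.
have p0 := pi_gt0 R.
have [D D0 HD] := theta_time_small.
have [M M0 HM] := heat_trace_large.
pose K := 3 * D ^+ 3.
exists (4 * (K * 4 + 1 + D ^+ 3 + M + 1)).
  have D3 : 0 < D ^+ 3 by rewrite exprn_gt0.
  by rewrite /K; lra.
move=> t t0; set s := Num.sqrt t; have s0 : 0 < s by rewrite sqrtr_gt0.
have st : s ^+ 2 = t by rewrite sqr_sqrtr// ltW.
have d0 := decay_gt0 t0.
have D3 : 0 < D ^+ 3 by rewrite exprn_gt0.
have Z1 := heat_trace_ge1 t0.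
have y0 : 0 < four_pi_sqrt t by rewrite invr_gt0 sqrtr_gt0 !mulr_gt0.
have ys : four_pi_sqrt t <= s^-1.
  rewrite lef_pV2 ?posrE ?sqrtr_gt0 ?mulr_gt0// ler_wsqrtr// ler_peMl ?ltW//.
  by have := pi_ge2 R; lra.
have x1 := theta_time_ge1 t0.
have [t1|/ltW t1] := leP t 1.
  have [h1 h2] := HD t t0 t1; have dl := decay_small t0 t1.
  rewrite -/s in h1 h2 dl.
  have s1 : s <= 1 by rewrite -sqrtr1 ler_wsqrtr.
  have is1 : 1 <= s^-1 by rewrite invf_ge1.
  split.
    have h3 : `|heat_trace t - four_pi_sqrt t ^+ 3| <= K * 4 * s^-1.
      rewrite /heat_trace; set x := theta_time t in h1 h2 x1 *; set y := four_pi_sqrt t in h2 y0 ys *.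
      have -> : x ^+ 3 - y ^+ 3 = (x - y) * (x ^+ 2 + x * y + y ^+ 2) by ring.
      rewrite normrM [X in _ * X]ger0_norm; last by rewrite !addr_ge0 ?sqr_ge0 ?mulr_ge0//; lra.
      have yD : y <= (D + D) / s.
        have : y <= x + D * s by move: h2; rewrite ler_norml; lra.
        move=> h; apply: (le_trans h); rewrite mulrDl lerD//.
        by rewrite ler_pM2l// (le_trans s1).
      have x0 : 0 <= x by lra.
      have q : x ^+ 2 + x * y + y ^+ 2 <= 12 * D ^+ 2 / s ^+ 2.
        have a1 : x ^+ 2 <= (D / s) ^+ 2 by rewrite ler_sqr ?nnegrE// divr_ge0// ltW.
        have a2 : x * y <= (D / s) * ((D + D) / s) by apply: ler_pM => //; exact: ltW.
        have a3 : y ^+ 2 <= ((D + D) / s) ^+ 2.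
          have q0 : 0 <= (D + D) / s by apply: le_trans yD; exact: ltW.
          by rewrite ler_sqr ?nnegrE ?(ltW y0).
        have E1 : (D / s) ^+ 2 = D ^+ 2 / s ^+ 2 by rewrite expr_div_n.
        have E2 : (D / s) * ((D + D) / s) = 2 * (D ^+ 2 / s ^+ 2) by field; rewrite gt_eqF.
        have E3 : ((D + D) / s) ^+ 2 = 4 * (D ^+ 2 / s ^+ 2) by field; rewrite gt_eqF.
        have p : 0 <= D ^+ 2 / s ^+ 2 by rewrite divr_ge0 ?sqr_ge0.
        rewrite E1 in a1; rewrite E2 in a2; rewrite E3 in a3; lra.
      apply: (@le_trans _ _ (D * s * (12 * D ^+ 2 / s ^+ 2))).
        by apply: ler_pM => //; rewrite !addr_ge0 ?sqr_ge0 ?mulr_ge0// ltW.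
      rewrite /K le_eqVlt; apply/orP; left; apply/eqP; field.
      by rewrite gt_eqF.
    have : `|heat_trace t - 1 - four_pi_sqrt t ^+ 3| <= (K * 4 + 1) * s^-1.
      rewrite addrAC; apply: (le_trans (ler_normB _ _)); rewrite normr1 mulrDl mul1r.
      exact: lerD.
    move=> /le_trans; apply.
    have K0 : 0 <= K * 4 + 1 by rewrite addr_ge0// !mulr_ge0// ltW.
    apply: (le_trans (ler_wpM2l K0 dl)); rewrite mulrCA -mulrA ler_pM2l// ler_pM2r//.
    lra.
  have : t * (heat_trace t - 1) <= D ^+ 3 * s^-1.
    apply: (@le_trans _ _ (t * (D / s) ^+ 3)).
      rewrite ler_pM2l// (@le_trans _ _ (heat_trace t))//; first lra.
      by rewrite /heat_trace lerXn2r ?nnegrE ?divr_ge0 ?(ltW s0) ?(ltW D0)//; lra.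
    by rewrite -st le_eqVlt; apply/orP; left; apply/eqP; field; rewrite gt_eqF.
  move=> /le_trans; apply; apply: (le_trans (ler_wpM2l (ltW D3) dl)).
  rewrite mulrCA -mulrA ler_pM2l// ler_pM2r//.
  have : 0 < K by rewrite mulr_gt0.
  lra.
have dl := decay_large t1; have h := HM t t1; rewrite -/s in dl h.
have s1 : 1 <= s by rewrite -sqrtr1 ler_wsqrtr.
have s3 : 0 < (s ^+ 3)^-1 by rewrite invr_gt0 exprn_gt0.
have K0 : 0 < K by rewrite mulr_gt0.
have E5 : t * (M / s ^+ 5) = M * (s ^+ 3)^-1.
  by rewrite -st; field; rewrite gt_eqF.
have h2 : t * (heat_trace t - 1) <= M * (s ^+ 3)^-1.
  by rewrite -E5 ler_pM2l.
have h3 : heat_trace t - 1 <= M * (s ^+ 3)^-1.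
  by apply: le_trans h2; rewrite ler_peMl//; lra.
have y3 : four_pi_sqrt t ^+ 3 <= (s ^+ 3)^-1.
  by rewrite -exprVn lerXn2r ?nnegrE ?(ltW y0) ?invr_ge0 ?(ltW s0).
have y30 : 0 <= four_pi_sqrt t ^+ 3 by rewrite exprn_ge0// ltW.
have fin (x : R) : x <= (M + 1) * (s ^+ 3)^-1 -> x <= 4 * (K * 4 + 1 + D ^+ 3 + M + 1) * decay t.
  move=> /le_trans; apply; apply: (@le_trans _ _ ((M + 1) * (4 * decay t))); first (rewrite ler_pM2l//; lra).
  rewrite mulrCA -mulrA ler_pM2l// ler_pM2r//; lra.
split; apply: fin; last lra.
by rewrite ler_norml; apply/andP; split; lra.
Qed.

(** Comparison with the increments of the primitive 2 s / (1 + s), s = sqrt(h j), over steps of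
    length [h]; the primitive is at most 2. *)
Lemma decay_sum (h : R) n : 0 < h -> \sum_(j < n) decay (h * j.+1%:R) <= 2 / h.
Proof.
move=> h0.
suff H : \sum_(j < n) decay (h * j.+1%:R) <=
    2 / h * (Num.sqrt (h * n%:R) / (1 + Num.sqrt (h * n%:R))).
  apply: (le_trans H); rewrite ler_piMr ?divr_ge0 ?(ltW h0)//.
  move: (Num.sqrt _) (sqrtr_ge0 (h * n%:R)) => q q0.
  have q1 : 0 < 1 + q by rewrite ltr_pwDl.
  by rewrite ler_pdivrMr// mul1r lerDr.
elim: n => [|n IH]; first by rewrite big_ord0 mulr0 sqrtr0 mul0r mulr0.
rewrite big_ord_recr /=; apply: (le_trans (lerD IH (lexx _))).
rewrite -lerBrDl -mulrBr /decay.
set s := Num.sqrt (h * n.+1%:R); set r := Num.sqrt (h * n%:R).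
have s0 : 0 < s by rewrite sqrtr_gt0 mulr_gt0.
have r0 : 0 <= r by rewrite sqrtr_ge0.
have rs : r <= s by rewrite ler_wsqrtr// ler_pM2l// ler_nat.
have E : h = s ^+ 2 - r ^+ 2.
  rewrite !sqr_sqrtr ?mulr_ge0 ?(ltW h0)// -mulrBr -natr1 addrC addKr mulr1//.
have -> : s / (1 + s) - r / (1 + r) = h / ((s + r) * (1 + s) * (1 + r)).
  by rewrite {1}E; field; rewrite !gt_eqF//; lra.
rewrite (_ : 2 / h * _ = 2 / ((s + r) * (1 + s) * (1 + r))); last first.
  by field; rewrite !gt_eqF//; lra.
rewrite ler_pdivlMr; last by rewrite !mulr_gt0//; lra.
rewrite mulrC ler_pdivrMr; last by rewrite mulr_gt0// exprn_gt0; lra.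
have : (s + r) * (1 + s) * (1 + r) <= (s + s) * (1 + s) * (1 + s).
  by apply: ler_pM; rewrite ?mulr_ge0 ?ler_pM ?lerD2l ?lerD//; lra.
lra.
Qed.

(** Each term is below the corresponding decrement of 2 / sqrt k. *)
Lemma zeta_tail (n m : nat) : (0 < n)%N -> (n <= m)%N ->
  \sum_(n <= k < m) (Num.sqrt (k.+1%:R : R))^-1 ^+ 3 <=
  2 * ((Num.sqrt n%:R)^-1 - (Num.sqrt m%:R)^-1).
Proof.
move=> n0; elim: m => [|m IH nm]; first by rewrite leqn0 => /eqP e; rewrite e in n0.
rewrite leq_eqVlt ltnS in nm; case/orP: nm => [/eqP <-|nm].
  by rewrite big_geq// subrr mulr0.
rewrite big_nat_recr//=; apply: (le_trans (lerD (IH nm) (lexx _))).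
set s := Num.sqrt m.+1%:R; set r := Num.sqrt m%:R.
have m0 : (0 < m)%N by apply: leq_trans nm.
have s0 : 0 < s by rewrite sqrtr_gt0.
have r0 : 0 < r by rewrite sqrtr_gt0 ltr0n.
have rs : r <= s by rewrite ler_wsqrtr// ler_nat.
have E : s ^+ 2 - r ^+ 2 = 1.
  by rewrite !sqr_sqrtr// -natr1 addrC addKr.
suff : s^-1 ^+ 3 <= 2 * (r^-1 - s^-1) by lra.
have -> : r^-1 - s^-1 = ((s + r) * (r * s))^-1.
  rewrite -[RHS]mul1r -E; field; rewrite !gt_eqF//; lra.
rewrite exprVn ler_pdivlMr; last by rewrite !mulr_gt0//; lra.
rewrite mulrC ler_pdivrMr ?exprn_gt0//.
have : (s + r) * (r * s) <= (s + s) * (s * s).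
  by apply: ler_pM; rewrite ?mulr_ge0 ?ler_pM2r ?lerD2l// ?ltW//; lra.
rewrite !exprS expr0; lra.
Qed.

Lemma powR_neg32 (x : R) : 0 < x -> x `^ (- (3 / 2)) = (Num.sqrt x)^-1 ^+ 3.
Proof.
move=> x0; rewrite powRN -powR12_sqrt ?ltW// exprVn; congr (_^-1).
by rewrite -powR_mulrn ?powR_ge0// -powRrM; congr (_ `^ _); lra.
Qed.

Lemma zeta_bounds (n : nat) : (0 < n)%N ->
  0 <= zeta (3 / 2) - \sum_(k < n) (Num.sqrt (k.+1%:R : R))^-1 ^+ 3 <= 2 / Num.sqrt n%:R.
Proof.
move=> n0; rewrite /zeta.
have E : (fun k => k.+1%:R `^ (- (3 / 2))) = (fun k => (Num.sqrt (k.+1%:R : R))^-1 ^+ 3).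
  by apply/funext => k; rewrite powR_neg32.
rewrite E; set u := (fun k => _).
have u0 k : 0 <= u k by rewrite exprn_ge0// invr_ge0 sqrtr_ge0.
have nd : nondecreasing_seq (series u) by apply: nondecreasing_series => k _ _.
have bnd m : (n <= m)%N -> series u m <= series u n + 2 / Num.sqrt n%:R.
  move=> nm; rewrite /series /= (big_cat_nat _ nm)//= lerD2l.
  apply: (le_trans (zeta_tail n0 nm)); rewrite ler_pM2l// gerBl invr_ge0 sqrtr_ge0//.
have cu : cvgn (series u).
  apply: nondecreasing_is_cvgn => //; exists (series u n + 2 / Num.sqrt n%:R) => _ [m _ <-].
  by case: (leqP n m) => [/bnd//|/ltnW mn]; apply: (le_trans (nd _ _ mn)); rewrite lerDl divr_ge0// sqrtr_ge0.
have -> : \sum_(k < n) (Num.sqrt (k.+1%:R : R))^-1 ^+ 3 = series u n by rewrite seriesEord.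
apply/andP; split; first by rewrite subr_ge0; exact: nondecreasing_cvgn_le.
rewrite lerBlDl; apply: limr_le => //; near=> m; apply: bnd; near: m; exact: nbhs_infty_ge.
Unshelve. all: by end_near.
Qed.

Lemma zeta_gt0 : 0 < zeta (3 / 2) :> R.
Proof.
have /andP[h _] := @zeta_bounds 1 isT; rewrite big_ord1 sqrtr1 invr1 expr1n in h; lra.
Qed.
End partition_function.

(** * Compound Poisson laws *)

Section compound_poisson.
Variable R : realType.
Implicit Types a b : nat -> R.

(* Coefficients of [exp (\sum_(1 <= j <= N) a_j z^j / j)], the unnormalized law of
   [\sum_j j Y_j] for independent Poisson variables [Y_j] of means [a_j / j]. *)
Definition cp_poly (N : nat) a : {poly R} := \poly_(j < N.+1) (a j / j%:R).

Definition cp_coef (N : nat) a (n : nat) : R :=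
  \sum_(k < n.+1) (cp_poly N a ^+ k)`_n / k`!%:R.

Variables (N : nat) (a : nat -> R).
Hypothesis a_ge0 : forall j, 0 <= a j.

Let A := cp_poly N a.
Let m := cp_coef N a.

Let A0 : A`_0 = 0.
Proof. by rewrite /A coef_poly /= invr0 mulr0. Qed.

Let powA_small k n : (n < k)%N -> (A ^+ k)`_n = 0.
Proof.
elim: k n => // k IH n nk; rewrite exprS coefM big1// => i _.
have [i0|i0] := posnP i; first by rewrite i0 A0 mul0r.
rewrite IH ?mulr0// ltn_subLR; last by rewrite -ltnS.
by rewrite (leq_trans nk)// -add1n leq_add2r.
Qed.

Let powA_ge0 k n : 0 <= (A ^+ k)`_n.
Proof.
elim: k n => [|k IH] n; first by rewrite expr0 coef1; case: eqP.
rewrite exprS coefM sumr_ge0// => i _; rewrite mulr_ge0//.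
by rewrite /A coef_poly; case: ifP => // _; rewrite divr_ge0.
Qed.

Let cp_coefE K n : (n < K)%N -> m n = \sum_(k < K) (A ^+ k)`_n / k`!%:R.
Proof.
move=> nK; rewrite /m /cp_coef -/A.
rewrite (big_ord_widen K (fun k => (A ^+ k)`_n / k`!%:R) nK) big_mkcond /=.
apply: eq_bigr => k _; case: ltnP => // kn.
by rewrite powA_small ?mul0r.
Qed.

Lemma cp_coef_ge0 n : 0 <= m n.
Proof. by apply: sumr_ge0 => k _; rewrite divr_ge0. Qed.

Lemma cp_coef0 : m 0 = 1.
Proof. by rewrite /m /cp_coef big_ord1 expr0 coef1 divr1. Qed.

(** Coefficients of the identity M' = A' M for M = exp A; the denominators j cancel in A'. This
    recursion drives the moments, the tilt and the link with Poisson counts. *)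
Lemma cp_coef_rec n : n.+1%:R * m n.+1 =
  \sum_(j < n.+1) (if (j < N)%N then a j.+1 else 0) * m (n - j).
Proof.
have dA j : (A^`())%R`_j = if (j < N)%N then a j.+1 else 0.
  rewrite coef_deriv /A coef_poly ltnS; case: ifP => _; last by rewrite mul0rn.
  by rewrite -[LHS]mulr_natr divfK// pnatr_eq0.
rewrite (@cp_coefE n.+2)// big_ord_recl expr0 coef1 /= mul0r add0r mulr_sumr.
transitivity (\sum_(k < n.+1) \sum_(j < n.+1) (A^`())%R`_j * (A ^+ k)`_(n - j) / k`!%:R).
  apply: eq_bigr => k _; rewrite -mulr_suml -coefM.
  have -> : (A^`())%R * A ^+ k = (k.+1%:R)^-1 *: (A ^+ k.+1)^`()%R.
    by rewrite deriv_exp /= -(scaler_nat k.+1 (_ * _)) scalerA mulVf ?scale1r ?pnatr_eq0.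
  rewrite coefZ coef_deriv /bump /= add1n factS natrM invfM -mulr_natl.
  by move: ((A ^+ k.+1)`_n.+1) => c; rewrite -mulr_natr; ring.
rewrite exchange_big; apply: eq_bigr => j _; rewrite dA (@cp_coefE n.+1) ?ltnS ?leq_subr// mulr_sumr.
by apply: eq_bigr => k _; rewrite mulrA.
Qed.

(** The value A(1), that is, the logarithm of the total mass. *)
Definition cp_exponent : R := \sum_(j < N) a j.+1 / j.+1%:R.

Definition cp_mean : R := \sum_(j < N) a j.+1.

Definition cp_var : R := \sum_(j < N) j.+1%:R * a j.+1.

Let S K := \sum_(n < K) m n.

Let sum_powA_eq K k : (size (A ^+ k) <= K)%N -> \sum_(n < K) (A ^+ k)`_n = cp_exponent ^+ k.
Proof.
have A1 : A.[1] = cp_exponent.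
  rewrite /A horner_poly big_ord_recl invr0 mulr0 mul0r add0r.
  by apply: eq_bigr => j _; rewrite expr1n mulr1.
move=> sK; rewrite -A1 -horner_exp (horner_coef_wide _ sK).
by apply: eq_bigr => n _; rewrite expr1n mulr1.
Qed.

Let sum_powA K k : \sum_(n < K) (A ^+ k)`_n <= cp_exponent ^+ k.
Proof.
rewrite -(@sum_powA_eq (maxn K (size (A ^+ k)))) ?leq_maxr//.
rewrite (big_ord_widen (maxn K (size (A ^+ k))) (fun n => (A ^+ k)`_n)) ?leq_maxl//.
by rewrite [leRHS](bigID (fun n : 'I__ => (n < K)%N)) /= lerDl sumr_ge0.
Qed.

Let SE K : S K = \sum_(k < K) (\sum_(n < K) (A ^+ k)`_n) / k`!%:R.
Proof.
rewrite /S; under eq_bigr => n _ do rewrite (cp_coefE (ltn_ord n)).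
by rewrite exchange_big; apply: eq_bigr => k _; rewrite mulr_suml.
Qed.

Let Sle K : S K <= expR cp_exponent.
Proof.
have e0 : 0 <= cp_exponent by apply: sumr_ge0 => j _; rewrite divr_ge0.
have nd : nondecreasing_seq (series (exp_coeff cp_exponent)).
  by apply: nondecreasing_series => k _ _; rewrite /exp_coeff /= divr_ge0// exprn_ge0.
apply: le_trans (nondecreasing_cvgn_le nd (is_cvg_series_exp_coeff cp_exponent) K).
rewrite SE seriesEord /=; apply: ler_sum => k _.
have -> : exp_coeff cp_exponent k = cp_exponent ^+ k / k`!%:R by [].
by apply: ler_wpM2r; [rewrite invr_ge0|exact: sum_powA].
Qed.

Let Snd : nondecreasing_seq S.
Proof.
apply/nondecreasing_seqP => n; rewrite /S big_ord_recr lerDl; exact: cp_coef_ge0.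
Qed.

(** Each power of the polynomial [A] is exhausted by finitely many coefficients, so the masses
    eventually dominate every partial sum of the exponential series at A(1). *)
Let Scvg : S @ \oo --> expR cp_exponent.
Proof.
have cS : cvgn S.
  apply: nondecreasing_is_cvgn => //; exists (expR cp_exponent) => _ [K _ <-]; exact: Sle.
suff -> : expR cp_exponent = limn S by exact: cS.
apply/eqP; rewrite eq_le; apply/andP; split; last first.
  by apply: limr_le => //; apply: nearW => K; exact: Sle.
apply: limr_le; first exact: is_cvg_series_exp_coeff.
apply: nearW => k0; rewrite seriesEord /=.
pose K := maxn k0 (\max_(k < k0) size (A ^+ k)).
apply: le_trans (nondecreasing_cvgn_le Snd cS K).
have k0K : (k0 <= K)%N by exact: leq_maxl.
rewrite SE (big_ord_widen K (fun k => exp_coeff cp_exponent k) k0K) big_mkcond /=.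
apply: ler_sum => k _; case: ifP => [kk|_]; last first.
  by rewrite divr_ge0// sumr_ge0.
have -> : exp_coeff cp_exponent k = cp_exponent ^+ k / k`!%:R by [].
rewrite sum_powA_eq// /K leq_max; apply/orP; right.
exact: (leq_bigmax (Ordinal kk)).
Qed.

Let conv_sum (f : nat -> nat -> R) K :
  \sum_(n < K) \sum_(j < n.+1) f j (n - j)%N = \sum_(j < K) \sum_(i < K - j) f j i.
Proof.
elim: K => [|K IH]; first by rewrite !big_ord0.
rewrite [LHS]big_ord_recr /= IH [RHS]big_ord_recr /= subSnn big_ord1.
rewrite [X in _ + X]big_ord_recr /= subnn addrA; congr (_ + _).
rewrite -big_split /=; apply: eq_bigr => j _.
by rewrite subSn 1?ltnW// big_ord_recr.
Qed.

Let coefb (j : nat) : R := if (j < N)%N then a j.+1 else 0.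

Let sum_coefb (g : nat -> R) K : g 0%N = 0 ->
  \sum_(j < K) coefb j * g (K - j)%N = \sum_(j < N) a j.+1 * g (K - j)%N.
Proof.
move=> g0; have [KN|NK] := leqP K N.
  rewrite (big_ord_widen N (fun j => coefb j * g (K - j)%N) KN) big_mkcond /=.
  apply: eq_bigr => j _; rewrite /coefb ltn_ord; case: ltnP => // Kj.
  by rewrite (eqP Kj) g0 mulr0.
rewrite [RHS](big_ord_widen K (fun j => a j.+1 * g (K - j)%N) (ltnW NK)) [RHS]big_mkcond /=.
by apply: eq_bigr => j _; rewrite /coefb; case: ifP => //; rewrite mul0r.
Qed.

Let T K := \sum_(n < K) n%:R * m n.
Let U K := \sum_(n < K) n%:R ^+ 2 * m n.

(** The recursion expresses a moment truncated at [K] through moments of lower order truncated at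
    [K - j], so the limits follow one from another through sums of only [N] terms. *)
Let TE K : T K.+1 = \sum_(j < N) a j.+1 * S (K - j)%N.
Proof.
rewrite /T big_ord_recl mul0r add0r -sum_coefb; last by rewrite /S big_ord0.
under eq_bigr => n _ do rewrite cp_coef_rec.
rewrite (conv_sum (fun j i => coefb j * m i)); apply: eq_bigr => j _.
by rewrite /S mulr_sumr.
Qed.

Let UE K : U K.+1 = \sum_(j < N) a j.+1 * (T (K - j)%N + j.+1%:R * S (K - j)%N).
Proof.
have conv : U K.+1 = \sum_(j < K) \sum_(i < K - j) coefb j * ((i%:R + j.+1%:R) * m i).
  rewrite -(conv_sum (fun j i => coefb j * ((i%:R + j.+1%:R) * m i))).
  rewrite /U big_ord_recl expr0n mul0r add0r; apply: eq_bigr => n _.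
  rewrite !lift0 expr2 -mulrA cp_coef_rec mulr_sumr; apply: eq_bigr => j _.
  have -> : n.+1%:R = (n - j)%:R + j.+1%:R :> R by rewrite -natrD addnS subnK// -ltnS.
  by rewrite -/(coefb j); ring.
rewrite conv.
transitivity (\sum_(j < K) coefb j * (T (K - j)%N + j.+1%:R * S (K - j)%N)).
  apply: eq_bigr => j _; rewrite -mulr_sumr; congr (_ * _).
  by rewrite /T /S mulr_sumr -big_split /=; apply: eq_bigr => i _; ring.
have [KN|NK] := leqP K N.
  rewrite (big_ord_widen N (fun j => coefb j * (T (K - j)%N + j.+1%:R * S (K - j)%N)) KN).
  rewrite big_mkcond /=.
  apply: eq_bigr => j _; rewrite /coefb ltn_ord; case: ltnP => // Kj.
  by rewrite (eqP Kj) /T /S !big_ord0 mulr0 addr0 mulr0.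
rewrite [RHS](big_ord_widen K (fun j => a j.+1 * (T (K - j)%N + j.+1%:R * S (K - j)%N)) (ltnW NK)).
rewrite [RHS]big_mkcond /=.
by apply: eq_bigr => j _; rewrite /coefb; case: ifP => //; rewrite mul0r.
Qed.

Let cvg_sub (g : nat -> R) (l : R) j : g @ \oo --> l -> (fun K => g (K - j)%N) @ \oo --> l.
Proof.
move=> cg; apply: (@cvg_comp _ _ _ (fun K => (K - j)%N) g _ \oo) => //.
move=> B [M _ MB]; exists (M + j)%N => // K /= h; apply: MB => /=.
by rewrite -(leq_add2r j) subnK// (leq_trans _ h)// leq_addl.
Qed.

Let Tcvg : T @ \oo --> cp_mean * expR cp_exponent.
Proof.
rewrite -(cvg_shiftS T).
have -> : [sequence T n.+1]_n = (fun K => \sum_(j < N) a j.+1 * S (K - j)%N).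
  by apply/funext => K; exact: TE.
rewrite /cp_mean mulr_suml.
apply: cvg_big => [|j _]; first exact: add_continuous.
by apply: cvgMr; exact: cvg_sub.
Qed.

Let Ucvg : U @ \oo --> (cp_mean ^+ 2 + cp_var) * expR cp_exponent.
Proof.
rewrite -(cvg_shiftS U).
have -> : [sequence U n.+1]_n =
    (fun K => \sum_(j < N) a j.+1 * (T (K - j)%N + j.+1%:R * S (K - j)%N)).
  by apply/funext => K; exact: UE.
have -> : (cp_mean ^+ 2 + cp_var) * expR cp_exponent =
    \sum_(j < N) a j.+1 * (cp_mean * expR cp_exponent + j.+1%:R * expR cp_exponent).
  rewrite expr2 /cp_var mulrDl -mulrA {1}/cp_mean !mulr_suml -big_split /=.
  by apply: eq_bigr => j _; ring.
apply: cvg_big => [|j _]; first exact: add_continuous.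
by apply: cvgMr; apply: cvgD; [|apply: cvgMr]; exact: cvg_sub.
Qed.

Lemma cp_second_moment K :
  \sum_(n < K) (n%:R - cp_mean) ^+ 2 * m n <= cp_var * expR cp_exponent.
Proof.
pose Q K := \sum_(n < K) (n%:R - cp_mean) ^+ 2 * m n.
have QE n : Q n = U n - 2 * cp_mean * T n + cp_mean ^+ 2 * S n.
  rewrite /Q /U /T /S; move: cp_mean => mu; rewrite !mulr_sumr -sumrB -big_split /=.
  by apply: eq_bigr => i _; ring.
have cQ : Q @ \oo --> cp_var * expR cp_exponent.
  have -> : cp_var * expR cp_exponent = (cp_mean ^+ 2 + cp_var) * expR cp_exponent -
     2 * cp_mean * (cp_mean * expR cp_exponent) + cp_mean ^+ 2 * expR cp_exponent by ring.
  under eq_cvg do rewrite QE.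
  by apply: cvgD; [apply: cvgB => //; exact: cvgMr|exact: cvgMr].
have Qnd : nondecreasing_seq Q.
  apply/nondecreasing_seqP => n; rewrite /Q big_ord_recr lerDl mulr_ge0 ?sqr_ge0//.
  exact: cp_coef_ge0.
have cQ' : cvgn Q by apply/cvg_ex; eexists; exact: cQ.
by rewrite -(cvg_lim _ cQ)//; exact: nondecreasing_cvgn_le.
Qed.

Lemma cp_mass_le K : \sum_(n < K) m n <= expR cp_exponent.
Proof. exact: Sle. Qed.

(** Chebyshev's inequality; the window ends below [K], so that the mass in it is already found among
    the first [K] coefficients. *)
Lemma cp_window (K : nat) (h : R) : 0 < h -> cp_mean + h < K%:R ->
  (1 - cp_var / h ^+ 2) * expR cp_exponent <= \sum_(n < K | `|n%:R - cp_mean| <= h) m n.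
Proof.
move=> h0 hK; rewrite mulrBl mul1r lerBlDr -[X in X <= _](cvg_lim _ Scvg)//.
apply: limr_le; first by apply/cvg_ex; eexists; exact: Scvg.
near=> n.
have Kn : (K <= n)%N by near: n; exact: nbhs_infty_ge.
rewrite /S (bigID (fun i : 'I_n => `|i%:R - cp_mean| <= h)) /=; apply: lerD.
  rewrite (big_ord_widen_cond n (fun i => `|i%:R - cp_mean| <= h) m Kn).
  rewrite le_eqVlt; apply/orP; left; apply/eqP; apply: eq_bigl => i.
  case: (leP `|i%:R - cp_mean| h) => //= hi; case: ltnP => // Ki.
  have : K%:R <= i%:R :> R by rewrite ler_nat.
  by move: hi; rewrite ler_norml => /andP[_]; lra.
rewrite mulrAC ler_pdivlMr ?exprn_gt0//.
apply: le_trans (cp_second_moment n).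
rewrite [leRHS](bigID (fun i : 'I_n => `|i%:R - cp_mean| <= h)) /= mulr_suml.
rewrite -[leLHS]add0r; apply: lerD.
  by apply: sumr_ge0 => i _; rewrite mulr_ge0 ?sqr_ge0// cp_coef_ge0.
apply: ler_sum => i; rewrite -ltNge => hi; rewrite mulrC ler_wpM2r ?cp_coef_ge0//.
by rewrite -(real_normK (num_real (i%:R - cp_mean))) ler_sqr ?nnegrE// ltW.
Unshelve. all: by end_near.
Qed.

(** Exchanging the sums leaves m_i with weight K - i. With x = K - mean and y = i - mean, l (x - y)
    <= l^2 / 2 + x^2 + y^2. The scale [l] will be L^2, which bounds the order of both deviations. *)
Lemma cp_double_sum (K : nat) (l : R) : 0 < l ->
  \sum_(n < K) \sum_(i < n.+1) m i <=
  (l + 2 * ((K%:R - cp_mean) ^+ 2 + cp_var) / l) / 2 * expR cp_exponent.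
Proof.
move=> l0.
have -> : \sum_(n < K) \sum_(i < n.+1) m i = \sum_(i < K) (K%:R - i%:R) * m i.
  elim: K => [|K IH]; first by rewrite !big_ord0.
  rewrite [LHS]big_ord_recr /= IH !big_ord_recr /= addrA -big_split /=; congr (_ + _).
    by apply: eq_bigr => i _; rewrite -natr1; ring.
  by rewrite -natr1; ring.
apply: (@le_trans _ _ (\sum_(i < K) ((l + 2 * (K%:R - cp_mean) ^+ 2 / l) / 2 * m i +
   (i%:R - cp_mean) ^+ 2 * m i / l))).
  apply: ler_sum => i _; rewrite [_ * m i / l]mulrAC -mulrDl ler_wpM2r ?cp_coef_ge0//.
  have -> : (l + 2 * (K%:R - cp_mean) ^+ 2 / l) / 2 + (i%:R - cp_mean) ^+ 2 / l =
     (l ^+ 2 / 2 + (K%:R - cp_mean) ^+ 2 + (i%:R - cp_mean) ^+ 2) / l.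
    by field; rewrite gt_eqF.
  rewrite ler_pdivlMr//.
  have := sqr_ge0 (l - (K%:R - i%:R)).
  have := sqr_ge0 ((K%:R - cp_mean) + (i%:R - cp_mean)).
  by lra.
rewrite big_split /= -mulr_sumr -mulr_suml.
have l1 : 0 < l^-1 by rewrite invr_gt0.
have h1 := cp_second_moment K; have h2 := Sle K.
have q0 : 0 <= (l + 2 * (K%:R - cp_mean) ^+ 2 / l) / 2.
  apply: divr_ge0 => //; apply: addr_ge0; first exact: ltW.
  by apply: divr_ge0; rewrite ?(ltW l0)// mulr_ge0// sqr_ge0.
have := ler_wpM2l q0 h2; have := ler_wpM2r (ltW l1) h1; rewrite /S.
rewrite (_ : (l + 2 * (_ + cp_var) / l) / 2 * _ = (l + 2 * (K%:R - cp_mean) ^+ 2 / l) / 2 * expR cp_exponent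
  + cp_var * expR cp_exponent / l); first by lra.
by field; rewrite gt_eqF.
Qed.
End compound_poisson.

(** * Exponential tilting *)

Section tilting.
Variables (R : realType) (N : nat) (a : nat -> R).
Hypothesis a_ge0 : forall j, 0 <= a j.

(** A rescaling of the variable in exp A, checked through the recursion. *)
Lemma cp_coef_tilt (z : R) n : 0 <= z ->
  cp_coef N (fun j => a j * z ^+ j) n = z ^+ n * cp_coef N a n.
Proof.
move=> z0; have b_ge0 j : 0 <= a j * z ^+ j by rewrite mulr_ge0// exprn_ge0.
elim/ltn_ind: n => -[_|n IH].
  by rewrite !cp_coef0 expr0 mulr1.
have n0 : n.+1%:R != 0 :> R by rewrite pnatr_eq0.
apply: (mulfI n0); rewrite (cp_coef_rec N (fun j => a j * z ^+ j)) [RHS]mulrCA (cp_coef_rec N a) mulr_sumr.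
apply: eq_bigr => j _; rewrite IH ?ltnS ?leq_subr//; case: ifP => _; last by rewrite !mul0r mulr0.
have -> : z ^+ n.+1 = z ^+ j.+1 * z ^+ (n - j).
  by rewrite -exprD addSn subnKC// -ltnS.
by ring.
Qed.

(** Chebyshev's inequality puts three quarters of the tilted mass within [H] of a mean below n + 1 -
    H. Undoing the tilt on that window costs at most exp(s (s V + H)), V the variance: the factor
    exp(s mean) lost by the total mass is regained from the weights exp(- s i), as i is at least
    mean - s V - H there. *)
Lemma cp_lower (s H : R) (n : nat) : 0 <= s -> 0 < H -> 4 * cp_var N a <= H ^+ 2 ->
  cp_mean N (fun j => a j * expR (- s) ^+ j) + H < n.+1%:R ->
  3 / 4 * expR (- (s * (s * cp_var N a + H))) * expR (cp_exponent N a) <=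
  \sum_(i < n.+1) cp_coef N a i.
Proof.
move=> s0 H0 VH hn; set z := expR (- s) in hn.
have z0 : 0 < z by exact: expR_gt0.
pose b j := a j * z ^+ j.
have b_ge0 j : 0 <= b j by rewrite mulr_ge0// exprn_ge0// ltW.
have zj j : z ^+ j = expR (- (s * j%:R)) by rewrite -expRM_natl; congr expR; ring.
have zj1 j : z ^+ j <= 1 by rewrite zj -expR0 ler_expR oppr_le0 mulr_ge0.
have zj2 j : 1 - s * j%:R <= z ^+ j by rewrite zj; exact: expR_ge1Dx.
have Vb : cp_var N b <= cp_var N a.
  apply: ler_sum => j _; rewrite ler_wpM2l// ler_piMr//.
have mub : cp_mean N a - s * cp_var N a <= cp_mean N b.
  rewrite /cp_mean /cp_var mulr_sumr -sumrB; apply: ler_sum => j _.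
  by have := ler_wpM2l (a_ge0 j.+1) (zj2 j.+1); rewrite /b; lra.
have Ab : cp_exponent N a - s * cp_mean N a <= cp_exponent N b.
  rewrite /cp_exponent /cp_mean mulr_sumr -sumrB; apply: ler_sum => j _.
  have j0 : 0 < j.+1%:R :> R by [].
  rewrite ler_pdivlMr// mulrBl divfK ?gt_eqF//.
  by have := ler_wpM2l (a_ge0 j.+1) (zj2 j.+1); rewrite /b; lra.
have win := cp_window b_ge0 H0 hn.
have H2 : 0 < H ^+ 2 by rewrite exprn_gt0.
have q : 3 / 4 <= 1 - cp_var N b / H ^+ 2.
  have : cp_var N b / H ^+ 2 <= 1 / 4 by rewrite ler_pdivrMr//; lra.
  by lra.
(* A lower bound for the left end of the window, since tilting lowers the mean by at most [s] times
   the variance. *)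
set c := cp_mean N a - s * cp_var N a - H.
have up : \sum_(i < n.+1 | `|i%:R - cp_mean N b| <= H) cp_coef N b i <=
    expR (- (s * c)) * \sum_(i < n.+1) cp_coef N a i.
  rewrite mulr_sumr big_mkcond; apply: ler_sum => i _.
  have m0 := cp_coef_ge0 N a_ge0 i.
  case: ifP => [|_]; last by rewrite mulr_ge0 ?expR_ge0.
  rewrite ler_norml => /andP[hi _]; rewrite (cp_coef_tilt _ (ltW z0)) ler_wpM2r// zj ler_expR lerN2.
  by rewrite ler_wpM2l// /c; lra.
have E : 0 < expR (s * c) by exact: expR_gt0.
have e1 : expR (- (s * (s * cp_var N a + H))) * expR (cp_exponent N a) =
    expR (s * c) * expR (cp_exponent N a - s * cp_mean N a).
  by rewrite -!expRD; congr expR; rewrite /c; ring.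
rewrite -mulrA e1.
have h1 : expR (cp_exponent N a - s * cp_mean N a) <= expR (cp_exponent N b) by rewrite ler_expR.
have h2 : 3 / 4 * expR (cp_exponent N b) <= expR (- (s * c)) * \sum_(i < n.+1) cp_coef N a i.
  apply: le_trans up; apply: le_trans win.
  by rewrite ler_wpM2r ?expR_ge0.
have h3 : 3 / 4 * expR (cp_exponent N a - s * cp_mean N a) <=
    expR (- (s * c)) * \sum_(i < n.+1) cp_coef N a i by lra.
have e2 (x : R) : expR (s * c) * (expR (- (s * c)) * x) = x.
  by rewrite mulrA -expRD subrr expR0 mul1r.
by have := ler_wpM2l (ltW E) h3; rewrite e2 mulrCA.
Qed.

(** Partial sums are the coefficients of exp A / (1 - z), and - log(1 - z) adds 1 to every a_j. In
    [A] itself the a_j stop at [N], hence the restriction on [n]. *)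
Lemma cp_partial_sum_rec n : (n < N)%N -> n.+1%:R * (\sum_(i < n.+2) cp_coef N a i) =
  \sum_(j < n.+1) (a j.+1 + 1) * \sum_(i < (n - j).+1) cp_coef N a i.
Proof.
pose W n := \sum_(i < n.+1) cp_coef N a i.
rewrite -/(W n.+1).
elim: n => [|n IH] nN.
  have e : cp_coef N a 1 = a 1%N.
    by have := cp_coef_rec N a 0; rewrite big_ord1 /= nN sub0n cp_coef0 mulr1 mul1r.
  rewrite big_ord1 /= sub0n big_ord1 /= cp_coef0 mulr1 mul1r /W !big_ord_recr big_ord0 /=.
  by rewrite cp_coef0 e add0r addrC.
have nN' := ltnW nN.
have e1 : W n.+2 = W n.+1 + cp_coef N a n.+2 by rewrite /W big_ord_recr.
have e2 : n.+2%:R * W n.+2 = n.+1%:R * W n.+1 + W n.+1 + n.+2%:R * cp_coef N a n.+2.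
  by rewrite e1 -(natr1 n.+1); ring.
rewrite e2 (IH nN') (cp_coef_rec N a).
have e3 : W n.+1 = \sum_(j < n.+2) cp_coef N a (n.+1 - j).
  rewrite /W (reindex_inj rev_ord_inj) /=; apply: eq_bigr => j _; by rewrite subSS.
rewrite [X in _ + X + _]e3 -addrA -big_split /= [in RHS]big_ord_recr /= subnn.
rewrite [X in _ + X]big_ord_recr /= subnn nN big_ord1 addrA -big_split /=.
congr (_ + _); last by rewrite cp_coef0; ring.
apply: eq_bigr => j _; have jn : (j <= n)%N by rewrite -ltnS.
have jN : (j < N)%N by rewrite (leq_ltn_trans jn).
rewrite jN subSn//.
by rewrite [in RHS]big_ord_recr /=; ring.
Qed.
End tilting.

(** * Bounds on the heat kernel *)

Section kernel_bounds.
Variable R : realType.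
Implicit Types (a l t : R) (x y : R * R * R).

Lemma theta3_diag a x : theta3 a x x = theta a 0 ^+ 3.
Proof. by rewrite /theta3 !subrr !mulr0 !exprS expr0 mulr1 mulrA. Qed.

(** Both differences of products telescope in the same way, and the pieces compare one by one. *)
Lemma theta3_sub1_le a x y : 0 < a -> `|theta3 a x y - 1| <= theta a 0 ^+ 3 - 1.
Proof.
move=> a0; rewrite /theta3.
move: (2 * pi * (x.1.1 - y.1.1)) (2 * pi * (x.1.2 - y.1.2)) (2 * pi * (x.2 - y.2)) => u v w.
have T1 := theta0_ge1 a0.
have := theta_norm_le w a0; have := theta_norm_le v a0.
have := theta_sub1_le w a0; have := theta_sub1_le v a0; have := theta_sub1_le u a0.
move: (theta a u) (theta a v) (theta a w) (theta a 0) T1 => p q r T T1 p1 q1 r1 qT rT.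
have -> : p * q * r - 1 = (p - 1) * q * r + (q - 1) * r + (r - 1) by ring.
have -> : T ^+ 3 - 1 = (T - 1) * T * T + (T - 1) * T + (T - 1) by ring.
apply: (le_trans (ler_normD _ _)); apply: lerD => //.
apply: (le_trans (ler_normD _ _)); apply: lerD => //; rewrite !normrM.
  by apply: ler_pM => //; apply: ler_pM.
by apply: ler_pM.
Qed.

(** Since exp a >= 4, the nonconstant part of each factor is at most 2 / 3. This serves bounded [L],
    for which the times of [theta3_late] may not be reached. *)
Lemma theta3_lower a x y : 2 <= a -> 3^-1 ^+ 3 <= theta3 a x y.
Proof.
move=> a2; have a0 : 0 < a by apply: lt_le_trans a2.
have e4 : 4 <= expR a.
  apply: (@le_trans _ _ (expR (1 + 1))); last by rewrite ler_expR.
  by have := expR_ge1Dx (1 : R); rewrite expRD; nra.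
have q : theta a 0 - 1 <= 2 / 3.
  apply: (le_trans (theta0_large a0)); rewrite ler_pdivrMr; last by lra.
  by lra.
have low v : 3^-1 <= theta a v.
  by have := theta_sub1_le v a0; rewrite ler_norml => /andP[+ _]; lra.
rewrite /theta3 !exprS expr0 mulr1 mulrA.
by apply: ler_pM; [rewrite mulr_ge0 ?invr_ge0| |apply: ler_pM|]; rewrite ?invr_ge0//; exact: low.
Qed.

Lemma theta3_late : exists2 T : R, 0 < T & forall t x y, T <= t ->
  1 / 2 <= theta3 (4 * pi ^+ 2 * t) x y.
Proof.
have [M M0 HM] := heat_trace_large R.
exists (1 + (2 * M) ^+ 2) => [|t x y tT]; first by rewrite ltr_pwDl ?sqr_ge0.
have t1 : 1 <= t by apply: le_trans tT; rewrite lerDl sqr_ge0.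
have t0 : 0 < t by apply: lt_le_trans t1.
have := HM t t1; set s := Num.sqrt t => h.
have s1 : 1 <= s by rewrite -sqrtr1 ler_wsqrtr.
have sM : 2 * M <= s.
  rewrite -[2 * M]ger0_norm ?mulr_ge0 ?(ltW M0)// -sqrtr_sqr ler_wsqrtr//.
  by apply: le_trans tT; rewrite lerDr.
have s5 : s <= s ^+ 5 by rewrite exprS ler_peMr ?exprn_ege1//; lra.
have q : M / s ^+ 5 <= 1 / 2.
  by rewrite ler_pdivrMr; lra.
have := theta3_sub1_le x y (time_gt0 t0); rewrite -/(theta_time t) -/(heat_trace t).
by rewrite ler_norml => /andP[+ _]; lra.
Qed.

Lemma theta_far_uniform (d : R) : 0 < d -> d <= 2^-1 -> exists2 C : R, 0 < C &
  forall t (v : R), 0 < t -> t <= 1 -> (forall k : int, d <= `|v - k%:~R|) ->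
  `|theta (4 * pi ^+ 2 * t) (2 * pi * v)| <= C * Num.sqrt t.
Proof.
move=> d0 d2; have p0 := pi_gt0 R.
have c1 := cos2pi_lt1 d0 d2; pose g := 2 - 2 * cos (2 * pi * d).
have g0 : 0 < g by rewrite /g; lra.
pose K : R := 64 * expR (2 * (4 * pi ^+ 2)).
have K0 : 0 < K by rewrite mulr_gt0// expR_gt0.
pose E : R := 4 * pi ^+ 2 + 4 * pi.
have A0 : 0 < 4 * pi ^+ 2 :> R by rewrite mulr_gt0// exprn_gt0.
have E0 : 0 < E by rewrite /E; lra.
exists (K * E / g); first by rewrite divr_gt0// mulr_gt0.
move=> t v t0 t1 far; have [k vk] := nearest_int v.
have cg : g <= 2 - 2 * cos (2 * pi * v) by have := cos_far (ltW d0) vk (far k); rewrite /g; lra.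
have := theta_far_le (2 * pi * v) (time_gt0 t0); rewrite sqrt_time//.
set s := Num.sqrt t; move: (`|theta _ _|) (normr_ge0 (theta (4 * pi ^+ 2 * t) (2 * pi * v))) => th th0 h.
have s0 : 0 < s by rewrite sqrtr_gt0.
have s1 : s <= 1 by rewrite -sqrtr1 ler_wsqrtr.
have st : s ^+ 2 = t by rewrite sqr_sqrtr// ltW.
rewrite mulrAC ler_pdivlMr// mulrC.
apply: (@le_trans _ _ ((2 - 2 * cos (2 * pi * v)) * th)); first by rewrite ler_wpM2r.
apply: (le_trans h); rewrite -[leRHS]mulrA; apply: ler_pM.
- by rewrite mulr_ge0// expR_ge0.
- by rewrite addr_ge0 ?mulr_ge0 ?(ltW A0) ?(ltW t0) ?(ltW p0) ?(ltW s0).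
- by rewrite /K ler_pM2l// ler_expR ler_pM2l// ler_piMr// ltW.
have ts : t <= s by rewrite -st expr2 ler_piMr// ltW.
by have := ler_wpM2l (ltW A0) ts; rewrite /E; lra.
Qed.

(** If every coordinate came within eps l / 2 of the lattice, the distance would be at most sqrt 3 /
    2 times eps l. The cap 1/2 is the largest distance of a real number from the integers. *)
Lemma torus_dist_far (eps l : R) x y : 0 < eps -> 0 < l -> eps * l < torus_dist l x y ->
  let far (u v : R) := forall k : int, Num.min (eps / 2) 2^-1 <= `|l^-1 * u - l^-1 * v - k%:~R| in
  [\/ far x.1.1 y.1.1, far x.1.2 y.1.2 | far x.2 y.2].
Proof.
move=> e0 l0 dxy far; apply: contrapT => nfar.
have near u v : ~ far u v -> exists k : int, `|u - v + l * k%:~R| <= eps / 2 * l.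
  move=> /existsNP[k /negP]; rewrite -ltNge lt_min => /andP[h _].
  exists (- k); rewrite intrN.
  have -> : u - v + l * - k%:~R = (l^-1 * u - l^-1 * v - k%:~R) * l by field; rewrite gt_eqF.
  by rewrite normrM (gtr0_norm l0) ler_wpM2r ?(ltW l0)// ltW.
have [k1 h1] := near x.1.1 y.1.1 (fun h => nfar (Or31 _ _ h)).
have [k2 h2] := near x.1.2 y.1.2 (fun h => nfar (Or32 _ _ h)).
have [k3 h3] := near x.2 y.2 (fun h => nfar (Or33 _ _ h)).
move: dxy; rewrite ltNge => /negP; apply.
apply: (@le_trans _ _ (euclidean_norm (x - y + l *: lattice R (k1, k2, k3)))).
  apply: ge_inf; last by exists (k1, k2, k3).
  by exists 0 => _ [k _ <-]; exact: sqrtr_ge0.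
have el : 0 <= eps * l by rewrite mulr_ge0 ?ltW.
rewrite -[leRHS]ger0_norm// -sqrtr_sqr /euclidean_norm ler_wsqrtr//= /GRing.scale/=.
have sq (z : R) : `|z| <= eps / 2 * l -> z ^+ 2 <= (eps / 2 * l) ^+ 2.
  by move=> h; rewrite -(real_normK (num_real z)) ler_sqr ?nnegrE// (le_trans _ h).
have := sq _ h1; have := sq _ h2; have := sq _ h3.
have -> : (eps / 2 * l) ^+ 2 = (eps * l) ^+ 2 / 4 by field.
have := sqr_ge0 (eps * l).
by lra.
Qed.

(** One far factor of order t^(1/2) against two of order t^(-1/2) leaves t^(-1/2), the rate of
    [decay] at small times; for t >= 1 the kernel is bounded. *)
Lemma theta3_far (eps : R) : 0 < eps -> exists2 C : R, 0 < C &
  forall t l x y, 0 < t -> 0 < l -> eps * l < torus_dist l x y ->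
  theta3 (4 * pi ^+ 2 * t) (l^-1 *: x) (l^-1 *: y) <= C * (1 + decay t).
Proof.
move=> e0; have [M M0 HM] := heat_trace_large R; have [D D0 HD] := theta_time_small R.
set d : R := Num.min (eps / 2) 2^-1.
have d0 : 0 < d by rewrite lt_min divr_gt0//= invr_gt0.
have d2 : d <= 2^-1 by rewrite ge_min lexx orbT.
have [C C0 HC] := theta_far_uniform d0 d2.
have D2 : 0 < D ^+ 2 by rewrite exprn_gt0.
have CD : 0 < C * D ^+ 2 by rewrite mulr_gt0.
exists (1 + M + 4 * (C * D ^+ 2)); first by lra.
move=> t l x y t0 l0 far; have dt := decay_gt0 t0.
have [t1|/ltW t1] := leP t 1; last first.
  have := theta3_sub1_le (l^-1 *: x) (l^-1 *: y) (time_gt0 t0).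
  rewrite -/(theta_time t) -/(heat_trace t) ler_norml => /andP[_].
  have s1 : 1 <= Num.sqrt t ^+ 5 by rewrite exprn_ege1// -[leLHS]sqrtr1 ler_wsqrtr.
  have : M / Num.sqrt t ^+ 5 <= M by rewrite ler_pdivrMr ?ler_peMr ?(ltW M0)// (lt_le_trans _ s1).
  have := HM t t1; have := mulr_gt0 M0 dt; have := mulr_gt0 CD dt.
  by nra.
have [h _] := HD t t0 t1; have ds := decay_small t0 t1.
set s := Num.sqrt t in h ds; have s0 : 0 < s by rewrite sqrtr_gt0.
have a0 := time_gt0 t0.
have tn v : `|theta (4 * pi ^+ 2 * t) v| <= D / s by apply: le_trans h; exact: theta_norm_le.
have ub (p q r : R) : `|p| <= C * s -> `|q| <= D / s -> `|r| <= D / s ->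
    p * q * r <= (1 + M + 4 * (C * D ^+ 2)) * (1 + decay t).
  move=> hp hq hr; apply: (@le_trans _ _ (C * D ^+ 2 * s^-1)).
    have -> : C * D ^+ 2 * s^-1 = C * s * (D / s) * (D / s) by field; rewrite gt_eqF.
    apply: (le_trans (ler_norm _)); rewrite !normrM.
    by apply: ler_pM => //; apply: ler_pM.
  apply: (le_trans (ler_wpM2l (ltW CD) ds)).
  have := mulr_gt0 M0 dt; have := mulr_gt0 CD dt; nra.
rewrite /theta3 /=.
case: (torus_dist_far e0 l0 far) => hf; have f := HC t _ t0 t1 hf.
- exact: ub.
- by rewrite [X in X * _]mulrC; exact: ub.
- by rewrite [leLHS]mulrC [leLHS]mulrA; exact: ub.
Qed.
End kernel_bounds.

(** * Particle numbers of the loop soup *)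

Section poisson_generating_polynomial.
Variables (R : realType) (n : nat) (c : nat -> R).

(** The exponential of c_i z^(i+1), cut so as to remain a polynomial: at most [n] loops of each
    length fit into [n] particles. *)
Let E i : {poly R} := \sum_(k < n.+1) (c i ^+ k / k`!%:R)%:P * 'X^(i.+1 * k).
Let F m := \prod_(i < m) E i.
Let S m : {poly R} := \sum_(i < m) (i.+1%:R * c i)%:P * 'X^i.

(** The cut shows up only in degree i + (i+1) n, which is at least n, and therefore not in the
    coefficients below n. *)
Let derivE i : (E i)^`()%R = (i.+1%:R * c i)%:P * 'X^i * E i -
  (i.+1%:R * c i * (c i ^+ n / n`!%:R))%:P * 'X^(i + i.+1 * n).
Proof.
have cancel (x y q : R) : q != 0 -> x * q^-1 * (y * q) = y * x by move=> q0; field.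
rewrite /E raddf_sum big_ord_recl [in RHS]big_ord_recr /= mulrDr.
rewrite [X in _ = _ + X - _](_ : _ = (i.+1%:R * c i * (c i ^+ n / n`!%:R))%:P * 'X^(i + i.+1 * n)).
  rewrite addrK muln0 expr0 mulr1 derivC add0r mulr_sumr; apply: eq_bigr => k _.
  rewrite /bump /= add1n derivM derivC mul0r add0r derivXn.
  have -> : (i.+1 * k.+1).-1 = (i + i.+1 * k)%N by rewrite mulnS addSn.
  rewrite exprD -(mulr_natr _ (i.+1 * k.+1)) -polyC_natr factS exprS.
  have -> : c i * c i ^+ k / (k.+1 * k`!)%:R =
      (c i * (c i ^+ k / k`!%:R)) * k.+1%:R^-1 by rewrite natrM invfM; ring.
  rewrite natrM [X in _ = X * _]mulrC.
  transitivity ((c i * (c i ^+ k / k`!%:R) * k.+1%:R^-1 * (i.+1%:R * k.+1%:R))%:P * ('X^i * 'X^(i.+1 * k))).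
    by rewrite [in RHS]polyCM; ring.
  have -> : c i * (c i ^+ k / k`!%:R) * k.+1%:R^-1 * (i.+1%:R * k.+1%:R) =
     i.+1%:R * c i * (c i ^+ k / k`!%:R) by rewrite cancel ?pnatr_eq0// mulrA.
  by rewrite [in LHS]polyCM; ring.
by rewrite exprD [in RHS]polyCM; ring.
Qed.

Let derivF m : exists Q : {poly R}, (F m)^`()%R = S m * F m - 'X^n * Q.
Proof.
elim: m => [|m [Q IH]].
  by exists 0; rewrite /F /S !big_ord0 mul0r mulr0 subr0 derivC.
exists (Q * E m + (m.+1%:R * c m * (c m ^+ n / n`!%:R))%:P * 'X^(m + m * n) * F m).
have -> : F m.+1 = F m * E m by rewrite /F big_ord_recr.
have -> : S m.+1 = S m + (m.+1%:R * c m)%:P * 'X^m by rewrite /S big_ord_recr.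
rewrite derivM IH derivE.
have -> : (m + m.+1 * n = n + (m + m * n))%N by rewrite mulSn addnCA.
by rewrite exprD; ring.
Qed.

Let coef_rec k : (k < n)%N ->
  k.+1%:R * (F n)`_k.+1 = \sum_(j < k.+1) j.+1%:R * c j * (F n)`_(k - j).
Proof.
move=> kn; have [Q dF] := derivF n.
have := congr1 (fun p : {poly R} => p`_k) dF.
rewrite coef_deriv coefB coefXnM kn subr0 coefM => e; rewrite mulr_natl e.
apply: eq_bigr => j _; congr (_ * _).
have jn : (j < n)%N by apply: leq_ltn_trans kn; rewrite -ltnS.
rewrite /S coef_sum (bigD1 (Ordinal jn)) //= coefCM coefXn eqxx mulr1 big1 ?addr0// => i ij.
rewrite coefCM coefXn; case: eqP => [ji|_]; last by rewrite mulr0.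
by case/eqP: ij; apply: val_inj.
Qed.

Let coef0 : (F n)`_0 = 1.
Proof.
rewrite -horner_coef0 /F horner_prod big1// => i _.
rewrite /E horner_sum big_ord_recl big1 => [|k _].
  by rewrite muln0 expr0 mulr1 hornerC expr0 divr1 addr0.
by rewrite hornerM hornerXn /bump /= mulnS addSn expr0n mulr0.
Qed.

(** Expanding the product of the [E i] shows the sum over partitions to be its coefficient of degree
    [n], and the coefficients up to there satisfy the recursion that determines [W]. *)
Lemma poisson_partition_rec (W : nat -> R) : W 0%N = 1 ->
  (forall k, (k < n)%N -> k.+1%:R * W k.+1 = \sum_(j < k.+1) j.+1%:R * c j * W (k - j)%N) ->
  \sum_(k : {ffun 'I_n -> 'I_n.+1} | (\sum_(i < n) i.+1 * k i == n)%N)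
     \prod_(i < n) (c i ^+ k i / (k i)`!%:R) = W n.
Proof.
move=> W0 Wrec.
have FW k : (k <= n)%N -> (F n)`_k = W k.
  elim/ltn_ind: k => -[_ _|k IH kn]; first by rewrite coef0 W0.
  have k0 : k.+1%:R != 0 :> R by rewrite pnatr_eq0.
  apply: (mulfI k0); rewrite coef_rec// Wrec//; apply: eq_bigr => j _.
  by rewrite IH// ?ltnS ?leq_subr// (leq_trans (leq_subr _ _))// ltnW.
rewrite -FW// /F /E bigA_distr_bigA coef_sum big_mkcond /=; apply: eq_bigr => k _.
have -> : \prod_(i < n) ((c i ^+ k i / (k i)`!%:R)%:P * 'X^(i.+1 * k i)) =
    (\prod_(i < n) (c i ^+ k i / (k i)`!%:R))%:P * 'X^(\sum_(i < n) i.+1 * k i) :> {poly R}.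
  by rewrite big_split /= rmorph_prod expr_sum.
rewrite coefCM coefXn eq_sym.
by case: eqP => _; rewrite ?mulr1 ?mulr0.
Qed.
End poisson_generating_polynomial.

(** * The law of the particle number *)

Section loop_soup_law.
Variable R : realType.

Lemma measure_big_disjoint (d : measure_display) (T : measurableType d)
    (mu : {measure set T -> \bar R}) (J : choiceType) (s : seq J) (Q : pred J) (E : J -> set T) :
  uniq s -> (forall i, measurable (E i)) -> trivIset setT E ->
  mu (\big[setU/set0]_(i <- s | Q i) E i) = (\sum_(i <- s | Q i) mu (E i))%E.
Proof.
move=> + mE tE; elim: s => [_|x s IH /= /andP[xs us]]; first by rewrite !big_nil measure0.
rewrite !big_cons; case: ifP => _; last exact: IH.
have mU : measurable (\big[setU/set0]_(j <- s | Q j) E j) by exact: bigsetU_measurable.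
have dis : E x `&` \big[setU/set0]_(j <- s | Q j) E j = set0.
  rewrite -bigcup_seq_cond; apply/seteqP; split => // om [Ex [i /andP[si _] Ei]].
  have ix : i != x by apply: contraNneq xs => <-.
  by have /trivIsetP/(_ i x I I ix) := tE => e0; rewrite -[set0 om]/(set0 om) -e0.
by rewrite measureU//; congr (_ + _)%E; exact: IH.
Qed.

Variables (lam : nat -> R) (phi : nat -> R * R * R -> R) (beta : R) (L : {posnum R}).
Hypotheses (beta_gt0 : 0 < beta) (eigen : laplace_eigenbasis lam phi).

Let h := beta * L%:num ^- 2.

Lemma heat_kernel_unit x y (j : nat) : (0 < j)%N ->
  heat_kernel lam phi L%:num (beta * j%:R) x y =
  L%:num ^- 3 * theta3 (4 * pi ^+ 2 * (h * j%:R)) (L%:num^-1 *: x) (L%:num^-1 *: y).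
Proof.
move=> j0; have t0 : 0 < beta * j%:R by rewrite mulr_gt0// ltr0n.
rewrite (heat_kernel_theta x y eigen _ t0)//.
by rewrite -[4 * pi ^+ 2 * (beta * _) * _]mulrA (mulrAC beta).
Qed.

Variable bridge : R * R * R -> R * R * R -> R -> {measure set (path_space L) -> \bar R}.
Hypothesis bridgeP : forall x y t, cell L%:num x -> cell L%:num y -> 0 < t ->
  is_brownian_bridge (heat_kernel lam phi L%:num) x y t (bridge x y t).

Lemma bridge_mass x y t : cell L%:num x -> cell L%:num y -> 0 < t ->
  bridge x y t setT = (heat_kernel lam phi L%:num t x y)%:E.
Proof.
move=> cx cy t0; have [_ _ B] := bridgeP cx cy t0.
by have := B [::]; rewrite /= subr0 andbT => ->.
Qed.

(** Nonnegativity is inherited from the bridge measure, whose total mass is the kernel; the cosine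
    series does not display it. *)
Lemma heat_kernel_ge0 x y t : cell L%:num x -> cell L%:num y -> 0 < t ->
  0 <= heat_kernel lam phi L%:num t x y.
Proof. by move=> cx cy t0; rewrite -lee_fin -bridge_mass. Qed.

(** The bridge mass on the diagonal does not depend on the point, so the volume of the cell cancels
    the factor L^-3. *)
Lemma loop_intensity_length (N : nat) (Q : pred nat) :
  loop_intensity bridge beta N [set w : loop L | Q w.1] =
  (\sum_(j < N | Q j.+1) heat_trace (h * j.+1%:R) / j.+1%:R)%:E.
Proof.
have L0 : 0 < L%:num by [].
rewrite /loop_intensity big_add1 /= big_mkord -sumEFin [RHS]big_mkcond; apply: eq_bigr => j _.
have xs : xsection [set w : loop L | Q w.1] j.+1 = if Q j.+1 then setT else set0.
  rewrite xsectionE; apply/seteqP; split => w /=; first by move=> ->.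
  by case: ifP.
rewrite xs; case: ifP => Qj; last first.
  by under eq_integral do rewrite measure0; rewrite integral0 mule0.
rewrite (@eq_integral _ _ _ _ _ (cst (L%:num ^- 3 * heat_trace (h * j.+1%:R))%:E)); last first.
  move=> x; rewrite inE => cx; rewrite bridge_mass// ?mulr_gt0//.
  by rewrite heat_kernel_unit// theta3_diag.
rewrite integral_cst; last exact: measurable_cell.
rewrite (_ : _ (cell L%:num) = (L%:num ^+ 3)%:E); last exact: lebesgue3_cell (ltW L0).
rewrite -!EFinM mulrAC mulVf ?mul1r 1?mulrC// expf_neq0// gt_eqF//.
Qed.

(** Excluding loops longer than [n] leaves finitely many lengths, hence an event governed by the
    joint law of finitely many Poisson counts. *)
Lemma particle_numberE (n : nat) (s : seq (loop L)) :
  particle_number s = n <->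
  count (fun w => (n < w.1)%N) s = 0%N /\
  (\sum_(i < n) i.+1 * count (fun w => w.1 == i.+1) s = n)%N.
Proof.
have key : count (fun w => (n < w.1)%N) s = 0%N ->
    particle_number s = (\sum_(i < n) i.+1 * count (fun w => w.1 == i.+1) s)%N.
  rewrite /particle_number; elim: s => [_|w s IH /=].
    by rewrite big_nil big1// => i _; rewrite muln0.
  move/eqP; rewrite addn_eq0 eqb0 -leqNgt => /andP[wn /eqP c0].
  rewrite big_cons IH//; under [in RHS]eq_bigr do rewrite mulnDr.
  rewrite [in RHS]big_split /=; congr (_ + _)%N.
  case w0 : w.1 wn => [|k] kn; first by rewrite big1// => i _; rewrite muln0.
  rewrite (bigD1 (Ordinal kn))//= eqxx muln1 big1 ?addn0// => i ik.
  rewrite eqSS; case: eqP => [e|_]; last by rewrite muln0.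
  by case/eqP: ik; apply: val_inj.
split => [e|[c0 <-]]; last by rewrite -key.
suff c0 : count (fun w => (n < w.1)%N) s = 0%N by split => //; rewrite -key.
apply/eqP; rewrite -leqn0 leqNgt -has_count; apply/hasP => -[w ws nw].
suff : (w.1 <= n)%N by rewrite leqNgt nw.
rewrite -e /particle_number; elim: s ws {key e} => // v s IH.
rewrite inE big_cons => /orP[/eqP ->|/IH]; first exact: leq_addr.
by move=> /leq_trans; apply; exact: leq_addl.
Qed.

Variables (d : measure_display) (T : measurableType d) (P : probability T R).
Variables (xi : T -> seq (loop L)) (N : nat).
Hypothesis poisson : is_poisson_process P (loop_intensity bridge beta N) xi.

Let c j : R := heat_trace (h * j.+1%:R) / j.+1%:R.
Let hits (Q : pred nat) om := count (fun w : loop L => Q w.1) (xi om).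
(** Disjoint classes of lengths: one for each of 1, ..., n, and a last one for all lengths above n,
    to which [ext] assigns the count 0. *)
Let Qn n (i : 'I_n.+1) : pred nat := if (i < n)%N then fun m => m == i.+1 else fun m => (n < m)%N.
Let ext n (k : {ffun 'I_n -> 'I_n.+1}) (i : 'I_n.+1) : nat :=
  oapp (fun j : 'I_n => k j : nat) 0%N (insub (i : nat)).

Let measurable_length (Q : pred nat) : measurable [set w : loop L | Q w.1].
Proof.
rewrite (_ : [set w : loop L | Q w.1] = [set m : nat | Q m] `*` setT).
  exact: measurableX.
by apply/seteqP; split => w /=; [|case].
Qed.

Let hitsE (Q : pred nat) om :
  count (fun w => w \in [set w : loop L | Q w.1]) (xi om) = hits Q om.
Proof. by apply: eq_count => w; apply/idP/idP; rewrite inE. Qed.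

Let measurable_hits Q k : measurable [set om | hits Q om = k].
Proof.
rewrite (_ : [set om | _] = [set om | count (fun w => w \in [set w : loop L | Q w.1]) (xi om) = k]).
  by apply: (poisson.1); exact: measurable_length.
by apply/seteqP; split => om /=; rewrite hitsE.
Qed.

Let event n (k : {ffun 'I_n -> 'I_n.+1}) : set T :=
  [set om | forall i : 'I_n.+1, hits (Qn i) om = ext k i].

Let ext_lt n (k : {ffun 'I_n -> 'I_n.+1}) (i : 'I_n) : ext k (widen_ord (leqnSn n) i) = k i.
Proof. by rewrite /ext /= valK. Qed.

Let ext_max n (k : {ffun 'I_n -> 'I_n.+1}) : ext k ord_max = 0%N.
Proof. by rewrite /ext insubF//= ltnn. Qed.

Let measurable_event n (k : {ffun 'I_n -> 'I_n.+1}) : measurable (event k).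
Proof.
rewrite (_ : event k = \bigcap_(i in [set: 'I_n.+1]) [set om | hits (Qn i) om = ext k i]).
  by apply: fin_bigcap_measurable => // i _; exact: measurable_hits.
by apply/seteqP; split => om /= H i; [move=> _|]; apply: H.
Qed.

Let event_trivIset n : trivIset setT (@event n).
Proof.
apply/trivIsetP => k k' _ _ kk'; apply/seteqP; split => // om [H H'].
case/eqP: kk'; apply/ffunP => i; apply: val_inj => /=.
by rewrite -(ext_lt k) -(ext_lt k') -H -H'.
Qed.

(** The exponential factors of the classes, including that for the absence of loops longer than [n],
    multiply to a single factor over all lengths up to [N]. *)
Let event_prob n (k : {ffun 'I_n -> 'I_n.+1}) : (n <= N)%N ->
  P (event k) = (expR (- \sum_(j < N) c j) * \prod_(i < n) (c i ^+ k i / (k i)`!%:R))%:E.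
Proof.
move=> nN.
have := poisson.2 n.+1 (fun i => [set w : loop L | Qn i w.1]) (ext k).
rewrite (_ : [set om | _] = event k); last first.
  by apply/seteqP; split => om /= H i; have := H i; rewrite hitsE.
move=> -> //; last first.
  apply/trivIsetP => i j _ _ ij; apply/seteqP; split => // w /= [].
  rewrite /Qn; case: (ltnP i n) => iN; case: (ltnP j n) => jN /=.
  + move=> /eqP -> /eqP[e]; case/eqP: ij; exact: val_inj.
  + by move=> /eqP ->; rewrite ltnNge iN.
  + by move=> + /eqP e; rewrite e ltnNge jN.
  + have top (m : 'I_n.+1) : (n <= m)%N -> m = n :> nat.
      by move=> nm; apply/eqP; rewrite eqn_leq nm -ltnS ltn_ord.
    by move=> _ _; case/eqP: ij; apply: val_inj; rewrite /= (top _ iN) (top _ jN).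
congr (_%:E); under eq_bigr do rewrite loop_intensity_length /=.
rewrite big_ord_recr /= ext_max /poisson_weight expr0 mulr1 fact0 divr1.
have last_sum : \sum_(j < N | Qn (ord_max : 'I_n.+1) j.+1) c j = \sum_(j < N | ~~ (j < n)%N) c j.
  by apply: eq_bigl => j; rewrite /Qn /= ltnn ltnS -leqNgt.
rewrite last_sum.
have first_sum (i : 'I_n) : \sum_(j < N | Qn (widen_ord (leqnSn n) i) j.+1) c j = c i.
  have iN := leq_trans (ltn_ord i) nN.
  rewrite (big_pred1 (Ordinal iN))// => j; rewrite /Qn /= ltn_ord eqSS.
  by apply/eqP/eqP => [e|->//]; exact: val_inj.
under eq_bigr => i _ do rewrite first_sum ext_lt -mulrA.
rewrite big_split /= -expR_sum mulrAC -expRD; congr (expR _ * _).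
rewrite [in RHS](bigID (fun j : 'I_N => (j < n)%N)) /= opprD; congr (_ + _).
by rewrite sumrN (big_ord_widen N c nN).
Qed.

Lemma particle_prob_eq n : (n <= N)%N ->
  particle_prob P xi n = expR (- \sum_(j < N) c j) *
  \sum_(k : {ffun 'I_n -> 'I_n.+1} | (\sum_(i < n) i.+1 * k i == n)%N)
     \prod_(i < n) (c i ^+ k i / (k i)`!%:R).
Proof.
move=> nN; rewrite /particle_prob.
pose K := fun k : {ffun 'I_n -> 'I_n.+1} => (\sum_(i < n) i.+1 * k i == n)%N.
have -> : [set om | particle_number (xi om) = n] =
    \big[setU/set0]_(k <- index_enum {ffun 'I_n -> 'I_n.+1} | K k) event k.
  rewrite -bigcup_seq_cond; apply/seteqP; split => om /=.
    move=> /particle_numberE[c0 cn].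
    (* Counts above [n] cannot occur, so functions with values in ['I_n.+1] describe all cases. *)
    have cle (i : 'I_n) : (hits (fun m => m == i.+1) om <= n)%N.
      by rewrite -[leqRHS]cn (bigD1 i)//=; apply: leq_trans (leq_addr _ _); exact: leq_pmull.
    exists [ffun i : 'I_n => inord (hits (fun m => m == i.+1) om)].
      rewrite /= mem_index_enum /K; apply/eqP; rewrite -[RHS]cn; apply: eq_bigr => i _.
      by rewrite ffunE inordK// ltnS.
    move=> i; rewrite /ext /Qn; case: ltnP => ni.
      by rewrite insubT /= ffunE inordK// ltnS; exact: (cle (Ordinal ni)).
    by rewrite insubF//= ltnNge ni.
  case=> k /andP[_ /eqP Kk] ek; apply/particle_numberE; split.
    by have := ek ord_max; rewrite ext_max /Qn /= ltnn.
  rewrite -[RHS]Kk; apply: eq_bigr => i _; congr (_ * _)%N.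
  by have := ek (widen_ord (leqnSn n) i); rewrite ext_lt /Qn /= ltn_ord.
rewrite measure_big_disjoint ?index_enum_uniq//; last exact: event_trivIset.
rewrite (eq_bigr (fun k : {ffun 'I_n -> 'I_n.+1} =>
  (expR (- \sum_(j < N) c j) * \prod_(i < n) (c i ^+ k i / (k i)`!%:R))%:E)); last first.
  by move=> k _; exact: event_prob.
by rewrite sumEFin /= mulr_sumr.
Qed.
End loop_soup_law.

Section loop_soup_counts.
Variable R : realType.

(** [j.-1.+1] is [j] for positive [j] and 1 at [j = 0]: the time is always positive, so that
    nonnegativity holds for every [j], as the compound Poisson lemmas require. *)
Definition excess (h : R) (j : nat) : R := heat_trace (h * j.-1.+1%:R) - 1.

Lemma excess_ge0 h j : 0 < h -> 0 <= excess h j.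
Proof. by move=> h0; rewrite subr_ge0 heat_trace_ge1// mulr_gt0. Qed.

(** Writing the heat trace as 1 plus [excess] splits the normalization into a harmonic sum and
    [cp_exponent]; [cp_partial_sum_rec] is the recursion that [poisson_partition_rec] asks for. *)
Lemma particle_prob_cp (lam : nat -> R) (phi : nat -> R * R * R -> R) (beta : R)
    (L : {posnum R}) (N : nat) (d : measure_display) (T : measurableType d)
    (P : probability T R) (xi : T -> seq (loop L)) n :
  0 < beta -> laplace_eigenbasis lam phi -> is_loop_soup lam phi beta N P xi -> (n <= N)%N ->
  particle_prob P xi n =
  expR (- (\sum_(j < N) j.+1%:R^-1 + cp_exponent N (excess (beta * L%:num ^- 2)))) *
  \sum_(i < n.+1) cp_coef N (excess (beta * L%:num ^- 2)) i.
Proof.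
move=> b0 B [bridge [bridgeP poisson]] nN; set h := beta * _.
have h0 : 0 < h by rewrite mulr_gt0// invr_gt0 exprn_gt0.
rewrite (particle_prob_eq b0 B bridgeP poisson nN) -/h; congr (expR (- _) * _).
  rewrite /cp_exponent -big_split /=; apply: eq_bigr => j _.
  by rewrite /excess /= mulrBl mul1r addrC subrK.
apply: (@poisson_partition_rec R n (fun m => heat_trace (h * m.+1%:R) / m.+1%:R)
  (fun m => \sum_(i < m.+1) cp_coef N (excess h) i)).
  by rewrite big_ord1 cp_coef0.
move=> k kn; rewrite (@cp_partial_sum_rec R N)//; last exact: leq_trans nN.
  apply: eq_bigr => j _; congr (_ * _); rewrite /excess /= subrK.
  by rewrite [RHS]mulrC divfK// pnatr_eq0.
Qed.

Lemma heat_kernel_soup_ge0 (lam : nat -> R) (phi : nat -> R * R * R -> R) (beta : R)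
    (L : {posnum R}) (N : nat) (d : measure_display) (T : measurableType d)
    (P : probability T R) (xi : T -> seq (loop L)) x y t :
  is_loop_soup lam phi beta N P xi -> cell L%:num x -> cell L%:num y -> 0 < t ->
  0 <= heat_kernel lam phi L%:num t x y.
Proof. by move=> [bridge [bridgeP _]]; exact: (heat_kernel_ge0 bridgeP). Qed.
End loop_soup_counts.

(** * Estimates at the critical density *)

Section critical_asymptotics.
Variables (R : realType) (beta : R).
Hypothesis beta_gt0 : 0 < beta.

Let rho := critical_density beta.
Let q := Num.sqrt (4 * pi * beta).

Let q_gt0 : 0 < q.
Proof. by rewrite sqrtr_gt0 mulr_gt0// mulr_gt0// pi_gt0. Qed.

Lemma zeta_ge1 : 1 <= zeta (3 / 2) :> R.
Proof.
have /andP[+ _] := @zeta_bounds R 1 isT.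
by rewrite big_ord1 sqrtr1 invr1 expr1n subr_ge0.
Qed.

Let rhoE : rho = q^-1 ^+ 3 * zeta (3 / 2).
Proof.
by rewrite /rho /critical_density powR_neg32// mulr_gt0// mulr_gt0// pi_gt0.
Qed.

Lemma critical_density_gt0 : 0 < critical_density beta.
Proof.
rewrite -/rho rhoE mulr_gt0 ?zeta_gt0//; apply: exprn_gt0.
by rewrite invr_gt0.
Qed.

Lemma harmonic_exp_ge (N : nat) : N.+1%:R <= expR (\sum_(j < N) j.+1%:R^-1) :> R.
Proof.
elim: N => [|N IH]; first by rewrite big_ord0 expR0.
rewrite big_ord_recr /= expRD.
have e : 1 + N.+1%:R^-1 <= expR N.+1%:R^-1 :> R by exact: expR_ge1Dx.
have -> : N.+2%:R = N.+1%:R * (1 + N.+1%:R^-1) :> R.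
  by rewrite mulrDr mulr1 mulfV ?pnatr_eq0// natr1.
by apply: ler_pM => //; rewrite addr_ge0.
Qed.

Lemma harmonic_exp_le (N : nat) : (0 < N)%N ->
  expR (\sum_(j < N) j.+1%:R^-1) <= expR 1 * N%:R :> R.
Proof.
case: N => // N _; elim: N => [|N IH]; first by rewrite big_ord1 invr1 mulr1.
rewrite big_ord_recr /= expRD.
have e : expR N.+2%:R^-1 <= N.+2%:R / N.+1%:R :> R.
  rewrite -[leLHS]invrK -expRN -[leRHS]invrK invf_div.
  have e1 : N.+1%:R / N.+2%:R <= expR (- N.+2%:R^-1) :> R.
    have -> : N.+1%:R / N.+2%:R = 1 - N.+2%:R^-1 :> R.
      by rewrite -[X in X / _](addrK 1 N.+1%:R) natr1 mulrBl mulfV ?pnatr_eq0// mul1r.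
    exact: expR_ge1Dx.
  by rewrite lef_pV2 ?posrE ?expR_gt0// divr_gt0.
apply: (le_trans (ler_pM (expR_ge0 _) (expR_ge0 _) IH e)).
by rewrite -mulrA ler_pM2l ?expR_gt0// mulrC divfK.
Qed.

Lemma block_sum (f : nat -> R) (m N : nat) (B : R) : (2 * m <= N)%N ->
  (forall j, 0 <= f j) -> (forall j, (m <= j < 2 * m)%N -> B <= f j) ->
  m%:R * B <= \sum_(j < N) f j.
Proof.
move=> mN f0 fB; have m2 : (m <= 2 * m)%N by rewrite mul2n -addnn leq_addr.
rewrite -(big_mkord xpredT f) (@big_cat_nat _ _ _ (2 * m))//=.
rewrite (@big_cat_nat _ _ _ m)//= -[leLHS]add0r -[leLHS]addr0.
apply: lerD; last exact: sumr_ge0.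
apply: lerD; first exact: sumr_ge0.
have -> : m%:R * B = \sum_(m <= j < 2 * m) B.
  by rewrite sumr_const_nat mul2n -addnn addnK mulr_natl.
by rewrite [leLHS]big_nat_cond [leRHS]big_nat_cond; apply: ler_sum => j /andP[/fB].
Qed.

Lemma nat_ceil (x : R) : 0 <= x -> exists m : nat, x <= m%:R <= x + 1.
Proof.
move=> x0; exists (Num.truncn x).+1.
have /andP[h1 h2] := truncn_itv x0.
by rewrite (ltW h2)/= -natr1 lerD2r.
Qed.

Lemma sqrt_time_scale (L : R) (j : nat) : 0 < L ->
  four_pi_sqrt (beta * L ^- 2 * j.+1%:R) = L * q^-1 * (Num.sqrt j.+1%:R)^-1.
Proof.
move=> L0; rewrite /four_pi_sqrt.
have -> : 4 * pi * (beta * L ^- 2 * j.+1%:R) = (4 * pi * beta) * (L^-1 ^+ 2 * j.+1%:R).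
  by rewrite exprVn; ring.
have p0 : 0 <= 4 * pi * beta by rewrite ltW// mulr_gt0// mulr_gt0// pi_gt0.
rewrite sqrtrM// (@sqrtrM R (L^-1 ^+ 2) _ (sqr_ge0 _)) sqrtr_sqr ger0_norm ?invr_ge0 ?ltW// -/q.
by rewrite !invfM invrK; ring.
Qed.

(** At criticality [N] equals L^3 q^-3 zeta(3/2), and the leading parts of the heat traces add up to
    the same expression with the zeta series cut after [N] terms. The missing tail contributes
    O(sqrt N), that is O(L^(3/2)); [decay_sum] bounds the rest. *)
Lemma mean_var_bound : exists2 C : R, 0 < C & forall (L : R) (N : nat), 1 <= L ->
  rho * L ^+ 3 = N%:R ->
  `|N%:R - cp_mean N (excess (beta * L ^- 2))| <= C * L ^+ 2 /\
  cp_var N (excess (beta * L ^- 2)) <= C * (L ^+ 2) ^+ 2.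
Proof.
have [C C0 HC] := heat_trace_estimate R.
have b20 : 0 < beta ^+ 2 by exact: exprn_gt0.
exists (2 * C / beta + 2 * Num.sqrt rho + 2 * C / beta ^+ 2).
  have := divr_gt0 (mulr_gt0 (ltr0Sn _ 1) C0) beta_gt0.
  have := divr_gt0 (mulr_gt0 (ltr0Sn _ 1) C0) b20.
  by have := sqrtr_ge0 rho; lra.
move=> L N L1 LN; have L0 : 0 < L by apply: lt_le_trans L1.
have L20 : 0 < L ^+ 2 by exact: exprn_gt0.
set h := beta * L ^- 2; have h0 : 0 < h by rewrite mulr_gt0// invr_gt0.
have t0 (j : nat) : 0 < h * j.+1%:R by rewrite mulr_gt0.
have rho0 : 0 < rho by exact: critical_density_gt0.
have hC : C * (2 / h) = 2 * C / beta * L ^+ 2.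
  by rewrite /h; field; rewrite !gt_eqF.
have c1 : 0 < 2 * C / beta by rewrite divr_gt0// mulr_gt0.
have c2 : 0 < 2 * C / beta ^+ 2 by rewrite divr_gt0// mulr_gt0.
have c3 : 0 <= 2 * Num.sqrt rho by rewrite mulr_ge0// sqrtr_ge0.
split; last first.
  have -> : cp_var N (excess h) = h^-1 * \sum_(j < N) (h * j.+1%:R) * (heat_trace (h * j.+1%:R) - 1).
    rewrite /cp_var mulr_sumr; apply: eq_bigr => j _.
    by rewrite /excess /= -[in RHS](mulrA h) mulKf// gt_eqF.
  have s1 : \sum_(j < N) (h * j.+1%:R) * (heat_trace (h * j.+1%:R) - 1) <= C * (2 / h).
    apply: (@le_trans _ _ (\sum_(j < N) C * decay (h * j.+1%:R))).
      by apply: ler_sum => j _; have [] := HC _ (t0 j).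
    by rewrite -mulr_sumr ler_pM2l// decay_sum.
  have ih : 0 < h^-1 by rewrite invr_gt0.
  apply: (le_trans (ler_wpM2l (ltW ih) s1)).
  have -> : h^-1 * (C * (2 / h)) = 2 * C / beta ^+ 2 * (L ^+ 2) ^+ 2.
    by rewrite /h; field; rewrite !gt_eqF.
  rewrite ler_wpM2r ?sqr_ge0//; lra.
pose Y := \sum_(j < N) four_pi_sqrt (h * j.+1%:R) ^+ 3.
have dY : `|Y - cp_mean N (excess h)| <= 2 * C / beta * L ^+ 2.
  rewrite /Y /cp_mean -sumrB; apply: (le_trans (ler_norm_sum _ _ _)).
  apply: (@le_trans _ _ (\sum_(j < N) C * decay (h * j.+1%:R))).
    by apply: ler_sum => j _; rewrite distrC; have [] := HC _ (t0 j).
  by rewrite -hC -mulr_sumr ler_pM2l// decay_sum.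
have N0 : (0 < N)%N.
  by rewrite -(ltr0n R) -LN mulr_gt0//; exact: exprn_gt0.
have /andP[z1 z2] := @zeta_bounds R N N0.
pose S := \sum_(k < N) (Num.sqrt (k.+1%:R : R))^-1 ^+ 3.
have YE : Y = L ^+ 3 * q^-1 ^+ 3 * S.
  rewrite /Y /S mulr_sumr; apply: eq_bigr => j _.
  by rewrite sqrt_time_scale// !exprMn.
have NE : N%:R = L ^+ 3 * q^-1 ^+ 3 * zeta (3 / 2).
  by rewrite -LN rhoE; ring.
have K0 : 0 <= L ^+ 3 * q^-1 ^+ 3.
  by apply: mulr_ge0; apply: exprn_ge0; rewrite ?invr_ge0 ltW.
have KN : L ^+ 3 * q^-1 ^+ 3 <= N%:R by rewrite NE ler_peMr// zeta_ge1.
have sN : Num.sqrt N%:R <= Num.sqrt rho * L ^+ 2.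
  have L2 : 0 <= L ^+ 2 by exact: ltW.
  rewrite -[in leRHS](ger0_norm L2) -sqrtr_sqr -sqrtrM ?(ltW rho0)// ler_wsqrtr//.
  by rewrite -LN ler_pM2l// -exprM ler_weXn2l.
have sN0 : 0 < Num.sqrt (N%:R : R) by rewrite sqrtr_gt0 ltr0n.
have NY : 0 <= N%:R - Y <= 2 * Num.sqrt rho * L ^+ 2.
  rewrite NE YE -mulrBr; apply/andP; split; first by rewrite mulr_ge0.
  apply: (@le_trans _ _ (N%:R * (2 / Num.sqrt N%:R))).
    by apply: ler_pM.
  have -> : N%:R * (2 / Num.sqrt N%:R) = 2 * Num.sqrt N%:R :> R.
    rewrite -[X in X * _ = _](@sqr_sqrtr R N%:R)//.
    by field; rewrite gt_eqF.
  by rewrite -mulrA ler_pM2l.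
have := mulr_gt0 c2 L20; have /andP[n1 n2] := NY.
rewrite !mulrDl; move: dY; rewrite !ler_norml => /andP[d1 d2] c2L.
by apply/andP; split; lra.
Qed.

(** For small t the leading term, of order t^(-3/2), is at least twice the error, of order
    t^(-1/2). *)
Lemma heat_trace_lower : exists2 c : R, 0 < c & exists2 tau : R, 0 < tau &
  forall t, 0 < t -> t <= tau -> c / Num.sqrt t ^+ 3 <= heat_trace t - 1.
Proof.
have [C C0 HC] := heat_trace_estimate R.
pose g : R := (Num.sqrt (4 * pi))^-1.
have p4 : 0 < 4 * pi :> R by rewrite mulr_gt0// pi_gt0.
have g0 : 0 < g by rewrite invr_gt0 sqrtr_gt0.
have g3 : 0 < g ^+ 3 by exact: exprn_gt0.
exists (g ^+ 3 / 2); first by rewrite divr_gt0.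
exists (g ^+ 3 / (2 * C)) => [|t t0 tt]; first by rewrite divr_gt0// mulr_gt0.
have [h1 _] := HC t t0.
set s := Num.sqrt t; have s0 : 0 < s by rewrite sqrtr_gt0.
have st : s ^+ 2 = t by rewrite sqr_sqrtr// ltW.
have y : four_pi_sqrt t = g / s by rewrite /four_pi_sqrt sqrtrM ?ltW// invfM.
have dec : decay t <= s^-1.
  have u2 : 0 < (1 + s) ^+ 2 by apply: exprn_gt0; exact: addr_gt0.
  have u3 : 0 < s * (1 + s) ^+ 2 by exact: mulr_gt0.
  rewrite /decay -/s lef_pV2 ?posrE//.
  by rewrite ler_peMr ?(ltW s0)//; apply: exprn_ege1; lra.
have CT : C * s^-1 <= g ^+ 3 / 2 / s ^+ 3.
  have -> : g ^+ 3 / 2 / s ^+ 3 = g ^+ 3 / 2 / s ^+ 2 * s^-1 by field; rewrite gt_eqF.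
  rewrite ler_pM2r ?invr_gt0// st ler_pdivlMr//.
  by move: tt; rewrite ler_pdivlMr ?mulr_gt0//; lra.
have Cd : C * decay t <= C * s^-1 by rewrite ler_pM2l.
have E : four_pi_sqrt t ^+ 3 = g ^+ 3 / 2 / s ^+ 3 + g ^+ 3 / 2 / s ^+ 3.
  by rewrite y; field; rewrite gt_eqF.
by move: h1; rewrite E ler_norml => /andP[h1 _]; lra.
Qed.

(** Only a block of indices from m to 2 m, with m close to L^2 / sg, is kept. There the tilt takes
    away at least half of each term, and the terms are at least of order sg^(3/2), so the drop is at
    least of order sqrt(sg) L^2. *)
Lemma mean_drop (M : R) : 0 < M -> exists2 sg : R, 0 < sg & exists L0 : R,
  forall (L : R) (N : nat), 1 <= L -> L0 <= L -> rho * L ^+ 3 = N%:R ->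
  cp_mean N (fun j => excess (beta * L ^- 2) j * expR (- (sg / L ^+ 2)) ^+ j) + M * L ^+ 2 <=
  cp_mean N (excess (beta * L ^- 2)).
Proof.
move=> M0.
have large (r s L : R) : 0 < r -> 0 < s -> 0 < L -> 4 / (s * r) <= L ->
    4 * (L ^+ 2 / s) <= r * L ^+ 3.
  move=> r0 s0 L0; rewrite ler_pdivrMr ?mulr_gt0// mulrA ler_pdivrMr// => k.
  by have := ler_wpM2r (sqr_ge0 L) k; lra.
have [c c0 [tau tau0 low]] := heat_trace_lower.
have rho0 : 0 < rho by exact: critical_density_gt0.
(* The kept indices have rescaled times at most u^-2. The middle summand makes these at most [tau];
   the last makes the drop c u / (8 beta) L^2 at least M L^2. *)
pose u := 1 + tau^-1 + 8 * beta * M / c.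
have itau : 0 < tau^-1 by rewrite invr_gt0.
have bMc : 0 < 8 * beta * M / c by rewrite divr_gt0// !mulr_gt0.
have u1 : 1 <= u by rewrite /u; lra.
have u0 : 0 < u by apply: lt_le_trans u1.
have ut : u^-1 <= tau.
  by rewrite -[leRHS]invrK lef_pV2 ?posrE//; rewrite /u; lra.
have uM : M <= c * u / (8 * beta).
  rewrite ler_pdivlMr ?mulr_gt0//.
  have : 8 * beta * M / c <= u by rewrite /u; lra.
  by rewrite ler_pdivrMr//; lra.
have u20 : 0 < u ^+ 2 by exact: exprn_gt0.
have [sg sgE sg0] : exists2 sg : R, sg = 4 * beta * u ^+ 2 & 0 < sg.
  by exists (4 * beta * u ^+ 2) => //; rewrite mulr_gt0// mulr_gt0.
(* The part [1 + sg] yields sg <= L^2, hence L^2 / sg >= 1; the last summand yields 2 m <= N. *)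
exists sg => //; exists (1 + sg + 4 / (sg * rho)) => L N L1 LL LN.
have L0 : 0 < L by apply: lt_le_trans L1.
have L20 : 0 < L ^+ 2 by exact: exprn_gt0.
have q0 : 0 < 4 / (sg * rho) by rewrite divr_gt0// mulr_gt0.
have Lsg : sg <= L ^+ 2 by rewrite expr2; nra.
set h := beta * L ^- 2; have h0 : 0 < h by rewrite mulr_gt0// invr_gt0.
have t0 (j : nat) : 0 < h * j.+1%:R by rewrite mulr_gt0.
set x := L ^+ 2 / sg.
have x1 : 1 <= x by rewrite ler_pdivlMr// mul1r.
have [m /andP[mx1 mx2]] : exists m : nat, x <= m%:R <= x + 1 by apply: nat_ceil; lra.
have mN : (2 * m <= N)%N.
  rewrite -(ler_nat R) -LN natrM.
  apply: (@le_trans _ _ (4 * x)); first lra.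
  by apply: large => //; lra.
set s := sg / L ^+ 2; have s0 : 0 < s by rewrite divr_gt0.
have sx : s * x = 1 by rewrite /s /x; field; rewrite !gt_eqF.
have sm : 1 <= s * m%:R by apply: (@le_trans _ _ (s * x)); [rewrite sx|rewrite ler_pM2l].
have em : expR (-1) <= 1 / 2 :> R.
  rewrite expRN mul1r lef_pV2 ?posrE ?expR_gt0//.
  by have := expR_ge1Dx (1 : R); lra.
have zj j : expR (- s) ^+ j = expR (- (s * j%:R)).
  by rewrite -expRM_natl; congr expR; ring.
rewrite -lerBrDl /cp_mean -sumrB.
apply: (@le_trans _ _ (m%:R * (c * u ^+ 3 / 2))).
  apply: (@le_trans _ _ (x * (c * u ^+ 3 / 2))).
    have -> : x * (c * u ^+ 3 / 2) = c * u / (8 * beta) * L ^+ 2.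
      by rewrite /x sgE; field; rewrite !gt_eqF.
    by rewrite ler_pM2r.
  by rewrite ler_wpM2r// divr_ge0// mulr_ge0 ?(ltW c0)// exprn_ge0// ltW.
apply: (@block_sum (fun j => excess h j.+1 - excess h j.+1 * expR (- s) ^+ j.+1)) => // j.
  have a0 := excess_ge0 j.+1 h0.
  rewrite zj subr_ge0 ler_piMr// -expR0 ler_expR oppr_le0 mulr_ge0 ?(ltW s0)//.
move=> /andP[jm1 jm2].
have ej : expR (- s) ^+ j.+1 <= 1 / 2.
  apply: le_trans em; rewrite zj ler_expR lerN2; apply: (le_trans sm).
  by rewrite ler_pM2l// ler_nat ltnW.
have tj : h * j.+1%:R <= u^-1 ^+ 2.
  apply: (@le_trans _ _ (h * (4 * x))).
    rewrite ler_pM2l//; apply: (@le_trans _ _ (2 * m)%N%:R); first by rewrite ler_nat.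
    by rewrite natrM; lra.
  rewrite /h /x sgE le_eqVlt; apply/orP; left; apply/eqP.
  by field; rewrite !gt_eqF.
have iu0 : 0 < u^-1 by rewrite invr_gt0.
have iu1 : u^-1 <= 1 by rewrite invf_le1.
have tt : h * j.+1%:R <= tau.
  by apply: (le_trans tj); apply: le_trans ut; rewrite expr2 ler_piMl// ltW.
have st : Num.sqrt (h * j.+1%:R) <= u^-1.
  by rewrite -[leRHS]ger0_norm ?(ltW iu0)// -sqrtr_sqr ler_wsqrtr.
have := low _ (t0 j) tt; rewrite -[heat_trace _ - 1]/(excess h j.+1).
move: (excess h j.+1) (excess_ge0 j.+1 h0) => a a0 la.
have s1 : 0 < Num.sqrt (h * j.+1%:R) by rewrite sqrtr_gt0.
have cu : c * u ^+ 3 <= a.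
  apply: le_trans la; rewrite ler_pM2l// -[leLHS]invrK -exprVn lef_pV2 ?posrE ?exprn_gt0//.
  by rewrite lerXn2r ?nnegrE ?(ltW s1) ?(ltW iu0).
have : a * expR (- s) ^+ j.+1 <= a * (1 / 2) by rewrite ler_wpM2l.
by lra.
Qed.
End critical_asymptotics.

(** * Partial sums of the compound Poisson coefficients *)

Section partial_sums.
Variables (R : realType) (beta : R).
Hypothesis beta_gt0 : 0 < beta.

Let rho := critical_density beta.
Let W (L : R) (N n : nat) : R := \sum_(i < n.+1) cp_coef N (excess (beta * L ^- 2)) i.
Let A (L : R) (N : nat) : R := cp_exponent N (excess (beta * L ^- 2)).

Let h_gt0 (L : R) : 1 <= L -> 0 < beta * L ^- 2.
Proof.
by move=> L1; rewrite mulr_gt0// invr_gt0; apply: exprn_gt0; apply: lt_le_trans L1.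
Qed.

Lemma partial_sum_ge1 (L : R) N n : 1 <= L -> 1 <= W L N n.
Proof.
move=> L1; rewrite /W big_ord_recl cp_coef0 lerDl sumr_ge0// => i _.
by apply: cp_coef_ge0 => j; apply: excess_ge0; exact: h_gt0.
Qed.

Lemma partial_sum_le (L : R) N n : 1 <= L -> W L N n <= expR (A L N).
Proof. by move=> L1; apply: cp_mass_le => j; apply: excess_ge0; exact: h_gt0. Qed.

Lemma partial_sum_nd (L : R) N m n : 1 <= L -> (m <= n)%N -> W L N m <= W L N n.
Proof.
move=> L1 mn.
have W_nd : {homo W L N : k l / (k <= l)%N >-> k <= l}.
  apply: homo_leq => [k|k l p|k]; [exact: lexx|exact: le_trans|].
  rewrite /W [leRHS]big_ord_recr lerDl.
  by apply: cp_coef_ge0 => j; apply: excess_ge0; exact: h_gt0.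
exact: W_nd.
Qed.

(** Dividing the terms by j only decreases them, so the exponent is at most the mean, which stays
    bounded for bounded [L]. *)
Lemma exponent_bound (L0 : R) : 1 <= L0 -> exists2 B : R, 0 < B &
  forall (L : R) (N : nat), 1 <= L -> L <= L0 -> rho * L ^+ 3 = N%:R ->
  expR (A L N) <= B.
Proof.
move=> L01; have [C C0 HC] := mean_var_bound beta_gt0.
have rho0 : 0 < rho by exact: critical_density_gt0.
exists (expR (rho * L0 ^+ 3 + C * L0 ^+ 2)); first exact: expR_gt0.
move=> L N L1 LL LN; rewrite ler_expR.
have L2 : L ^+ 2 <= L0 ^+ 2 by rewrite lerXn2r ?nnegrE//; lra.
have L3 : L ^+ 3 <= L0 ^+ 3 by rewrite lerXn2r ?nnegrE//; lra.
have [+ _] := HC L N L1 LN; rewrite ler_norml => /andP[m1 _].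
have a1 : A L N <= cp_mean N (excess (beta * L ^- 2)).
  apply: ler_sum => j _; rewrite ler_piMr ?excess_ge0 ?h_gt0//.
  by rewrite invf_le1// ler1n.
have := ler_wpM2l (ltW C0) L2; have := ler_wpM2l (ltW rho0) L3.
by rewrite LN; lra.
Qed.

(** For large [L] this is [cp_lower]; for bounded [L] the sum is at least 1 while the exponent is
    bounded. *)
Lemma partial_sum_lower (kappa : R) : 0 < kappa -> exists2 c : R, 0 < c &
  forall (L : R) (N n : nat), 1 <= L -> rho * L ^+ 3 = N%:R ->
  N%:R - kappa * L ^+ 2 <= n%:R -> c * expR (A L N) <= W L N n.
Proof.
move=> k0; have [C C0 HC] := mean_var_bound beta_gt0.
(* [H0 * L ^+ 2] is at least twice the standard deviation, as 4 C <= H0^2. *)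
pose H0 := 1 + 4 * C.
have H00 : 0 < H0 by rewrite /H0; lra.
(* The drop has to cover the offset of the mean from [N], the half-width of the window and the
   distance from [N] down to [n]. *)
have M0 : 0 < C + H0 + kappa by lra.
have [sg sg0 [L0 drop]] := mean_drop beta_gt0 M0.
have L01 : 1 <= Num.max 1 L0 by rewrite le_max lexx.
have [B B0 HB] := exponent_bound L01.
pose c := 3 / 4 * expR (- (sg * (sg * C + H0))).
have c0 : 0 < c by rewrite mulr_gt0 ?expR_gt0// divr_gt0.
exists (Num.min c B^-1) => [|L N n L1 LN Nn]; first by rewrite lt_min c0 invr_gt0.
have eA : 0 <= expR (A L N) by exact: expR_ge0.
have [LL|LL] := leP L0 L; last first.
  have LB : expR (A L N) <= B by apply: HB => //; rewrite le_max (ltW LL) orbT.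
  apply: le_trans (partial_sum_ge1 N n L1).
  apply: (@le_trans _ _ (B^-1 * expR (A L N))).
    by rewrite ler_wpM2r// ge_min lexx orbT.
  by rewrite mulrC ler_pdivrMr// mul1r.
apply: (@le_trans _ _ (c * expR (A L N))); first by rewrite ler_wpM2r// ge_min lexx.
have a_ge0 j : 0 <= excess (beta * L ^- 2) j by apply: excess_ge0; exact: h_gt0.
have L20 : 0 < L ^+ 2 by apply: exprn_gt0; apply: lt_le_trans L1.
have := drop L N L1 LL LN; have [] := HC L N L1 LN.
have low := @cp_lower R N (excess (beta * L ^- 2)) a_ge0 (sg / L ^+ 2) (H0 * L ^+ 2) n.
move: low; rewrite -/(A L N) -/(W L N n).
set V := cp_var _ _; set mu := cp_mean N (excess _); set mus := cp_mean N _.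
move: (expR (A L N)) eA (W L N n) => e e0 w low.
rewrite ler_norml => /andP[m1 m2] VC drp.
have V1 : 4 * V <= (H0 * L ^+ 2) ^+ 2.
  rewrite exprMn.
  apply: (@le_trans _ _ (4 * C * (L ^+ 2) ^+ 2)); first by rewrite -mulrA ler_pM2l.
  by apply: ler_wpM2r; [exact: sqr_ge0|rewrite /H0; nra].
have s0 : 0 < sg / L ^+ 2 by rewrite divr_gt0.
have n1 : mus + H0 * L ^+ 2 < n.+1%:R.
  by rewrite -natr1; move: drp Nn; rewrite !mulrDl; lra.
have {low}low := low (ltW s0) (mulr_gt0 H00 L20) V1 n1.
apply: le_trans low; apply: ler_wpM2r => //; rewrite /c ler_pM2l ?divr_gt0// ler_expR lerN2.
have -> : sg / L ^+ 2 * (sg / L ^+ 2 * V + H0 * L ^+ 2) = sg * (sg * (V / (L ^+ 2) ^+ 2) + H0).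
  by field; rewrite gt_eqF//; apply: lt_le_trans L1.
by rewrite ler_pM2l// lerD2r ler_pM2l// ler_pdivrMr// exprn_gt0.
Qed.

Lemma partial_sum_total : exists2 C : R, 0 < C & forall (L : R) (N : nat), 1 <= L ->
  rho * L ^+ 3 = N%:R -> \sum_(n < N) W L N n <= C * L ^+ 2 * expR (A L N).
Proof.
have [C C0 HC] := mean_var_bound beta_gt0.
exists ((1 + 2 * (C ^+ 2 + C)) / 2) => [|L N L1 LN].
  by rewrite divr_gt0//; have := sqr_ge0 C; lra.
have a_ge0 j : 0 <= excess (beta * L ^- 2) j by apply: excess_ge0; exact: h_gt0.
have L20 : 0 < L ^+ 2 by apply: exprn_gt0; apply: lt_le_trans L1.
have [] := HC L N L1 LN.
have := @cp_double_sum R N (excess (beta * L ^- 2)) a_ge0 N (L ^+ 2) L20.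
rewrite -/(A L N); set V := cp_var _ _; set mu := cp_mean _ _.
move=> tot m1 VC; apply: (le_trans tot); apply: ler_wpM2r; first exact: expR_ge0.
move: (L ^+ 2) L20 m1 VC => l l0 m1 VC.
have m2 : (N%:R - mu) ^+ 2 <= C ^+ 2 * l ^+ 2.
  rewrite -exprMn -(real_normK (num_real (N%:R - mu))) ler_sqr ?nnegrE//.
  exact: le_trans m1.
rewrite [leRHS]mulrAC ler_pM2r ?invr_gt0// [leRHS]mulrDl mul1r lerD2l ler_pdivrMr//.
by rewrite -[leRHS]mulrA -expr2; lra.
Qed.
End partial_sums.

(** * Probability and density matrix of the critical loop soup *)

Section critical_loop_soup.
Variables (R : realType) (beta : R) (lam : nat -> R) (phi : nat -> R * R * R -> R).
Hypotheses (beta_gt0 : 0 < beta) (eigen : laplace_eigenbasis lam phi).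

Let rho := critical_density beta.
Let W (L : R) (N n : nat) : R := \sum_(i < n.+1) cp_coef N (excess (beta * L ^- 2)) i.
Let A (L : R) (N : nat) : R := cp_exponent N (excess (beta * L ^- 2)).

Lemma critical_number_gt0 (L : R) (N : nat) : 1 <= L -> rho * L ^+ 3 = N%:R -> (0 < N)%N.
Proof.
move=> L1 LN; rewrite -(ltr0n R) -LN mulr_gt0 ?critical_density_gt0//.
by apply: exprn_gt0; apply: lt_le_trans L1.
Qed.

(** The probability is exp(- H_N) times W_N / exp A, with H_N the harmonic sum: the first factor
    lies between 1 / (e N) and 1 / N, the second between [c] and 1. *)
Lemma critical_prob_bounds : exists C : R, 0 < C /\
  forall (L : {posnum R}) (N : nat) (d : measure_display)
    (T : measurableType d) (P : probability T R) (xi : T -> seq (loop L)),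
    1 <= L%:num -> rho * L%:num ^+ 3 = N%:R -> is_loop_soup lam phi beta N P xi ->
    C^-1 * L%:num ^- 3 <= particle_prob P xi N <= C * L%:num ^- 3.
Proof.
have [c c0 low] := partial_sum_lower beta_gt0 (@ltr01 R).
have rho0 : 0 < rho by exact: critical_density_gt0.
have e0 := expR_gt0 (1 : R).
have i1 : 0 < rho^-1 by rewrite invr_gt0.
have i2 : 0 < expR 1 * rho / c by rewrite divr_gt0// mulr_gt0.
exists (rho^-1 + expR 1 * rho / c); split; first by rewrite addr_gt0.
move=> L N d T P xi L1 LN soup.
rewrite (particle_prob_cp beta_gt0 eigen soup (leqnn N)).
have L30 : 0 < L%:num ^+ 3 by exact: exprn_gt0.
have N0 := critical_number_gt0 L1 LN.
have := low L%:num N N L1 LN; rewrite mul1r gerBl sqr_ge0 => /(_ isT).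
have := partial_sum_le beta_gt0 N N L1.
have := harmonic_exp_ge R N; have := harmonic_exp_le R N0.
rewrite opprD expRD [expR (- \sum_(_ < _) _)]expRN [expR (- cp_exponent _ _)]expRN.
set hN := expR (\sum_(_ < _) _); set eA := expR (cp_exponent N _); set w := \sum_(i < _) _.
have hN0 : 0 < hN by exact: expR_gt0.
have eA0 : 0 < eA by exact: expR_gt0.
move: hN hN0 eA eA0 w => hN hN0 eA eA0 w h1 h2 wu wl.
have n0 : 0 < N%:R :> R by rewrite ltr0n.
have wl' : c <= eA^-1 * w by rewrite mulrC ler_pdivlMr.
have wu' : eA^-1 * w <= 1 by rewrite mulrC ler_pdivrMr// mul1r.
have hu : hN^-1 <= rho^-1 * L%:num ^- 3.
  by rewrite -invfM LN lef_pV2 ?posrE// (le_trans _ h2)// ler_nat.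
have hl : (expR 1 * rho)^-1 * L%:num ^- 3 <= hN^-1.
  by rewrite -invfM -mulrA LN lef_pV2 ?posrE// mulr_gt0.
have l30 : 0 < L%:num ^- 3 by rewrite invr_gt0.
rewrite -(mulrA hN^-1); apply/andP; split.
  apply: (@le_trans _ _ ((expR 1 * rho)^-1 * L%:num ^- 3 * c)).
    rewrite [leRHS]mulrAC ler_pM2r//.
    have -> : (expR 1 * rho)^-1 * c = (expR 1 * rho / c)^-1 by rewrite invf_div mulrC.
    by rewrite lef_pV2 ?posrE ?addr_gt0//; lra.
  by apply: ler_pM => //; [rewrite mulr_ge0// ?(ltW l30)// invr_ge0 mulr_ge0// ltW|exact: ltW].
have c1 : 0 <= eA^-1 * w by apply: le_trans wl'; exact: ltW.
have hi : 0 <= hN^-1 by rewrite invr_ge0 ltW.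
have : hN^-1 * (eA^-1 * w) <= hN^-1 * 1 by rewrite ler_wpM2l.
rewrite mulr1 => /le_trans; apply; apply: (le_trans hu).
by rewrite ler_pM2r//; lra.
Qed.

Section density_matrix.
Variables (L : {posnum R}) (N : nat) (d : measure_display).
Variables (T : measurableType d) (P : probability T R) (xi : T -> seq (loop L)).
Hypotheses (L1 : 1 <= L%:num) (LN : rho * L%:num ^+ 3 = N%:R).
Hypothesis soup : is_loop_soup lam phi beta N P xi.

Let h := beta * L%:num ^- 2.

Lemma reduced_density_matrixE x y :
  reduced_density_matrix lam phi beta N P xi x y =
  \sum_(j < N) L%:num ^- 3 *
    theta3 (4 * pi ^+ 2 * (h * j.+1%:R)) (L%:num^-1 *: x) (L%:num^-1 *: y) *
    (W L%:num N (N - j.+1) / W L%:num N N).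
Proof.
rewrite /reduced_density_matrix big_add1 /= big_mkord; apply: eq_bigr => j _.
rewrite (heat_kernel_unit L beta_gt0 eigen)// -mulrA; congr (_ * _).
rewrite !(particle_prob_cp beta_gt0 eigen soup) ?leq_subr//.
rewrite -/(W L%:num N N) -/(W L%:num N (N - j.+1)) -mulf_div divff ?mul1r//.
by rewrite gt_eqF// expR_gt0.
Qed.

Lemma torus_kernel_ge0 x y (j : nat) : cell L%:num x -> cell L%:num y ->
  0 <= theta3 (4 * pi ^+ 2 * (h * j.+1%:R)) (L%:num^-1 *: x) (L%:num^-1 *: y).
Proof.
move=> cx cy.
have t0 : 0 < beta * j.+1%:R by rewrite mulr_gt0.
have := heat_kernel_soup_ge0 soup cx cy t0.
by rewrite (heat_kernel_unit L beta_gt0 eigen)// pmulr_rge0// invr_gt0 exprn_gt0.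
Qed.

(* By [zeta (3 / 2) >= 1] and [N >= 1], the longest loops have rescaled time at least
   [1 / (4 * pi)], uniformly in [beta] and [L]. *)
Lemma last_time_ge2 : 2 <= 4 * pi ^+ 2 * (h * N%:R).
Proof.
have p0 := pi_gt0 R; have p2 := pi_ge2 R.
have z1 := zeta_ge1 R; set z : R := zeta (3 / 2) in z1.
have b4 : 0 < 4 * pi * beta by rewrite mulr_gt0// mulr_gt0.
set q := Num.sqrt (4 * pi * beta); have q0 : 0 < q by rewrite sqrtr_gt0.
have q2 : q ^+ 2 = 4 * pi * beta by rewrite sqr_sqrtr// ltW.
have rE : rho = q^-1 ^+ 3 * z by rewrite /rho /critical_density powR_neg32.
have L0 : 0 < L%:num by [].
have N1 : 1 <= N%:R :> R by rewrite ler1n (critical_number_gt0 L1 LN).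
have qz : q <= z * L%:num.
  have zL : 0 <= z * L%:num by rewrite mulr_ge0//; lra.
  rewrite leNgt; apply/negP => lt.
  have : (z * L%:num) ^+ 3 < q ^+ 3 by rewrite ltr_pXn2r// ?nnegrE// ltW.
  apply/negP; rewrite -leNgt.
  have -> : q ^+ 3 = q ^+ 3 * 1 by rewrite mulr1.
  apply: (@le_trans _ _ (q ^+ 3 * N%:R)); first by rewrite ler_pM2l// exprn_gt0.
  rewrite -LN rE.
  have -> : q ^+ 3 * (q^-1 ^+ 3 * z * L%:num ^+ 3) = z * L%:num ^+ 3.
    by field; rewrite gt_eqF.
  rewrite exprMn ler_wpM2r ?exprn_ge0// exprS ler_peMr//; first lra.
  by rewrite exprn_ege1.
have -> : 4 * pi ^+ 2 * (h * N%:R) = pi * (z * L%:num / q).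
  rewrite -LN rE /h.
  have -> : 4 * pi ^+ 2 * (beta * L%:num ^- 2 * (q^-1 ^+ 3 * z * L%:num ^+ 3)) =
     pi * (4 * pi * beta) * L%:num ^- 2 * (q^-1 ^+ 3 * z * L%:num ^+ 3) by ring.
  by rewrite -q2; field; rewrite !gt_eqF.
have : 1 <= z * L%:num / q by rewrite ler_pdivlMr// mul1r.
by nra.
Qed.
End density_matrix.

Lemma density_matrix_upper (eps : R) : 0 < eps -> exists2 C : R, 0 < C &
  forall (L : {posnum R}) (N : nat) (d : measure_display)
    (T : measurableType d) (P : probability T R) (xi : T -> seq (loop L)) (x y : R * R * R),
    1 <= L%:num -> rho * L%:num ^+ 3 = N%:R -> is_loop_soup lam phi beta N P xi ->
    eps * L%:num < torus_dist L%:num x y ->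
    reduced_density_matrix lam phi beta N P xi x y <= C * L%:num^-1.
Proof.
move=> e0; have [K K0 far] := theta3_far e0.
have [C3 C30 tot] := partial_sum_total beta_gt0.
have [c c0 low] := partial_sum_lower beta_gt0 (@ltr01 R).
exists (K * (C3 / c + 2 / beta)).
  by rewrite mulr_gt0// addr_gt0// divr_gt0.
move=> L N d T P xi x y L1 LN soup dxy.
rewrite (reduced_density_matrixE soup) -/rho.
set h := beta * L%:num ^- 2.
have L0 : 0 < L%:num by [].
have L20 : 0 < L%:num ^+ 2 by exact: exprn_gt0.
have h0 : 0 < h by rewrite mulr_gt0// invr_gt0.
have W0 n : 0 < W L%:num N n by apply: lt_le_trans (partial_sum_ge1 beta_gt0 N n L1).
have eA := expR_gt0 (A L%:num N).
have lowN : c * expR (A L%:num N) <= W L%:num N N.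
  by apply: low => //; rewrite mul1r gerBl sqr_ge0.
have totN := tot L%:num N L1 LN; rewrite -/(A L%:num N) in totN.
pose w j := W L%:num N (N - j.+1) / W L%:num N N.
have w0 j : 0 <= w j by rewrite divr_ge0// ltW.
have w1 j : w j <= 1 by rewrite ler_pdivrMr// mul1r partial_sum_nd// leq_subr.
have sw : \sum_(j < N) w j <= C3 / c * L%:num ^+ 2.
  rewrite /w -mulr_suml ler_pdivrMr//.
  have -> : \sum_(j < N) W L%:num N (N - j.+1) = \sum_(n < N) W L%:num N n.
    rewrite [RHS](reindex_inj rev_ord_inj) /=; apply: eq_bigr => j _; by [].
  apply: (le_trans totN).
  apply: (@le_trans _ _ (C3 / c * L%:num ^+ 2 * (c * expR (A L%:num N)))).
    by rewrite le_eqVlt; apply/orP; left; apply/eqP; field; rewrite gt_eqF.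
  by rewrite ler_pM2l// mulr_gt0// divr_gt0.
(* As w <= 1, (1 + decay) w <= w + decay, which decouples the kernel from the weights. *)
apply: (@le_trans _ _ (L%:num ^- 3 * K * \sum_(j < N) (w j + decay (h * j.+1%:R)))).
  rewrite mulr_sumr; apply: ler_sum => j _.
  have t0 : 0 < h * j.+1%:R by rewrite mulr_gt0.
  have fj := far (h * j.+1%:R) L%:num x y t0 L0 dxy; have dt := decay_gt0 t0.
  rewrite -/(w j); move: (w0 j) (w1 j) fj dt.
  move: (theta3 _ _ _) (w j) (decay _) => k v D v0 v1 fj dt.
  have l30 : 0 < L%:num ^- 3 by rewrite invr_gt0; exact: exprn_gt0.
  rewrite -(mulrA _ k) -(mulrA _ K) ler_pM2l//.
  apply: (le_trans (ler_wpM2r v0 fj)).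
  by rewrite -mulrA ler_pM2l// mulrDl mul1r lerD2l ler_piMr// ltW.
rewrite big_split /=.
have ds := decay_sum N h0.
apply: (@le_trans _ _ (L%:num ^- 3 * K * (C3 / c * L%:num ^+ 2 + 2 / h))).
  by rewrite ler_pM2l ?lerD// mulr_gt0// invr_gt0 exprn_gt0.
rewrite /h le_eqVlt; apply/orP; left; apply/eqP.
by field; rewrite !gt_eqF.
Qed.

Lemma density_matrix_lower : exists2 C : R, 0 < C &
  forall (L : {posnum R}) (N : nat) (d : measure_display)
    (T : measurableType d) (P : probability T R) (xi : T -> seq (loop L)) (x y : R * R * R),
    1 <= L%:num -> rho * L%:num ^+ 3 = N%:R -> is_loop_soup lam phi beta N P xi ->
    cell L%:num x -> cell L%:num y ->
    C * L%:num^-1 <= reduced_density_matrix lam phi beta N P xi x y.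
Proof.
have [T0 T00 late] := theta3_late R.
have rho0 : 0 < rho by exact: critical_density_gt0.
(* Adding [beta] makes z = tm L^2 / beta at least 1, so that rounding it up at most doubles it. *)
pose tm := T0 + beta.
have tm0 : 0 < tm by exact: addr_gt0.
(* The indices used are at most 2 m <= 4 z, so the particle numbers that remain are at least N -
   kappa L^2. *)
pose kappa := 4 * tm / beta.
have k0 : 0 < kappa by rewrite divr_gt0// mulr_gt0.
have [c c0 low] := partial_sum_lower beta_gt0 k0.
(* For larger [L] one has kappa L^2 <= N, so that the block from m to 2 m fits below [N]. *)
pose L0 := 1 + kappa / rho.
have L01 : 1 <= L0 by rewrite lerDl divr_ge0// ltW.
have [B B0 HB] := exponent_bound beta_gt0 L01.
pose c1 : R := 3^-1 ^+ 3 / B / L0 ^+ 2.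
have L020 : 0 < L0 ^+ 2 by apply: exprn_gt0; apply: lt_le_trans L01.
have third : 0 < 3^-1 ^+ 3 :> R by apply: exprn_gt0; rewrite invr_gt0.
have c10 : 0 < c1 by rewrite divr_gt0// divr_gt0.
pose c2 := tm * c / (2 * beta).
have c20 : 0 < c2 by rewrite divr_gt0// mulr_gt0.
exists (Num.min c1 c2) => [|L N d T P xi x y L1 LN soup cx cy]; first by rewrite lt_min c10.
rewrite (reduced_density_matrixE soup).
set h := beta * L%:num ^- 2.
have Lp : 0 < L%:num by [].
have L20 : 0 < L%:num ^+ 2 by exact: exprn_gt0.
have L30 : 0 < L%:num ^- 3 by rewrite invr_gt0 exprn_gt0.
have li : 0 < L%:num^-1 by rewrite invr_gt0.
have W0 n : 0 < W L%:num N n by apply: lt_le_trans (partial_sum_ge1 beta_gt0 N n L1).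
have WA : W L%:num N N <= expR (A L%:num N) by exact: partial_sum_le.
have eA := expR_gt0 (A L%:num N).
pose K j := theta3 (4 * pi ^+ 2 * (h * j.+1%:R)) (L%:num^-1 *: x) (L%:num^-1 *: y).
have K0 j : 0 <= K j by exact: torus_kernel_ge0 soup _ _ _ cx cy.
pose f j := L%:num ^- 3 * K j * (W L%:num N (N - j.+1) / W L%:num N N).
have f0 j : 0 <= f j by rewrite mulr_ge0// ?divr_ge0// ?(ltW (W0 _))// mulr_ge0// ltW.
have N0 := critical_number_gt0 L1 LN.
have [LL|LL] := leP L%:num L0.
  apply: (@le_trans _ _ (c1 * L%:num^-1)); first by rewrite ler_pM2r// ge_min lexx.
  (* The longest loops have a time bounded below by [last_time_ge2], and their quotient W_0 / W_N is
     at least 1 / B. *)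
  have jN : (N.-1 < N)%N by rewrite ltn_predL.
  apply: (@le_trans _ _ (f N.-1)); last first.
    by rewrite (bigD1 (Ordinal jN))//= lerDl; apply: sumr_ge0 => j _; exact: f0.
  have k1 : 3^-1 ^+ 3 <= K N.-1.
    by rewrite /K prednK//; apply: theta3_lower; exact: last_time_ge2 L1 LN.
  rewrite /f prednK// subnn.
  have EB : W L%:num N N <= B by apply: (le_trans WA); exact: HB.
  have w1 : B^-1 <= W L%:num N 0 / W L%:num N N.
    apply: (@le_trans _ _ (W L%:num N N)^-1); first by rewrite lef_pV2 ?posrE.
    by rewrite ler_peMl ?invr_ge0 ?(ltW (W0 _))//; exact: partial_sum_ge1.
  apply: (@le_trans _ _ (L%:num ^- 3 * 3^-1 ^+ 3 * B^-1)).
    have -> : L%:num ^- 3 * 3^-1 ^+ 3 * B^-1 = 3^-1 ^+ 3 / B / L%:num ^+ 2 * L%:num^-1.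
      by field; rewrite !gt_eqF.
    rewrite ler_pM2r// /c1 ler_pM2l ?divr_gt0// lef_pV2 ?posrE//.
    by rewrite lerXn2r ?nnegrE//; lra.
  apply: ler_pM => //; last by rewrite ler_pM2l.
  by rewrite invr_ge0 ltW.
apply: (@le_trans _ _ (c2 * L%:num^-1)); first by rewrite ler_pM2r// ge_min lexx orbT.
pose z := tm / beta * L%:num ^+ 2.
have tb : 1 <= tm / beta by rewrite ler_pdivlMr// mul1r /tm; lra.
have LL1 : 1 <= L%:num ^+ 2 by exact: exprn_ege1.
have z1 : 1 <= z by rewrite /z; nra.
have [m /andP[m1 m2]] : exists m : nat, z <= m%:R <= z + 1 by apply: nat_ceil; lra.
have m2k : 2 * m%:R <= kappa * L%:num ^+ 2.
  have -> : kappa * L%:num ^+ 2 = 4 * z by rewrite /kappa /z; ring.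
  by lra.
have kN : kappa * L%:num ^+ 2 <= N%:R.
  rewrite -LN (exprS _ 2) (mulrA rho) ler_pM2r//.
  by rewrite mulrC -ler_pdivrMr//; rewrite /L0 in LL; lra.
have mN : (2 * m <= N)%N by rewrite -(ler_nat R) natrM; lra.
apply: (@le_trans _ _ (m%:R * (L%:num ^- 3 * (1 / 2) * c))).
  apply: (@le_trans _ _ (z * (L%:num ^- 3 * (1 / 2) * c))).
    rewrite /c2 /z le_eqVlt; apply/orP; left; apply/eqP.
    by field; rewrite !gt_eqF.
  by rewrite ler_wpM2r// mulr_ge0 ?mulr_ge0 ?(ltW L30) ?(ltW c0).
apply: (@block_sum R f) => // j /andP[j1 j2].
have jN : (j < N)%N by exact: leq_trans mN.
rewrite /f; apply: ler_pM.
- by rewrite mulr_ge0// ltW.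
- exact: ltW.
- rewrite ler_pM2l//; apply: late.
  apply: (@le_trans _ _ (h * z)).
    have -> : h * z = tm by rewrite /h /z; field; rewrite !gt_eqF.
    by rewrite /tm lerDl ltW.
  rewrite ler_pM2l ?mulr_gt0 ?invr_gt0//; apply: (le_trans m1).
  by rewrite ler_nat ltnW.
have wl : c * expR (A L%:num N) <= W L%:num N (N - j.+1).
  apply: low => //; rewrite natrB// lerB//; apply: le_trans m2k.
  by rewrite -natrM ler_nat.
rewrite ler_pdivlMr//; apply: le_trans wl.
by rewrite ler_pM2l.
Qed.
End critical_loop_soup.

Theorem theorem3 (R : realType) (beta : R) (lam : nat -> R)
    (phi : nat -> R * R * R -> R) :
  0 < beta -> laplace_eigenbasis lam phi ->
  (exists C : R, 0 < C /\
    forall (L : {posnum R}) (N : nat) (d : measure_display)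
      (T : measurableType d) (P : probability T R) (xi : T -> seq (loop L)),
      1 <= L%:num -> critical_density beta * L%:num ^+ 3 = N%:R ->
      is_loop_soup lam phi beta N P xi ->
      C^-1 * L%:num ^- 3 <= particle_prob P xi N <= C * L%:num ^- 3) /\
  (forall eps : R, 0 < eps -> exists C : R, 0 < C /\
    forall (L : {posnum R}) (N : nat) (d : measure_display)
      (T : measurableType d) (P : probability T R) (xi : T -> seq (loop L))
      (x y : R * R * R),
      1 <= L%:num -> critical_density beta * L%:num ^+ 3 = N%:R ->
      is_loop_soup lam phi beta N P xi ->
      cell L%:num x -> cell L%:num y -> torus_dist L%:num x y > eps * L%:num ->
      C^-1 * L%:num ^-1 <=
        reduced_density_matrix lam phi beta N P xi x y <= C * L%:num ^-1).
Proof.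
move=> b0 B; split; first exact: critical_prob_bounds.
move=> eps e0; have [C1 C10 up] := density_matrix_upper b0 B e0.
have [C2 C20 lo] := density_matrix_lower b0 B.
have C2i : 0 < C2^-1 by rewrite invr_gt0.
exists (C1 + C2^-1); split; first exact: addr_gt0.
move=> L N d T P xi x y L1 LN soup cx cy dxy.
have li : 0 < L%:num^-1 by rewrite invr_gt0.
apply/andP; split; last first.
  by apply: (le_trans (up _ _ _ _ _ _ _ _ L1 LN soup dxy)); rewrite ler_pM2r// lerDl ltW.
apply: le_trans (lo _ _ _ _ _ _ _ _ L1 LN soup cx cy).
rewrite ler_pM2r// -[leRHS]invrK lef_pV2 ?posrE ?addr_gt0// lerDr ltW//.
Qed.
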